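(* Let $\Gamma$ be a compact quantum graph with $E$ edges, each edge $e$ being given an orientation and the corresponding arc-length coordinate $x_e$. Consider the operator on $\Gamma$ defined by the differential expression of order $m$ $$T=\sum_{j=0}^m c_j(x_e)\,\frac{d^{m-j}}{dx_e^{m-j}}$$ with $c_0$ continuous on each closed edge (but not necessarily on the whole graph) and never equal to $0$, and all other $c_j$ measurable and bounded. Let $T_1$ be the restriction of $T$, as an operator from $\bigoplus_eH^m(e)$ into $L^2(\Gamma)$, to a closed subspace of $\bigoplus_e H^m(e)$ of finite codimension $p$ (for example, the subspace defined by imposing $p$ independent linear vertex conditions involving derivatives up to order $m-1$). Then: (i) The operator $T_1$ is Fredholm. (ii) $\operatorname{index}T_1=mE-p$.
   Context: A compact quantum graph $\Gamma$ is a metric graph (multiple edges and loops allowed) with finitely many vertices and finitely many edges ($E$ of them), each edge $e$ being identified with an interval of finite positive length. $H^m(e)$ is the Sobolev space of order $m$ on $e$, and $L^2(\Gamma)=\bigoplus_eL^2(e)$ (complex-valued functions). A bounded operator $T\colon H_1\to H_2$ between Hilbert spaces is Fredholm if its range is closed and $\dim\ker T$ and $\operatorname{codim}\operatorname{ran}T$ are finite; then $\operatorname{index}T=\dim\ker T-\operatorname{codim}\operatorname{ran}T$. *)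

(* Defs.v *)
From HB Require Import structures.
From mathcomp Require Import all_boot all_order all_algebra.
From mathcomp Require Import all_classical all_reals all_analysis.
From mathcomp Require Import complex.

Set Implicit Arguments.
Unset Strict Implicit.
Unset Printing Implicit Defensive.

Import Order.TTheory GRing.Theory Num.Theory.
Import numFieldNormedType.Exports.

Local Open Scope classical_set_scope.
Local Open Scope ring_scope.
Local Open Scope complex_scope.

(** * Fredholm operators *)

Definition is_subspace (C : fieldType) (V : lmodType C) (A : set V) :=
  A 0 /\ forall (a : C) (u v : V), A u -> A v -> A (a *: u + v).

(** [A / B] has dimension [n]: there are [n] vectors of [A] whose classes modulo
    the subspace [B] form a basis. *)
Definition has_quotient_dim (C : fieldType) (V : lmodType C) (A B : set V)
    (n : nat) :=
  exists b : 'I_n -> V,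
    [/\ forall i, A (b i),
        forall u, A u -> exists k : 'I_n -> C, B (u - \sum_(i < n) k i *: b i)
      & forall k : 'I_n -> C,
          B (\sum_(i < n) k i *: b i) -> forall i, k i = 0].

Definition quotient_dim (C : fieldType) (V : lmodType C) (A B : set V) : nat :=
  xget 0%N [set n | has_quotient_dim A B n].

(** Function spaces are handled through representatives: a [seminormed] stands
    for the normed space [carrier / null], where [carrier] is a subspace of
    [ambient] on which [seminorm] is a seminorm.  No property of [seminorm]
    outside [carrier] is ever used, and all the notions below are those of the
    quotient space. *)
Record seminormed (R : realType) := Seminormed {
  ambient : lmodType R[i];
  carrier : set ambient;
  seminorm : ambient -> R }.

Section fredholm.
Variable R : realType.
Implicit Types X Y : seminormed R.

Definition null X : set (ambient X) :=
  [set u | carrier u /\ seminorm u = 0].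

Definition restriction X (D : set (ambient X)) : seminormed R :=
  Seminormed D (@seminorm _ X).

Definition closed_in X (D : set (ambient X)) :=
  D `<=` @carrier _ X /\
  forall u : ambient X, carrier u ->
    (forall eps : R, 0 < eps -> exists2 v, D v & seminorm (u - v) < eps) -> D u.

Definition bounded_operator X Y (T : ambient X -> ambient Y) :=
  [/\ forall u, carrier u -> carrier (T u),
      forall (a : R[i]) u v, carrier u -> carrier v ->
        seminorm (T (a *: u + v) - (a *: T u + T v)) = 0
    & exists M : R, forall u, carrier u -> seminorm (T u) <= M * seminorm u].

Definition kernel X Y (T : ambient X -> ambient Y) : set (ambient X) :=
  [set u | carrier u /\ seminorm (T u) = 0].

Definition operator_range X Y (T : ambient X -> ambient Y) : set (ambient Y) :=
  [set w | carrier w /\ exists2 u, carrier u & seminorm (w - T u) = 0].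

Definition fredholm X Y (T : ambient X -> ambient Y) :=
  [/\ bounded_operator T,
      closed_in (operator_range T),
      exists n, has_quotient_dim (kernel T) (@null X) n
    & exists n, has_quotient_dim (@carrier _ Y) (operator_range T) n].

Definition fredholm_index X Y (T : ambient X -> ambient Y) : int :=
  (quotient_dim (kernel T) (@null X))%:Z
  - (quotient_dim (@carrier _ Y) (operator_range T))%:Z.

End fredholm.

(** * Functions on an interval [[0, L]]

    A function on [[0, L]] is represented by a function [R -> R[i]] whose values
    outside [[0, L]] are irrelevant.  Measurability and integrals refer to the
    Lebesgue sigma-algebra and its complete measure; the library's
    [lebesgue_measure] is its restriction to the Borel sets. *)

Section interval.
Variable R : realType.
Implicit Types (L : R) (f g u : R -> R[i]) (phi : R -> R).

Local Notation mu := (@completed_lebesgue_measure R).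

(** [R] with the sigma-algebra of Lebesgue measurable sets. *)
Local Notation lebesgueR := (caratheodory_type (wlength (@idfun R))^*%mu).

Definition lebesgue_measurable L f :=
  measurable_fun (`[0, L] : set lebesgueR) (fun x => complex.Re (f x)) /\
  measurable_fun (`[0, L] : set lebesgueR) (fun x => complex.Im (f x)).

Definition complex_integral L f : R[i] :=
  (\int[mu]_(x in `[0, L]) complex.Re (f x)) +i*
  (\int[mu]_(x in `[0, L]) complex.Im (f x)).

Definition square_integrable L : set (R -> R[i]) :=
  [set f | lebesgue_measurable L f /\
    (\int[mu]_(x in (`[0%R, L]%classic : set lebesgueR))
       (Normc.normc (f x) ^+ 2)%:E < +oo)%E].

Definition L2_norm L f : R :=
  Num.sqrt (\int[mu]_(x in `[0, L]) Normc.normc (f x) ^+ 2).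

(** The real-valued smooth functions with compact support in [(0, L)] (complex
    test functions give the same weak derivatives, by linearity). *)
Definition test_function L phi :=
  (forall n x, derivable (derive1n n phi) x 1) /\
  closure [set x | phi x != 0] `<=` `]0, L[.

Definition is_weak_derivative L (k : nat) f g :=
  forall phi, test_function L phi ->
    complex_integral L (fun x => f x * (derive1n k phi x)%:C) =
    (-1) ^+ k * complex_integral L (fun x => g x * (phi x)%:C).

(** A representative of the [k]-th weak derivative, which is unique up to
    equality almost everywhere. *)
Definition weak_derivative L (k : nat) f : R -> R[i] :=
  xget 0 [set g | square_integrable L g /\ is_weak_derivative L k f g].

Definition sobolev L (m : nat) : set (R -> R[i]) :=
  [set u | square_integrable L u /\
    forall k, (k <= m)%N ->
      exists2 g, square_integrable L g & is_weak_derivative L k u g].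

Definition sobolev_norm L (m : nat) u : R :=
  Num.sqrt (\sum_(k < m.+1) L2_norm L (weak_derivative L k u) ^+ 2).

End interval.

(** * Compact quantum graphs *)

(** The edge [e] is identified with [[0, length e]], the coordinate running from
    [source e] to [target e]; loops and multiple edges are allowed. *)
Record quantum_graph (R : realType) := QuantumGraph {
  vertex : finType;
  edge : finType;
  source : edge -> vertex;
  target : edge -> vertex;
  length : edge -> R;
  length_gt0 : forall e, 0 < length e }.

Section graph.
Variables (R : realType) (G : quantum_graph R).

Definition L2_graph : seminormed R :=
  @Seminormed R (edge G -> R -> R[i])
    [set u | forall e, square_integrable (length e) (u e)]
    (fun u => Num.sqrt (\sum_e L2_norm (length e) (u e) ^+ 2)).

Definition sobolev_graph (m : nat) : seminormed R :=
  @Seminormed R (edge G -> R -> R[i])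
    [set u | forall e, sobolev (length e) m (u e)]
    (fun u => Num.sqrt (\sum_e sobolev_norm (length e) m (u e) ^+ 2)).

Definition differential_operator (m : nat)
    (c : 'I_m.+1 -> edge G -> R -> R[i]) (u : edge G -> R -> R[i]) :
    edge G -> R -> R[i] :=
  fun e x =>
    \sum_(j < m.+1) c j e x * weak_derivative (length e) (m - j) (u e) x.

End graph.

(* Main.v *)
(** On an edge, a function of [H^m] is, up to its [m] constants of integration
    [a], the [m]-fold primitive of its top derivative [w].  In terms of [(a, w)],
    the equation [T u = f] reads [w + V w = g] for a Volterra operator [V], and is
    uniquely solvable for [w] once [a] and [f] are given.  On the whole space
    [T] is therefore onto, has a bounded right inverse and a kernel of dimension
    [n = m * E].

    Now let [D] have codimension [p].  Since [D] is closed and [ker T] is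
    finite-dimensional, [D + ker T] is closed, and so is [T D] by the bounded
    right inverse.  If [r] is the rank of the map [ker T -> X / D], then [T] on [D]
    has kernel [D /\ ker T] of dimension [n - r] and range [T (D + ker T)] of
    codimension [p - r]. *)

Require Import Defs.
From HB Require Import structures.
From mathcomp Require Import all_boot all_order all_algebra.
From mathcomp Require Import all_classical all_reals all_analysis.
From mathcomp Require Import measurable_realfun complex.
From mathcomp Require Import ring lra.

Set Implicit Arguments.
Unset Strict Implicit.
Unset Printing Implicit Defensive.

Import Order.TTheory GRing.Theory Num.Theory.
Import numFieldNormedType.Exports.

Local Open Scope classical_set_scope.
Local Open Scope ring_scope.
Local Open Scope complex_scope.

(** Vectors are representatives: [weak_derivative] picks an arbitrary member of a class of almost
    everywhere equal functions, so [T] is linear only modulo null functions, and the linear algebra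
    is carried out modulo subspaces. On an edge, real analysis enters through two facts: a function
    with an integrable weak derivative is a primitive of it up to a constant (du Bois-Reymond),
    which gives the coordinates [(a, w)]; and the primitive [CJ w] has weak derivative [w], which is
    Fubini's theorem on a triangle. Since [f] and the lower coefficients are merely measurable, [w]
    is in general not continuous, and the Volterra equation is solved among integrable functions, at
    every point of [[0, L]]. This works because [V] maps integrable functions to bounded ones: all
    terms of the Neumann series but the first are bounded, and their sum converges uniformly. Square
    integrability of [w] then follows from that of [g], as [w - g] is bounded. *)

(** * Linear algebra modulo a subspace *)

Section subspaces.
Variables (C : fieldType) (V : lmodType C).
Implicit Types (A B : set V) (u v : V).

Lemma subspace0 B : is_subspace B -> B 0.
Proof. by case. Qed.

Lemma subspaceD B u v : is_subspace B -> B u -> B v -> B (u + v).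
Proof. by case=> _ + Bu Bv => /(_ 1 u v Bu Bv); rewrite scale1r. Qed.

Lemma subspaceZ B a u : is_subspace B -> B u -> B (a *: u).
Proof. by case=> B0 + Bu => /(_ a u 0 Bu B0); rewrite addr0. Qed.

Lemma subspaceB B u v : is_subspace B -> B u -> B v -> B (u - v).
Proof.
move=> sB Bu Bv; rewrite -scaleN1r; apply: subspaceD => //.
exact: subspaceZ.
Qed.

Lemma subspace_sum B (I : Type) (s : seq I) (F : I -> V) :
  is_subspace B -> (forall i, B (F i)) -> B (\sum_(i <- s) F i).
Proof.
move=> sB BF; elim/big_ind : _ => //; first exact: subspace0.
by move=> *; exact: subspaceD.
Qed.

Definition congr_mod B u v := B (u - v).

Section congr_mod.
Variables (B : set V) (sB : is_subspace B).

Lemma congr_refl u : congr_mod B u u.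
Proof. by rewrite /congr_mod subrr; exact: subspace0. Qed.

Lemma congrZ a u v : congr_mod B u v -> congr_mod B (a *: u) (a *: v).
Proof. by rewrite /congr_mod -scalerBr; exact: subspaceZ. Qed.

Lemma congr_sym u v : congr_mod B u v -> congr_mod B v u.
Proof. by move=> /(subspaceZ (-1) sB); rewrite scaleN1r opprB. Qed.

Lemma congr_trans v u w : congr_mod B u v -> congr_mod B v w -> congr_mod B u w.
Proof. by move=> uv /(subspaceD sB uv); rewrite addrA subrK. Qed.

Lemma congrD u v u' v' :
  congr_mod B u v -> congr_mod B u' v' -> congr_mod B (u + u') (v + v').
Proof.
by move=> uv /(subspaceD sB uv); rewrite /congr_mod opprD addrACA.
Qed.

Lemma congrB u v u' v' :
  congr_mod B u v -> congr_mod B u' v' -> congr_mod B (u - u') (v - v').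
Proof.
by move=> uv u'v'; apply: congrD => //; rewrite -!scaleN1r; exact: congrZ.
Qed.

Lemma congr_sum (I : Type) (s : seq I) (F G : I -> V) :
  (forall i, congr_mod B (F i) (G i)) ->
  congr_mod B (\sum_(i <- s) F i) (\sum_(i <- s) G i).
Proof.
move=> FG; elim/big_ind2 : _ => //; first exact: congr_refl.
by move=> *; exact: congrD.
Qed.

Lemma congr_mod0 u : congr_mod B u 0 <-> B u.
Proof. by rewrite /congr_mod subr0. Qed.

Lemma congr_in A u v : is_subspace A -> B `<=` A -> congr_mod B u v -> A v -> A u.
Proof.
by move=> sA BA uv Av; rewrite -(subrK v u); apply: subspaceD => //; exact: BA.
Qed.

End congr_mod.

(** Coefficients form a row vector so that a change of generators is a matrix product, as in
    [lincomb_mulmx]. *)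
Definition lincomb n (k : 'rV[C]_n) (b : 'I_n -> V) := \sum_i k 0 i *: b i.

Lemma lincomb_mulmx n p (k : 'rV[C]_n) (M : 'M[C]_(n, p)) (b : 'I_p -> V) :
  lincomb (k *m M) b = lincomb k (fun i => lincomb (row i M) b).
Proof.
rewrite /lincomb; under eq_bigr do rewrite mxE scaler_suml.
rewrite exchange_big/=; apply: eq_bigr => i _; rewrite scaler_sumr.
by apply: eq_bigr => j _; rewrite mxE scalerA.
Qed.

Lemma lincombD n (k l : 'rV[C]_n) (b : 'I_n -> V) :
  lincomb (k + l) b = lincomb k b + lincomb l b.
Proof.
by rewrite /lincomb -big_split; apply: eq_bigr => i _; rewrite mxE scalerDl.
Qed.

Lemma lincombB n (k l : 'rV[C]_n) (b : 'I_n -> V) :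
  lincomb (k - l) b = lincomb k b - lincomb l b.
Proof.
rewrite lincombD; congr (_ + _); rewrite /lincomb -sumrN.
by apply: eq_bigr => i _; rewrite mxE scaleNr.
Qed.

Lemma lincomb_row n (k : 'I_n -> C) (b : 'I_n -> V) :
  \sum_i k i *: b i = lincomb (\row_i k i) b.
Proof. by apply: eq_bigr => i _; rewrite mxE. Qed.

(** The coordinates of [b'] on [b] modulo [B] form a matrix with [n'] rows and [n] columns. A row
    vector annihilating it would be a linear relation among the [b' i] modulo [B], so its rows are
    independent. *)
Lemma leq_quotient_dim A B n n' : is_subspace B ->
  has_quotient_dim A B n -> has_quotient_dim A B n' -> (n' <= n)%N.
Proof.
move=> sB [b [_ bgen _]] [b' [Ab' _ b'free]].
have /choice[k kE] i := bgen _ (Ab' i).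
pose M : 'M[C]_(n', n) := \matrix_(i, j) k i j.
suff /eqP <- : row_free M by exact: rank_leq_col.
apply: inj_row_free => v vM0; apply/rowP => i; rewrite mxE.
apply: (b'free (fun i => v 0 i)); under eq_bigr => j _.
  rewrite -[b' j](subrK (\sum_l k j l *: b l)) scalerDr; over.
rewrite big_split /=; apply: subspaceD => //.
  by apply: subspace_sum => // j; exact: subspaceZ.
have -> : \sum_j v 0 j *: \sum_l k j l *: b l = 0; last exact: subspace0.
under eq_bigr do rewrite scaler_sumr.
rewrite exchange_big big1//= => l _.
under eq_bigr do rewrite scalerA.
rewrite -scaler_suml; move/rowP : vM0 => /(_ l); rewrite !mxE.
by under eq_bigr do rewrite mxE; move=> ->; rewrite scale0r.
Qed.

Lemma quotient_dimE A B n : is_subspace B -> has_quotient_dim A B n ->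
  quotient_dim A B = n.
Proof.
move=> sB An; rewrite /quotient_dim; case: xgetP => [k _ /= Ak|/(_ n)//].
by apply/eqP; rewrite eqn_leq; apply/andP; split; apply: leq_quotient_dim; eauto.
Qed.

End subspaces.

(** * Quasi-seminormed spaces and their closed subspaces *)

Section quasi_seminorm.
Variable R : realType.
Implicit Types X Y : seminormed R.

(* With the factor [2], sums of squared norms qualify through
   [|z + w|^2 <= 2 |z|^2 + 2 |w|^2] alone, without Minkowski's inequality. *)
Definition quasi_seminormed X := [/\ is_subspace (@carrier _ X),
  forall u : ambient X, 0 <= seminorm u,
  forall u v : ambient X, carrier u -> carrier v ->
    seminorm (u + v) <= 2 * (seminorm u + seminorm v) &
  forall (a : R[i]) (u : ambient X), carrier u ->
    seminorm (a *: u) = Normc.normc a * seminorm u].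

Lemma normc_ge0 (z : R[i]) : 0 <= Normc.normc z.
Proof. by case: z => x y; rewrite sqrtr_ge0. Qed.

Lemma normc_le_ReIm (z : R[i]) :
  Normc.normc z <= `|complex.Re z| + `|complex.Im z|.
Proof.
case: z => x y /=; rewrite -[leRHS]ger0_norm ?addr_ge0// -sqrtr_sqr.
rewrite ler_sqrt ?sqr_ge0// sqrrD !real_normK ?num_real//.
by rewrite lerD2r lerDl mulrn_wge0// mulr_ge0.
Qed.

Lemma ReIm_le_normc (z : R[i]) :
  `|complex.Re z| <= Normc.normc z /\ `|complex.Im z| <= Normc.normc z.
Proof.
by case: z => x y /=; split; rewrite -sqrtr_sqr ler_sqrt ?addr_ge0 ?sqr_ge0//;
  rewrite ?lerDl ?lerDr sqr_ge0.
Qed.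

Section theory.
Variables (X : seminormed R) (qX : quasi_seminormed X).
Implicit Types (u v : ambient X) (D : set (ambient X)).
Let sX : is_subspace (@carrier _ X) := let: And4 h _ _ _ := qX in h.

Lemma seminorm_ge0 u : 0 <= seminorm u.
Proof. by case: qX. Qed.

Lemma le_seminormD u v : carrier u -> carrier v ->
  seminorm (u + v) <= 2 * (seminorm u + seminorm v).
Proof. by case: qX => _ _ + _; exact. Qed.

Lemma seminormZ a u : carrier u ->
  seminorm (a *: u) = Normc.normc a * seminorm u.
Proof. by case: qX => _ _ _; exact. Qed.

Lemma seminorm0 : seminorm (0 : ambient X) = 0.
Proof.
by rewrite -(scale0r 0) seminormZ ?Normc.normc0 ?mul0r//; exact: subspace0.
Qed.

Lemma seminormN u : carrier u -> seminorm (- u) = seminorm u.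
Proof.
by move=> Xu; rewrite -scaleN1r seminormZ// normcN Normc.normc1 mul1r.
Qed.

Lemma le_seminormB u v : carrier u -> carrier v ->
  seminorm (u - v) <= 2 * (seminorm u + seminorm v).
Proof.
move=> Xu Xv; rewrite (le_trans (le_seminormD _ _))// ?seminormN//.
by rewrite -scaleN1r; exact: subspaceZ.
Qed.

Lemma null_subspace : is_subspace (@null _ X).
Proof.
split=> [|a u v [Xu u0] [Xv v0]].
  by split; [exact: subspace0|exact: seminorm0].
have Xau := subspaceZ a sX Xu.
split; first exact: subspaceD.
apply/eqP; rewrite eq_le seminorm_ge0 andbT (le_trans (le_seminormD _ _))//.
by rewrite seminormZ// u0 v0 mulr0 addr0 mulr0.
Qed.

(** The intervals of centre [a n] and radius [K * e n] meet pairwise, so the supremum of their left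
    ends lies in all of them; the rate comes together with the limit. *)
Lemma real_cauchy_limit (a e : R^nat) (K : R) :
  (forall n m, `|a n - a m| <= K * (e n + e m)) ->
  exists l, forall n, `|a n - l| <= K * e n.
Proof.
move=> aE; pose A := range (fun n => a n - K * e n).
have A0 : A !=set0 by exists (a 0%N - K * e 0%N), 0%N.
have ubA m : ubound A (a m + K * e m).
  move=> _ [n _ <-]; have := aE n m; rewrite ler_norml => /andP[_].
  by rewrite mulrDr; lra.
exists (sup A) => n.
have h1 : sup A <= a n + K * e n by exact: ge_sup.
have h2 : a n - K * e n <= sup A.
  by apply: ub_le_sup; [exists (a 0%N + K * e 0%N); exact: ubA|exists n].
by rewrite ler_norml; lra.
Qed.

(** A vector [v] outside the closed [D] is at distance at least [delta > 0] from [D], and this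
    controls the coefficient of [v] in a sum [d + a *: v] by the norm of the sum. Hence the
    coefficients of approximants of [u] are Cauchy, and their limit [a] puts [u - a *: v] in the
    closure of [D]. *)
Lemma closed_in_add_line D v : is_subspace D -> closed_in D -> carrier v ->
  closed_in [set u | exists a : R[i], D (u - a *: v)].
Proof.
move=> sD [DX Dcl] Xv; have ZX a : carrier (a *: v) by exact: subspaceZ.
split=> [u [a /DX Xu]|u Xu uE].
  by rewrite -(subrK (a *: v) u); exact: subspaceD.
have [Dv|nDv] := pselect (D v).
  exists 0; rewrite scale0r subr0; apply: Dcl => // eps /uE[w [a Dw] wu].
  by exists w => //; rewrite -(subrK (a *: v) w); apply: subspaceD => //; exact: subspaceZ.
have [delta delta0 vD] : exists2 delta : R, 0 < delta &
    forall d, D d -> delta <= seminorm (v - d).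
  apply: contrapT => nex; apply: nDv; apply: Dcl => // eps eps0.
  apply: contrapT => nd; apply: nex; exists eps => // d Dd.
  by rewrite leNgt; apply/negP => ?; apply: nd; exists d.
have dist a d : D d -> Normc.normc a * delta <= seminorm (a *: v - d).
  move=> Dd; have [->|a0] := eqVneq a 0.
    by rewrite Normc.normc0 mul0r seminorm_ge0.
  have Dad : D (a^-1 *: d) by exact: subspaceZ.
  rewrite (_ : a *: v - d = a *: (v - a^-1 *: d)); last first.
    by rewrite scalerBr scalerA divff// scale1r.
  rewrite seminormZ; last by apply: subspaceB => //; exact: DX.
  rewrite ler_wpM2l ?vD//; exact: normc_ge0.
pose e n : R := n.+1%:R^-1.
have e0 n : 0 < e n by rewrite invr_gt0 ltr0n.
have /choice[w wE] n : exists w : R[i] * ambient X,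
    D w.2 /\ seminorm (u - (w.2 + w.1 *: v)) < e n.
  have [w [a Dw] wu] := uE _ (e0 n).
  by exists (a, w - a *: v); rewrite /= subrK.
have Xw n : carrier (u - ((w n).2 + (w n).1 *: v)).
  apply: subspaceB => //; apply: subspaceD => //; apply: DX; exact: (wE n).1.
(* Two approximants of [u] differ by at most [2 * (e n + e m)] in norm, by the quasi-triangle
   inequality; [dist] then divides by [delta]. *)
have wC n m : Normc.normc ((w n).1 - (w m).1) <= 2 / delta * (e n + e m).
  rewrite mulrAC ler_pdivlMr// (le_trans (dist _ ((w m).2 - (w n).2) _))//.
    by apply: subspaceB => //; [exact: (wE m).1|exact: (wE n).1].
  rewrite (_ : _ - _ = (u - ((w m).2 + (w m).1 *: v)) -
      (u - ((w n).2 + (w n).1 *: v))); last first.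
    rewrite [in RHS]opprB [RHS]addrC addrA subrK [in RHS]opprD addrACA [RHS]addrC.
    by rewrite scalerBl opprB.
  apply: (le_trans (le_seminormB _ _)) => //.
  rewrite ler_pM2l// addrC lerD// ltW//; [exact: (wE n).2|exact: (wE m).2].
have [x xE] : exists x, forall n, `|complex.Re (w n).1 - x| <= 2 / delta * e n.
  apply: real_cauchy_limit => n m; apply: le_trans (wC n m).
  by apply: le_trans (ReIm_le_normc _).1; case: (w n).1; case: (w m).1.
have [y yE] : exists y, forall n, `|complex.Im (w n).1 - y| <= 2 / delta * e n.
  apply: real_cauchy_limit => n m; apply: le_trans (wC n m).
  by apply: le_trans (ReIm_le_normc _).2; case: (w n).1; case: (w m).1.
exists (x +i* y); apply: Dcl; first exact: subspaceB.
move=> eps eps0.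
(* The outer 2 is the quasi-triangle factor; [4 / delta] adds the errors [2 / delta] on the real and
   on the imaginary part of the coefficient. *)
pose K := 2 * (1 + 4 / delta * seminorm v).
have K0 : 0 < K.
  rewrite mulr_gt0// ltr_wpDr// !mulr_ge0// ?seminorm_ge0// invr_ge0 ltW//.
have [n nE] : exists n, K * e n < eps.
  have [n nE] : exists n : nat, K / eps < n.+1%:R.
    exists (Num.trunc (K / eps)); exact: truncnS_gt.
  by exists n; rewrite /e ltr_pdivrMr ?ltr0n// mulrC -ltr_pdivrMr.
exists (w n).2; first exact: (wE n).1.
apply: le_lt_trans nE.
rewrite (_ : _ - _ = (u - ((w n).2 + (w n).1 *: v)) +
    ((w n).1 - (x +i* y)) *: v); last first.
  rewrite scalerBl opprD !addrA subrK; by rewrite addrAC.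
apply: (le_trans (le_seminormD _ _)) => //.
rewrite /K -mulrA ler_pM2l// mulrDl mul1r lerD ?(ltW (wE n).2)//.
rewrite seminormZ// mulrAC ler_wpM2r ?seminorm_ge0//.
rewrite (le_trans (normc_le_ReIm _))//.
have -> : 4 / delta * e n = 2 / delta * e n + 2 / delta * e n by ring.
by apply: lerD; [apply: le_trans (xE n)|apply: le_trans (yE n)];
  case: (w n).1.
Qed.

(** Induction on [n]: the span of the first vectors together with [D] is a closed subspace, to which
    the line of the last vector is added. *)
Lemma closed_in_add_span D n (b : 'I_n -> ambient X) :
  is_subspace D -> closed_in D -> (forall i, carrier (b i)) ->
  closed_in [set u | exists k : 'I_n -> R[i], D (u - \sum_i k i *: b i)].
Proof.
elim: n b => [|n IHn] b sD Dcl Xb.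
  rewrite (_ : [set u | _] = D)//; apply/seteqP; split=> u /=.
    by case=> k; rewrite big_ord0 subr0.
  by move=> Du; exists (fun=> 0); rewrite big_ord0 subr0.
set E := [set u | exists k : 'I_n -> R[i],
  D (u - \sum_i k i *: b (widen_ord (leqnSn n) i))].
have Ecl : closed_in E by exact: IHn.
have sE : is_subspace E.
  split=> [|a u v [k uk] [l vl]].
    exists (fun=> 0); rewrite big1 ?subr0; first exact: subspace0.
    by move=> i _; rewrite scale0r.
  exists (fun i => a * k i + l i).
  rewrite (_ : _ - _ = a *: (u - \sum_i k i *: b (widen_ord (leqnSn n) i)) +
     (v - \sum_i l i *: b (widen_ord (leqnSn n) i))); last first.
    rewrite scalerBr scaler_sumr addrACA -opprD -big_split/=; congr (_ - _).
    by apply: eq_bigr => i _; rewrite scalerDl scalerA.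
  by case: sD => _; apply.
have := closed_in_add_line sE Ecl (Xb ord_max).
rewrite (_ : [set u | _] =
  [set u | exists k : 'I_n.+1 -> R[i], D (u - \sum_i k i *: b i)])//.
apply/seteqP; split=> u /=.
  move=> [a [k uk]].
  exists (fun i => if unlift ord_max i is Some j then k j else a).
  rewrite big_ord_recr/= unlift_none.
  rewrite (eq_bigr (fun i => k i *: b (widen_ord (leqnSn n) i))); last first.
    move=> i _; rewrite (_ : widen_ord _ i = lift ord_max i) ?liftK//.
    by apply: val_inj; rewrite /= /bump leqNgt ltn_ord.
  by rewrite opprD addrA addrAC in uk *.
move=> [k]; rewrite big_ord_recr/= opprD addrA addrAC => uk.
by exists (k ord_max), (fun i => k (widen_ord (leqnSn n) i)).
Qed.

End theory.

End quasi_seminorm.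

(** * Restriction of a surjective operator to a closed subspace of finite codimension *)

Section fredholm_restriction.
Variables (R : realType) (X Y : seminormed R) (T : ambient X -> ambient Y).
Hypotheses (qX : quasi_seminormed X) (qY : quasi_seminormed Y).
Hypothesis T_bounded : bounded_operator T.

Let sX : is_subspace (@carrier _ X) := let: And4 h _ _ _ := qX in h.
Let sY : is_subspace (@carrier _ Y) := let: And4 h _ _ _ := qY in h.
Let nX : is_subspace (@null _ X) := null_subspace qX.
Let nY : is_subspace (@null _ Y) := null_subspace qY.
Local Notation eqv := (congr_mod (@null _ Y)).

Let TX u : carrier u -> carrier (T u).
Proof. by case: T_bounded => + _ _; exact. Qed.

Let T_linear a u v : carrier u -> carrier v ->
  eqv (T (a *: u + v)) (a *: T u + T v).
Proof.
move=> Xu Xv; split; last by case: T_bounded => _ + _; exact.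
apply: subspaceB => //; first by apply: TX; case: sX => _; exact.
by case: sY => _; apply; exact: TX.
Qed.

Let TB u v : carrier u -> carrier v -> eqv (T (u - v)) (T u - T v).
Proof. move=> Xu Xv; rewrite -[- v]scaleN1r -[- T v]scaleN1r addrC [T u + _]addrC.
exact: T_linear. Qed.

Let T_null u : null u -> null (T u).
Proof.
move=> [Xu u0]; split; first exact: TX.
case: T_bounded => _ _ [M /(_ _ Xu)]; rewrite u0 mulr0 => TM.
by apply/eqP; rewrite eq_le TM seminorm_ge0.
Qed.

Let T_lincomb n (k : 'rV[R[i]]_n) (b : 'I_n -> ambient X) :
  (forall i, carrier (b i)) -> eqv (T (lincomb k b)) (lincomb k (T \o b)).
Proof.
move=> Xb; rewrite /lincomb; elim: (index_enum _) => [|i s IHs].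
  by rewrite !big_nil /congr_mod subr0; apply: T_null; exact: subspace0.
rewrite !big_cons; apply: congr_trans => //.
  by apply: T_linear => //; apply: subspace_sum => // j; exact: subspaceZ.
by apply: congrD => //; exact: congr_refl.
Qed.

Let X_lincomb n (k : 'rV[R[i]]_n) (b : 'I_n -> ambient X) :
  (forall i, carrier (b i)) -> carrier (lincomb k b).
Proof. by move=> Xb; apply: subspace_sum => // i; exact: subspaceZ. Qed.

Let kernelP u : Defs.kernel T u <-> carrier u /\ null (T u).
Proof.
by split=> [[Xu Tu]|[Xu [_ Tu]]]; split => //; split => //; exact: TX.
Qed.

Variable n : nat.
Hypothesis kernel_dim : has_quotient_dim (Defs.kernel T) (@null _ X) n.
Variable C : R.
Hypothesis T_lift : forall f, carrier f -> exists u,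
  [/\ carrier u, seminorm (f - T u) = 0 & seminorm u <= C * seminorm f].
Variables (D : set (ambient X)) (p : nat).
Hypotheses (sD : is_subspace D) (D_closed : closed_in D).
Hypothesis D_codim : has_quotient_dim (@carrier _ X) D p.

Let T1 : ambient (restriction D) -> ambient Y := T.

Let lift f : carrier f -> exists u,
  [/\ carrier u, eqv f (T u) & seminorm u <= C * seminorm f].
Proof.
move=> Yf; have [u [Xu fu uf]] := T_lift Yf; exists u; split => //.
by split => //; apply: subspaceB => //; exact: TX.
Qed.

Let DX : D `<=` @carrier _ X. Proof. by case: D_closed. Qed.

Let null_sub_D : @null _ X `<=` D.
Proof.
move=> u [Xu u0]; case: D_closed => _; apply => // eps eps0.
by exists 0; [exact: subspace0|rewrite subr0 u0].
Qed.

Let null_sub_Y : @null _ Y `<=` @carrier _ Y. Proof. by move=> u []. Qed.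

Let rangeP w : operator_range T1 w <-> exists2 u, D u & eqv w (T u).
Proof.
split=> [[Yw [u Du wu]]|[u Du wu]].
  by exists u => //; split => //; apply: subspaceB => //; exact/TX/DX.
split; first exact: (congr_in sY null_sub_Y wu (TX (DX Du))).
by exists u => //; case: wu.
Qed.

Let range_subspace : is_subspace (operator_range T1).
Proof.
split=> [|a f g /rangeP[u Du fu] /rangeP[v Dv gv]]; apply/rangeP.
  exists 0; first exact: subspace0.
  by apply: congr_sym => //; apply/congr_mod0/T_null; exact: subspace0.
exists (a *: u + v); first by case: sD => _; exact.
apply: (@congr_trans _ _ _ nY (a *: T u + T v)); last first.
  by apply: congr_sym => //; apply: T_linear; exact: DX.
by apply: congrD => //; exact: congrZ.
Qed.

Let lift_congr w u v : carrier u -> carrier v -> eqv w (T u) ->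
  eqv (T v) 0 -> eqv w (T (u - v)).
Proof.
move=> Xu Xv wu v0; apply: (congr_trans nY _ (congr_sym nY (TB Xu Xv))).
by rewrite -(subr0 w); apply: congrB => //; exact: congr_sym.
Qed.

Let kernel_lincomb (b : 'I_n -> ambient X) (k : 'rV[R[i]]_n) :
  (forall i, Defs.kernel T (b i)) -> eqv (T (lincomb k b)) 0.
Proof.
move=> Kb; apply: congr_trans => //.
  by apply: T_lincomb => i; case: (Kb i).
apply/congr_mod0; apply: subspace_sum => // i; apply: subspaceZ => //.
by have [] := (kernelP _).1 (Kb i).
Qed.

(** Write a limit [w] of [T D] as [T u]. If [T d] is close to [w], lift the difference to a small
    [v]: then [u - v - d] is in [ker T], so [u] is approximated by the element [u - v] of
    [D + ker T]. The latter being closed, it contains [u], and a kernel element can be subtracted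
    from [u] to land in [D]. *)
Let range_closed : closed_in (operator_range T1).
Proof.
have [b [Kb bgen _]] := kernel_dim.
have Xb i : carrier (b i) by case: (Kb i).
split=> [w []//|w Yw wcl].
have [u [Xu wTu _]] := lift Yw.
suff [k] : exists k : 'I_n -> R[i], D (u - \sum_i k i *: b i).
  rewrite lincomb_row => Dk; apply/rangeP; eexists; first exact: Dk.
  by apply: lift_congr => //; [exact: X_lincomb|exact: kernel_lincomb].
have [_ +] := closed_in_add_span qX sD D_closed Xb.
apply=> // eps eps0.
have C1 : 0 < `|C| + 1 by rewrite ltr_wpDl.
have [w' /rangeP[d Dd w'd] ww'] := wcl _ (divr_gt0 eps0 C1).
have Xd := DX Dd.
have Yw' : carrier w' := congr_in sY null_sub_Y w'd (TX Xd).
have [v [Xv vE vle]] := lift (subspaceB sY Yw Yw').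
have Xuv : carrier (u - v) by exact: subspaceB.
have Kuvd : Defs.kernel T (u - v - d).
  apply/kernelP; split; first exact: subspaceB.
  apply/congr_mod0/(congr_trans nY (TB Xuv Xd)).
  rewrite -(subrr w'); apply: congrB => //; last exact: congr_sym.
  apply: (congr_trans nY (TB Xu Xv)).
  by rewrite -[X in eqv _ X](subKr w w'); apply: congrB => //; exact: congr_sym.
have [k kE] := bgen _ Kuvd.
exists (u - v).
  exists k; rewrite -(subrK d (u - v - _)).
  by apply: subspaceD => //; apply: null_sub_D; rewrite addrAC.
rewrite opprB addrCA subrr addr0 (le_lt_trans vle)//.
rewrite (@le_lt_trans _ _ ((`|C| + 1) * seminorm (w - w')))//.
  by rewrite ler_wpM2r ?seminorm_ge0// (le_trans (ler_norm _))// lerDl.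
by rewrite mulrC -ltr_pdivlMr.
Qed.

(** The map [ker T -> X / D] has matrix [La] in the bases [b] and [e]. Its left kernel yields the
    kernel of [T1]; a complement of its row space, read in [X / D] and pushed through [T], yields
    the cokernel. *)
Lemma fredholm_restriction :
  fredholm T1 /\ fredholm_index T1 = n%:Z - p%:Z.
Proof.
have [b [Kb bgen bfree]] := kernel_dim.
have [e [Xe egen efree]] := D_codim.
have Xb i : carrier (b i) by case: (Kb i).
have /choice[l lE] i := egen _ (Xb i).
pose La : 'M[R[i]]_(n, p) := \matrix_(i, j) l i j.
have LaE (k : 'rV_n) : congr_mod D (lincomb k b) (lincomb (k *m La) e).
  rewrite lincomb_mulmx; apply: congr_sum => // i; apply: congrZ => //.
  rewrite /congr_mod; move: (lE i); rewrite lincomb_row.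
  by rewrite (_ : \row_j _ = row i La)//; apply/rowP => j; rewrite !mxE.
have free m (B : set (ambient X)) (f : 'I_m -> ambient X) (k : 'rV_m) :
    (forall k : 'I_m -> R[i], B (\sum_i k i *: f i) -> forall i, k i = 0) ->
    B (lincomb k f) -> k = 0.
  by move=> h /h k0; apply/rowP => i; rewrite mxE k0.
(* The rows of [Kr] are a basis of the coefficient vectors for which the combination of [b] falls
   into [D]. *)
pose q := \rank (kermx La); pose Kr := row_base (kermx La).
pose kap r := lincomb (row r Kr) b.
have kerdim : has_quotient_dim (Defs.kernel T1) (null (X:=restriction D)) q.
  exists kap; split.
  - move=> r; split.
      apply: (congr_in sD (@subset_refl _ D) (LaE (row r Kr))).
      rewrite (_ : _ *m _ = 0); last first.
        apply/sub_kermxP; apply: submx_trans (row_sub _ _) _.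
        by rewrite eq_row_base.
      rewrite /lincomb big1; first exact: subspace0.
      by move=> i _; rewrite mxE scale0r.
    have [_ ] : null (T (kap r)).
      by apply/congr_mod0; exact: kernel_lincomb.
    by [].
  - move=> u [Du Tu].
    have [k] := bgen _ (conj (DX Du) Tu); rewrite lincomb_row => -[Xuk uk].
    have Dk : D (lincomb (\row_i k i) b).
      apply: (congr_in sD null_sub_D _ Du); apply: congr_sym => //.
    have kLa : \row_i k i *m La = 0.
      apply: (free _ _ _ _ efree).
      apply: (congr_in sD (@subset_refl _ D) _ Dk).
      exact: (congr_sym sD (LaE _)).
    have /submxP[y yE] : (\row_i k i <= Kr)%MS.
      by rewrite eq_row_base; apply/sub_kermxP.
    exists (fun r => y 0 r).
    have -> : \sum_(r < q) y 0 r *: kap r = lincomb (\row_i k i) b.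
      by rewrite yE lincomb_mulmx.
    by split => //; apply: subspaceB.
  - move=> y; rewrite lincomb_row => -[Dy y0].
    have : lincomb (\row_r y r) kap = lincomb (\row_r y r *m Kr) b.
      by rewrite lincomb_mulmx.
    move=> yE; move: Dy y0; rewrite yE => Dy y0.
    have := free _ _ _ _ bfree (conj (DX Dy) y0).
    move/(congr1 (mulmx^~ (pinvmx Kr))) => /=.
    rewrite mul0mx -mulmxA mulmxVp ?row_base_free// mulmx1 => h r.
    by have /rowP/(_ r) := h; rewrite !mxE.
(* The rows of [Cr] span a complement of the image of [ker T] in the coordinates of [X / D]. *)
pose q' := \rank (La^C)%MS; pose Cr := row_base (La^C)%MS.
pose g r := lincomb (row r Cr) e.
have Xg r : carrier (g r) by exact: X_lincomb.
have cokerdim : has_quotient_dim (@carrier _ Y) (operator_range T1) q'.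
  exists (T \o g); split.
  - by move=> r; exact: TX.
  - move=> w Yw; have [u [Xu wu _]] := lift Yw.
    have [k] := egen _ Xu; rewrite lincomb_row => uk.
    (* Modulo [D], the lift [u] splits into a combination of [b], killed by [T], and a combination
       of [g]; removing both leaves an element of [D]. *)
    have /sub_addsmxP[[x y] /= kE] : (\row_i k i <= La + Cr)%MS.
      rewrite (adds_eqmx (eqmx_refl La) (eq_row_base _)).
      by apply: submx_full; exact: addsmx_compl_full.
    exists (fun r => y 0 r).
    apply/rangeP; exists (u - lincomb x b - lincomb y g).
      rewrite -addrA -opprD.
      apply: (congr_trans sD uk); rewrite kE lincombD.
      apply: congrD => //; first exact: (congr_sym sD (LaE x)).
      by rewrite lincomb_mulmx; exact: congr_refl.
    have -> : \sum_r y 0 r *: (T \o g) r = lincomb y (T \o g) by [].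
    have Xx : carrier (lincomb x b) by exact: X_lincomb.
    have Xy : carrier (lincomb y g) by exact: X_lincomb.
    apply: congr_sym => //.
    apply: (congr_trans nY (TB (subspaceB sX Xu Xx) Xy)).
    apply: congrB => //; last exact: T_lincomb.
    apply: congr_sym => //; apply: lift_congr => //; exact: kernel_lincomb.
  - move=> y; rewrite lincomb_row => /rangeP[d Dd yd].
    have Xy : carrier (lincomb (\row_r y r) g) by exact: X_lincomb.
    (* If a combination of [T \o g] is in the range, that of [g] is in [D + ker T]. Its coordinates
       then lie both in the row space of [La] and in the complement, hence are 0. *)
    have [k] : exists k : 'I_n -> R[i],
        null (lincomb (\row_r y r) g - d - \sum_i k i *: b i).
      apply: bgen; apply/kernelP; split; first exact: (subspaceB sX Xy (DX Dd)).
      apply/congr_mod0/(congr_trans nY (TB Xy (DX Dd))).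
      rewrite -(subrr (T d)); apply: congrB => //; last exact: congr_refl.
      exact: (congr_trans nY (T_lincomb _ Xg) yd).
    rewrite lincomb_row => yk.
    have /(free _ _ _ _ efree) : D (lincomb (\row_r y r *m Cr - \row_i k i *m La) e).
      rewrite lincombB lincomb_mulmx -/(congr_mod D _ _).
      apply: (congr_trans sD _ (LaE _)).
      rewrite /congr_mod -(subrK d (_ - lincomb _ b)); apply: subspaceD => //.
      by apply: null_sub_D; rewrite addrAC.
    move=> /eqP; rewrite subr_eq0 => /eqP yCk.
    have y0 : \row_r y r *m Cr = 0.
      apply/eqP; rewrite -submx0 -(capmx_compl La) sub_capmx {1}yCk.
      by rewrite submxMl/= (submx_trans (submxMl _ _))// eq_row_base.
    move/(congr1 (mulmx^~ (pinvmx Cr))) : y0 => /=.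
    rewrite mul0mx -mulmxA mulmxVp ?row_base_free// mulmx1 => h r.
    by have /rowP/(_ r) := h; rewrite !mxE.
split.
  split => //; [|by exists q|by exists q'].
  case: T_bounded => _ _ [M TM]; split.
  - by move=> u /DX /TX.
  - by move=> a u v /DX Xu /DX Xv; have [] := T_linear a Xu Xv.
  - by exists M => u /DX; exact: TM.
have nD : is_subspace (null (X:=restriction D)).
  split=> [|a u v [Du u0] [Dv v0]].
    by split; [exact: subspace0|exact: (seminorm0 qX)].
  split; first by case: sD => _; exact.
  have [//] : @null _ X (a *: u + v).
  by case: nX => _; apply; split => //; exact: DX.
rewrite /fredholm_index (quotient_dimE nD kerdim).
rewrite (quotient_dimE range_subspace cokerdim).
rewrite /q /q' mxrank_ker mxrank_compl.
rewrite -!subzn ?rank_leq_row ?rank_leq_col//.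
by rewrite opprB addrA subrK.
Qed.

End fredholm_restriction.

(** * Lebesgue against Borel measurability, and functions with zero integral on intervals *)

Section completed_lebesgue.
Variable R : realType.
Local Notation mu := (@completed_lebesgue_measure R).
Local Notation lebR := (caratheodory_type (wlength (@idfun R))^*%mu).

Lemma borel_lebesgue_measurable (A : set R) :
  measurable (A : set (measurableTypeR R)) -> measurable (A : set lebR).
Proof. exact: sub_caratheodory. Qed.

Lemma measurable_itv_leb (i : interval R) : measurable ([set` i] : set lebR).
Proof. apply: borel_lebesgue_measurable; exact: measurable_itv. Qed.

(** The identity as a measurable map from the Lebesgue to the Borel sigma-algebra. Borel measurable
    functions transfer by composition with it, and integrals too, the pushforward of [mu] along it
    being [lebesgue_measure]. *)
Definition leb_id : lebR -> measurableTypeR R := idfun.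

Lemma measurable_leb_id : measurable_fun setT leb_id.
Proof. by move=> _ A mA; rewrite setTI; exact: borel_lebesgue_measurable. Qed.

HB.instance Definition _ := isMeasurableFun.Build _ _ _ _ leb_id measurable_leb_id.

Lemma measurable_fun_leb d (T : measurableType d) (D : set R) (f : R -> T) :
  measurable_fun setT f ->
  measurable_fun (D : set lebR) (f : lebR -> T).
Proof.
move=> mf; apply: measurable_funTS.
exact: (measurableT_comp mf measurable_leb_id).
Qed.

Lemma integral_lebE (D : set R) (f : R -> \bar R) :
  measurable (D : set (measurableTypeR R)) ->
  measurable_fun setT f ->
  (\int[mu]_(x in D) f x = \int[lebesgue_measure]_(x in D) f x)%E.
Proof.
move=> mD mf.
have eqm (g : R -> \bar R) : (\int[lebesgue_measure]_(x in D) g x =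
    \int[pushforward mu leb_id]_(x in D) g x)%E.
  exact: (@eq_measure_integral _ _ _ _ (pushforward mu leb_id) lebesgue_measure).
have mid := measurable_leb_id.
rewrite integralE [RHS]integralE !eqm.
rewrite !(ge0_integral_pushforward mid)//.
- exact/measurable_funTS/measurable_funeneg.
- exact/measurable_funTS/measurable_funepos.
Qed.

Lemma mu_itv (a b : R) : a <= b -> mu `[a, b] = (b - a)%:E.
Proof.
move=> ab; rewrite (_ : mu _ = lebesgue_measure `[a, b])//.
by rewrite lebesgue_measure_itv/= lte_fin; case: ltgtP ab => // ->; rewrite subrr.
Qed.

Lemma integrable_continuous_leb (f : R -> R) (a b : R) : continuous f ->
  mu.-integrable `[a, b] (EFin \o f).
Proof.
move=> cf; apply: measurable_bounded_integrable.
- exact: measurable_itv_leb.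
- have [ab|ba] := leP a b.
    by have := mu_itv ab; rewrite /= => ->; rewrite ltry.
  by rewrite set_itv_ge ?measure0// bnd_simp -ltNge.
- by apply: measurable_fun_leb; exact: continuous_measurable_fun.
- have : bounded_set (f @` `[a, b]).
    apply: compact_bounded; apply: continuous_compact.
      exact/continuous_subspaceT.
    exact: segment_compact.
  move=> [M [Mr Mle]]; exists M; split => // x /Mle h y yab.
  by apply: h; exists y.
Qed.

Lemma Rintegral_lebE (D : set R) (f : R -> R) :
  measurable (D : set (measurableTypeR R)) ->
  measurable_fun setT f ->
  \int[mu]_(x in D) f x = \int[lebesgue_measure]_(x in D) f x.
Proof.
move=> mD mf; rewrite /Rintegral integral_lebE//.
exact/measurable_EFinP.
Qed.

Lemma Rintegral_FTC2 (f F : R -> R) (a b : R) : a <= b -> continuous f ->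
  (forall x, is_derive (x : R) (1 : R) F (f x)) ->
  \int[mu]_(x in `[a, b]) f x = F b - F a.
Proof.
rewrite le_eqVlt => /predU1P[<- cf dF|ab cf dF].
  rewrite subrr Rintegral_lebE//; last exact: continuous_measurable_fun.
  by rewrite set_itv1 Rintegral_set1.
have cF : continuous F.
  by move=> x; apply: differentiable_continuous; apply/derivable1_diffP; case: (dF x).
rewrite Rintegral_lebE//; last exact: continuous_measurable_fun.
rewrite /Rintegral (@continuous_FTC2 _ _ F)//.
- exact/continuous_subspaceT.
- split.
  + by move=> x _; case: (dF x).
  + exact/cvg_at_right_filter/cF.
  + exact/cvg_at_left_filter/cF.
- by move=> x _; rewrite derive1E; case: (dF x).
Qed.

Lemma mu_set2 (a b : R) : mu [set a; b] = 0%E.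
Proof.
by apply: (@countable_lebesgue_measure0 R); exact: finite_set_countable.
Qed.

Section integral_itv_eq0.
Variables (f : R -> R) (L : R).
Local Notation I := (`[0, L]%classic : set lebR).
Hypothesis intf : mu.-integrable I (EFin \o f).
Hypothesis f0 : forall a b, 0 <= a -> a < b -> b <= L ->
  \int[mu]_(x in `]a, b[) f x = 0.

Let mI : measurable I. Proof. exact: measurable_itv_leb. Qed.

Let int_sub (A : set lebR) : measurable A -> A `<=` I ->
  mu.-integrable A (EFin \o f).
Proof. by move=> mA AI; exact: integrableS intf. Qed.

(** Lets the hypothesis on open intervals serve for [I] itself and for the half-open intervals of
    the Dynkin argument, the end points being negligible. *)
Let int_near_itv (D : set lebR) a b : measurable D -> D `<=` I ->
  0 <= a -> b <= L -> D `\` [set a; b] = `]a, b[%classic ->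
  (\int[mu]_(x in D) (f x)%:E = 0)%E.
Proof.
move=> mD DI a0 bL Dab.
have m2 : measurable ([set a; b] : set lebR).
  by apply: borel_lebesgue_measurable; exact: measurableU.
rewrite (@negligible_integral _ _ _ mu D [set a; b])//; last 2 first.
- exact: int_sub.
- exact: mu_set2.
rewrite Dab; have [ab|ba] := ltP a b; last first.
  by rewrite set_itv_ge ?integral_set0// bnd_simp -leNgt.
rewrite -[LHS]fineK; first by congr EFin; exact: f0.
apply: integrable_fin_num; first exact: measurable_itv_leb.
apply: int_sub; first exact: measurable_itv_leb.
by rewrite -Dab => x [/DI].
Qed.

(** Half-open intervals are stable under intersection and generate the Borel sets, and the sets [A]
    with zero integral over [I] and [A] form a Dynkin class: for complements, the integral over all
    of [I] is 0. *)
Let int_borel (A : set R) : measurable A ->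
  (\int[mu]_(x in (I `&` A)) (f x)%:E = 0)%E.
Proof.
have mIA (B : set R) : measurable B -> measurable (I `&` B : set lebR).
  by move=> mB; apply: measurableI => //; exact: borel_lebesgue_measurable.
have intI : (\int[mu]_(x in I) (f x)%:E = 0)%E.
  apply: (@int_near_itv I 0 L) => //.
  apply/seteqP; split=> x /=; rewrite !in_itv/=.
    by move=> [/andP[x0 xL] /not_orP[/eqP ? /eqP ?]]; rewrite !lt_neqAle x0 xL; lra.
  move=> /andP[x0 xL]; split; first by rewrite !ltW.
  by move=> [xE|xE]; move: x0 xL; rewrite xE ltxx.
move: A; apply: (@dynkin_induction _ (measurableTypeR R) (@ocitv R)
  (fun A => (\int[mu]_(x in (I `&` A)) (f x)%:E = 0)%E)) => //.
- exact: ocitvI.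
- by rewrite setIT.
- move=> _ [[a b] _ <-] /=.
  apply: (@int_near_itv _ (Num.max a 0) (Num.min b L)) => //.
  + by apply: mIA; exact: measurable_itv.
  + by rewrite le_max lexx orbT.
  + by rewrite ge_min lexx orbT.
  apply/seteqP; split=> x /=; rewrite !in_itv/=.
    move=> [[/andP[x0 xL] /andP[ax xb]] /not_orP[/eqP na /eqP nb]].
    by rewrite !lt_neqAle eq_sym na nb/= ge_max le_min x0 xL xb ltW.
  move=> /andP[h1 h2]; split; last first.
    by move=> [xE|xE]; move: h1 h2; rewrite xE ltxx.
  by move: h1 h2; rewrite gt_max lt_min => /andP[-> /ltW->] /andP[/ltW-> /ltW->].
- move=> S mS S0.
  have := @integral_setU_EFin _ _ _ mu (I `&` S) (I `&` ~` S) f.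
  rewrite -setIUr setUv setIT S0 add0e intI => <- //.
  + exact: mIA.
  + by apply: mIA; exact: measurableC.
  + by apply/measurable_EFinP; exact: (measurable_int mu).
  + by rewrite /disj_set setIACA setICr setI0.
- move=> F mF tF F0.
  rewrite setI_bigcupr integral_bigcup//.
  + by rewrite eseries0// => k _ _; exact: F0.
  + exact: trivIset_setIl.
  + by move=> k; apply: mIA; exact: mF.
  + apply: int_sub; last by move=> x [k _ []].
    by apply: bigcupT_measurable => k; apply: mIA; exact: mF.
Qed.

Lemma integral_itv_eq0 : {ae mu, forall x, I x -> f x = 0}.
Proof.
have h : ae_eq mu I (EFin \o f) (cst 0%E).
  apply: integral_ae_eq => // E EI mE.
  rewrite integral0.
  have : (completed_algebra_gen (@lebesgue_measure R)).-sigma.-measurable E.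
    by rewrite completed_caratheodory_measurable.
  rewrite g_sigma_completed_algebra_genE => -[A mA [N [B [mB B0 NB]]] ANE].
  have mB' := borel_lebesgue_measurable mB.
  rewrite (@negligible_integral _ _ _ mu E B)//; last exact: int_sub.
  have -> : E `\` B = I `&` (A `\` B).
    apply/seteqP; split=> x.
      move=> [Ex nBx]; split; first exact: EI.
      by move: Ex; rewrite -ANE => -[//|/NB].
    by move=> [Ix [Ax nBx]]; split => //; rewrite -ANE; left.
  by apply: int_borel; exact: measurableD.
by apply: filterS h => x h /h [].
Qed.

End integral_itv_eq0.

End completed_lebesgue.

(** * Smooth functions *)

Section smooth_functions.
Variable R : realType.
Implicit Types (f g : R -> R) (x : R).

(** Peels off the first derivative rather than the last one, so that the sum, product and affine
    substitution rules need one differentiation and the induction hypothesis. *)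
Fixpoint diff_class (n : nat) f : Prop :=
  if n is n'.+1 then (forall x, derivable f x 1) /\ diff_class n' (derive1 f)
  else True.

Lemma diff_class_le n f : diff_class n.+1 f -> diff_class n f.
Proof. by elim: n f => // n IHn f [df] /IHn. Qed.

Lemma derive1_is_derive f (df : R -> R) :
  (forall x, is_derive x 1 f (df x)) -> derive1 f = df.
Proof. by move=> fE; apply/funext => x; rewrite derive1E; case: (fE x). Qed.

Lemma diff_classS n f (df : R -> R) : (forall x, is_derive x 1 f (df x)) ->
  diff_class n df -> diff_class n.+1 f.
Proof.
by move=> fE Cdf; split; [move=> x; case: (fE x)|rewrite (derive1_is_derive fE)].
Qed.

Lemma diff_class_is_derive n f : diff_class n.+1 f ->
  forall x, is_derive x 1 f (derive1 f x).
Proof. by move=> [df _] x; rewrite derive1E; exact: derivableP. Qed.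

Lemma diff_class_cst n (c : R) : diff_class n (cst c).
Proof.
elim: n c => // n IHn c; exact: (@diff_classS n _ (cst 0)).
Qed.

Lemma diff_classD n f g : diff_class n f -> diff_class n g -> diff_class n (f \+ g).
Proof.
elim: n f g => // n IHn f g Cf Cg.
have df := diff_class_is_derive Cf; have dg := diff_class_is_derive Cg.
apply: (@diff_classS n _ (derive1 f \+ derive1 g)).
by apply: IHn; [case: Cf|case: Cg].
Qed.

Lemma diff_classM n f g : diff_class n f -> diff_class n g -> diff_class n (f \* g).
Proof.
elim: n f g => // n IHn f g Cf Cg.
have df := diff_class_is_derive Cf; have dg := diff_class_is_derive Cg.
apply: (@diff_classS n _ ((f \* derive1 g) \+ (g \* derive1 f))).
by apply: diff_classD; apply: IHn; [exact: diff_class_le|case: Cg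
  |exact: diff_class_le|case: Cf].
Qed.

Lemma diff_class_affine n f (a b : R) : diff_class n f ->
  diff_class n (fun x => f (a * x + b)).
Proof.
elim: n f => // n IHn f Cf; have df := diff_class_is_derive Cf.
apply: (@diff_classS n _ ((fun x => derive1 f (a * x + b)) \* cst a)) => [x|].
  have dab : is_derive x 1 (fun x : R => a * x + b) a.
    have := is_deriveD (is_deriveZ a (is_derive_id x (1 : R))) (is_derive_cst b x 1).
    by rewrite addr0 [_ *: 1]mulr1.
  by have := @is_derive1_comp _ f _ x _ _ (df (a * x + b)) dab.
apply: diff_classM; last exact: diff_class_cst.
by apply: IHn; case: Cf.
Qed.

Definition smooth f := forall n x, derivable (derive1n n f) x 1.

Lemma smoothP f : smooth f <-> forall n, diff_class n f.
Proof.
split=> [fs n|fC n].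
  elim: n f fs => // n IHn f fs; split=> [x|]; first exact: (fs 0%N).
  by apply: IHn => k x; have := fs k.+1 x; rewrite derive1Sn.
elim: n f fC => [|n IHn] f fC x; first by case: (fC 1%N).
by rewrite derive1Sn; apply: IHn => k; case: (fC k.+1).
Qed.

Lemma smooth_is_derive f : smooth f -> forall x, is_derive x 1 f (derive1 f x).
Proof. by move=> fs x; apply: (@diff_class_is_derive 0%N); exact: ((smoothP f).1 fs 1%N). Qed.

Lemma smooth_derive1 f : smooth f -> smooth (derive1 f).
Proof. by move=> fs n x; rewrite -derive1Sn; exact: fs. Qed.

Lemma smoothS f (df : R -> R) : (forall x, is_derive x 1 f (df x)) ->
  smooth df -> smooth f.
Proof.
by move=> fE /smoothP Cdf; apply/smoothP => -[//|n]; exact: diff_classS fE _.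
Qed.

Lemma smooth_continuous f : smooth f -> continuous f.
Proof.
by move=> fs x; apply/differentiable_continuous/derivable1_diffP; exact: (fs 0%N).
Qed.

Lemma smoothD f g : smooth f -> smooth g -> smooth (f \+ g).
Proof.
by move=> /smoothP Cf /smoothP Cg; apply/smoothP => n; exact: diff_classD.
Qed.

Lemma smoothM f g : smooth f -> smooth g -> smooth (f \* g).
Proof.
by move=> /smoothP Cf /smoothP Cg; apply/smoothP => n; exact: diff_classM.
Qed.

Lemma smooth_cst (c : R) : smooth (cst c).
Proof. by apply/smoothP => n; exact: diff_class_cst. Qed.

Lemma smooth_affine f (a b : R) : smooth f -> smooth (fun x => f (a * x + b)).
Proof.
by move=> /smoothP Cf; apply/smoothP => n; exact: diff_class_affine.
Qed.

End smooth_functions.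

(** * Functions that are flat at 0 *)

Section flat_function.
Variable R : realType.
Implicit Types (p : {poly R}) (x y : R).

(** From [y / n <= 1 + y / n <= expR (y / n)], raised to the power [n]. *)
Lemma exprn_le_expR y n : 0 <= y -> y ^+ n <= n%:R ^+ n * expR y.
Proof.
move=> y0; have [->|n0] := eqVneq n 0%N.
  by rewrite !expr0 mul1r (le_trans _ (expR_ge1Dx _))// lerDl.
have n0' : 0 < n%:R :> R by rewrite ltr0n lt0n.
have -> : expR y = expR (y / n%:R) ^+ n.
  by rewrite -expRM_natl -mulr_natl mulrCA divff ?mulr1// gt_eqF.
rewrite -exprMn lerXn2r ?nnegrE ?mulr_ge0 ?expR_ge0//.
rewrite mulrC -ler_pdivrMr// (le_trans _ (expR_ge1Dx _))// lerDr//.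
Qed.

Lemma horner_le_expR p : exists C : R, forall y, 0 <= y -> `|p.[y]| <= C * expR y.
Proof.
exists (\sum_(i < size p) `|p`_i| * i%:R ^+ i) => y y0.
rewrite horner_coef (le_trans (ler_norm_sum _ _ _))// mulr_suml ler_sum// => i _.
rewrite normrM -mulrA ler_wpM2l// normrX (ger0_norm y0).
exact: exprn_le_expR.
Qed.

(* This family is stable under differentiation, so that all its members are
   smooth. *)
Definition flat p x : R := if 0 < x then p.[x^-1] * expR (- x^-1) else 0.

(** The exponential bound is applied to [p * 'X^2] at [x^-1], and the extra square becomes the
    factor [x ^+ 2]. Such a quadratic bound gives derivative 0 at the origin. *)
Lemma flat_le p : exists C : R, forall x, `|flat p x| <= C * x ^+ 2.
Proof.
have [C CE] := horner_le_expR (p * 'X^2).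
exists C => x; rewrite /flat; case: ifPn => x0; last first.
  have : 0 <= C.
    have := CE 0 (lexx _); rewrite expR0 mulr1; exact: le_trans.
  by move=> C0; rewrite normr0 mulr_ge0 ?sqr_ge0.
have y0 : 0 <= x^-1 by rewrite invr_ge0 ltW.
have := CE _ y0; rewrite hornerM hornerXn normrM normrX (ger0_norm y0) normrM.
rewrite expRN (ger0_norm (_ : 0 <= (expR _)^-1)) ?invr_ge0 ?expR_ge0//.
rewrite ler_pdivrMr ?expR_gt0// exprVn ler_pdivrMr ?exprn_gt0//.
by rewrite mulrAC.
Qed.

Lemma is_derive_quadratic (f : R -> R) (C : R) : f 0 = 0 ->
  (forall x, `|f x| <= C * x ^+ 2) -> is_derive (0 : R) (1 : R) f 0.
Proof.
move=> f0 fC.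
have h : (fun t : R => t^-1 *: (f (t *: 1 + 0) - f 0)) @ 0^' --> (0 : R).
  apply/cvgr0Pnorm_le => eps eps0.
  have C0 : 0 < `|C| + 1 by rewrite ltr_wpDl.
  near=> t.
  have t0 : t != 0 by near: t; exact: nbhs_dnbhs_neq.
  rewrite f0 subr0 addr0 [_ *: 1]mulr1 [_ *: _]/(_ * _) normrM normfV.
  rewrite mulrC ler_pdivrMr ?normr_gt0// (le_trans (fC t))//.
  rewrite -real_normK ?num_real// expr2 mulrA ler_wpM2r//.
  rewrite (@le_trans _ _ ((`|C| + 1) * `|t|))//.
    by rewrite ler_wpM2r// (le_trans (ler_norm _))// lerDl.
  rewrite mulrC -ler_pdivlMr//.
  near: t; apply: dnbhs0_le; exact: divr_gt0.
apply: DeriveDef; first by apply/cvg_ex; exists 0.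
exact/cvg_lim.
Unshelve. all: end_near. Qed.

Lemma is_derive_flat p x :
  is_derive x 1 (flat p) (flat ('X^2 * (p - p^`())) x).
Proof.
have [x0|x0|<-] := ltgtP 0 x.
- rewrite {2}/flat x0.
  pose g (y : R) := p.[y^-1] * expR (- y^-1).
  have xn0 : x != 0 by rewrite gt_eqF.
  have dinv : is_derive x 1 (fun y : R => y^-1) (- x ^- 2).
    have := @is_deriveV R idfun x 1 1 xn0 (is_derive_id _ _).
    by rewrite [_ *: 1]mulr1.
  have dp : is_derive x 1 (fun y : R => p.[y^-1]) (p^`().[x^-1] * - x ^- 2).
    exact: (@is_derive1_comp _ (horner p)).
  have dexp : is_derive x 1 (fun y : R => expR (- y^-1)) (expR (- x^-1) * x ^- 2).
    have dN : is_derive x 1 (fun y : R => - y^-1) (x ^- 2).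
      by have := is_deriveN dinv; rewrite opprK.
    exact: (@is_derive1_comp _ expR).
  have dg : is_derive x 1 g (('X^2 * (p - p^`())).[x^-1] * expR (- x^-1)).
    apply: is_derive_eq (is_deriveM dp dexp) _.
    rewrite hornerM hornerXn hornerD hornerN exprVn.
    have scE (a b : R) : a *: b = a * b by [].
    by rewrite !scE; move: (_ ^- 2) => z; ring.
  apply: near_eq_is_derive dg.
  near=> y; rewrite /flat /g ifT//.
  by near: y; exact: lt_nbhsr.
- rewrite {2}/flat ltNge (ltW x0)/=.
  apply: (@near_eq_is_derive _ _ _ (cst 0)).
  near=> y; rewrite /flat ifF//.
  by apply/negbTE; rewrite -leNgt ltW//; near: y; exact: lt_nbhsl.
- rewrite {2}/flat ltxx; have [C CE] := flat_le p.
  by apply: is_derive_quadratic CE; rewrite /flat ltxx.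
Unshelve. all: end_near. Qed.

Lemma smooth_flat p : smooth (flat p).
Proof.
apply/smoothP => n; elim: n p => // n IHn p.
exact: (diff_classS (is_derive_flat p)).
Qed.

End flat_function.

(** * Bump functions and their primitives *)

Section bump_functions.
Variable R : realType.
Implicit Types (a b x y : R) (n : nat).

Lemma flat1E y : flat 1 y = if 0 < y then expR (- y^-1) else 0 :> R.
Proof. by rewrite /flat hornerC mul1r. Qed.

Lemma flat1_ge0 y : 0 <= flat 1 y :> R.
Proof. by rewrite flat1E; case: ifP => // _; exact: expR_ge0. Qed.

Lemma flat1_le1 y : flat 1 y <= 1 :> R.
Proof.
rewrite flat1E; case: ifP => // y0.
by rewrite -[leRHS]expR0 ler_expR oppr_le0 invr_ge0 ltW.
Qed.

(** This is [flat 1] at [n * (x - a) - 1] times [flat 1] at [n * (b - x) - 1]. For [n > 0] it is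
    positive exactly on []a + 1/n, b - 1/n[], and it tends to the indicator of []a, b[]. The affine
    arguments are laid out for [smooth_affine]. *)
Definition bump_fun a b n x : R :=
  flat 1 (n%:R * x + (- (n%:R * a) - 1)) * flat 1 (- n%:R * x + (n%:R * b - 1)).

Lemma smooth_bump a b n : smooth (bump_fun a b n).
Proof. by apply: smoothM; apply: smooth_affine; exact: smooth_flat. Qed.

Lemma bump_ge0 a b n x : 0 <= bump_fun a b n x.
Proof. by rewrite mulr_ge0 ?flat1_ge0. Qed.

Lemma bump_le1 a b n x : bump_fun a b n x <= 1.
Proof. by rewrite mulr_ile1 ?flat1_ge0 ?flat1_le1. Qed.

Lemma bump_gt0E a b n x : (0 < n)%N ->
  (0 < bump_fun a b n x) = (a + n%:R^-1 < x < b - n%:R^-1).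
Proof.
move=> n0; have n0' : 0 < n%:R :> R by rewrite ltr0n.
have h1 : (0 < n%:R * x + (- (n%:R * a) - 1)) = (a + n%:R^-1 < x).
  rewrite -[RHS](ltr_pM2l n0') mulrDr divff ?gt_eqF//.
  by apply/idP/idP; lra.
have h2 : (0 < - n%:R * x + (n%:R * b - 1)) = (x < b - n%:R^-1).
  rewrite -[RHS](ltr_pM2l n0') mulrBr divff ?gt_eqF//.
  by apply/idP/idP; lra.
rewrite /bump_fun !flat1E h1 h2; case: ifP => _; last by rewrite mul0r ltxx.
by case: ifP => _; rewrite ?mulr0 ?ltxx// mulr_gt0 ?expR_gt0.
Qed.

Lemma bump_eq0 a b n x : (0 < n)%N ->
  ~~ (a + n%:R^-1 < x < b - n%:R^-1) -> bump_fun a b n x = 0.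
Proof.
move=> n0; rewrite -bump_gt0E// -leNgt => h.
by apply/eqP; rewrite eq_le h bump_ge0.
Qed.

Lemma cvg_flat1 y : 0 < y -> flat 1 (n%:R * y - 1) @[n --> \oo] --> (1 : R).
Proof.
move=> y0; apply/cvgrPdist_le => eps eps0; near=> n.
(* With [t = n * y - 1 > eps^-1], the distance [1 - expR (- t^-1)] is at most [t^-1], hence at most
   [eps]. *)
have h : eps^-1 + 1 < n%:R * y.
  by rewrite -ltr_pdivrMr//; near: n; exact: nbhs_infty_gtr.
have e0 : 0 < eps^-1 by rewrite invr_gt0.
have t0 : 0 < n%:R * y - 1 by lra.
rewrite ger0_norm ?subr_ge0 ?flat1_le1// flat1E t0.
have := expR_ge1Dx (- (n%:R * y - 1)^-1).
have : (n%:R * y - 1)^-1 <= eps by rewrite invf_ple ?posrE//; lra.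
lra.
Unshelve. all: end_near. Qed.

Lemma cvg_bump a b x : a < x < b -> bump_fun a b n x @[n --> \oo] --> (1 : R).
Proof.
move=> /andP[ax xb]; rewrite (_ : (fun n => _) = (fun n => flat 1 (n%:R * (x - a) - 1)) \*
  (fun n => flat 1 (n%:R * (b - x) - 1))).
  have := cvgM (cvg_flat1 (_ : 0 < x - a)) (cvg_flat1 (_ : 0 < b - x)).
  by rewrite mulr1; apply; rewrite subr_gt0.
apply/funext => n; rewrite /bump_fun; congr (flat _ _ * flat _ _); ring.
Qed.

(** The primitive is the integral over [[0, x]], which has the right derivative only to the right of
    the base point 0. Since [psi] vanishes up to [d > 0], the primitive is identically 0 below [d],
    and the fundamental theorem is invoked from [d] on. *)
Lemma antiderivative (psi : R -> R) (d : R) : continuous psi -> 0 < d ->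
  (forall x, x <= d -> psi x = 0) ->
  exists Psi : R -> R, (forall x, is_derive x 1 Psi (psi x)) /\
    forall x, x <= d -> Psi x = 0.
Proof.
move=> cpsi d0 psi0.
pose Psi x := \int[lebesgue_measure]_(t in `[0, x]) psi t.
have Psi0 x : x <= d -> Psi x = 0.
  move=> xd; rewrite /Psi (@eq_Rintegral _ _ _ _ _ (cst 0)).
    by rewrite Rintegral_cst//= mul0r.
  by move=> t; rewrite inE/= in_itv/= => /andP[_ tx]; rewrite psi0// (le_trans tx).
exists Psi; split => // x.
have [xd|dx] := ltP x d.
  rewrite psi0 ?ltW//; apply: (@near_eq_is_derive _ _ _ (cst 0)).
  by near=> y; rewrite Psi0// ltW//; near: y; exact: lt_nbhsl.
have x0 : 0 < x by rewrite (lt_le_trans d0).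
have [] := @continuous_FTC1_closed _ psi 0 x (x + 1) _ _ x0 (cpsi x).
- by rewrite ltrDl.
- by apply: continuous_compact_integrable; [exact: segment_compact
    |exact: continuous_subspaceT].
by move=> dP PE; rewrite -PE derive1E; exact: derivableP.
Unshelve. all: end_near. Qed.

End bump_functions.

(** * Test functions *)

Section test_functions.
Variables (R : realType) (L : R).
Implicit Types phi psi : R -> R.

Lemma test_function_smooth phi : test_function L phi -> smooth phi.
Proof. by case. Qed.

Lemma test_function_itv phi (a b : R) : smooth phi -> 0 < a -> b < L ->
  (forall x, phi x != 0 -> a <= x <= b) -> test_function L phi.
Proof.
move=> sphi a0 bL phi0; split => // x.
have : closed (`[a, b]%classic : set R) by exact: interval_closed.
rewrite closure_id => abE.
have : closure [set x | phi x != 0] `<=` `[a, b]%classic.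
  by rewrite abE; apply: closureS => y /= /phi0; rewrite in_itv.
move=> /[apply]; rewrite /= !in_itv/= => /andP[ax xb].
by rewrite (lt_le_trans a0 ax) (le_lt_trans xb bL).
Qed.

Lemma test_function_eq0 phi x : test_function L phi -> ~~ (0 < x < L) -> phi x = 0.
Proof.
move=> [_ phi0] x0L; apply/eqP/negP => /negP phix.
by have := phi0 x (@subset_closure _ [set x | phi x != 0] x phix); rewrite /= in_itv/=; apply/negP.
Qed.

(** Off the closure of its support [phi] is locally 0, so its derivative vanishes there too. *)
Lemma test_function_derive1 phi : test_function L phi -> test_function L (derive1 phi).
Proof.
move=> [sphi phi0]; split; first exact: smooth_derive1.
apply: subset_trans phi0; 
have /closure_id -> : closed (closure [set x | phi x != 0]).
  exact: closed_closure.
apply: closureS => x /= dx; apply: contrapT => xphi; move: dx; apply/negP.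
rewrite negbK derive1E (@near_eq_derive _ _ _ _ (cst 0)) ?derive_cst//.
have : open (~` closure [set x | phi x != 0]) by exact/closed_openC/closed_closure.
rewrite openE => /(_ _ xphi); apply: filterS => y nphi.
apply/eqP/negP => /negP phiy; apply: nphi.
exact: (@subset_closure _ [set x | phi x != 0]).
Qed.

End test_functions.

(** * Almost everywhere statements *)

Section almost_everywhere.
Context d (T : measurableType d) (R : realType) (m : {measure set T -> \bar R}).
Implicit Types P Q S : T -> Prop.

Lemma ae_mono P Q : (forall x, P x -> Q x) ->
  {ae m, forall x, P x} -> {ae m, forall x, Q x}.
Proof. by move=> PQ; apply: filterS PQ; exact: (ae_filter_ringOfSetsType m). Qed.

Lemma ae_mono2 P Q S : (forall x, P x -> Q x -> S x) ->
  {ae m, forall x, P x} -> {ae m, forall x, Q x} -> {ae m, forall x, S x}.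
Proof. by move=> PQ; apply: filterS2 PQ; exact: (ae_filter_ringOfSetsType m). Qed.

End almost_everywhere.

(** * Fubini for truncated product kernels *)

Section integrable_kernel.
Local Open Scope ereal_scope.
Context d1 d2 (T1 : measurableType d1) (T2 : measurableType d2) (R : realType).
Variable m1 : {sigma_finite_measure set T1 -> \bar R}.
Variable m2 : {sigma_finite_measure set T2 -> \bar R}.
Variables (p : T1 -> R) (w : T2 -> R) (A : set (T1 * T2)).
Hypotheses (pi : m1.-integrable setT (EFin \o p)).
Hypotheses (wi : m2.-integrable setT (EFin \o w)) (mA : measurable A).

(** By Tonelli: for a fixed first variable [x], the inner integral of the absolute value is at most
    [|p x|] times the integral of [|w|], the truncation by [A] only decreasing it. *)
Lemma integrable_kernel : (m1 \x m2).-integrable setT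
  (EFin \o (fun z => p z.1 * (w z.2 * \1_A z))%R).
Proof.
have mp : measurable_fun setT p by exact/measurable_EFinP/(measurable_int _ pi).
have mw : measurable_fun setT w by exact/measurable_EFinP/(measurable_int _ wi).
have mpe : measurable_fun setT (fun x => `|(p x)%:E|).
  by apply: measurableT_comp => //; exact/measurable_EFinP.
have mwe : measurable_fun setT (fun x => `|(w x)%:E|).
  by apply: measurableT_comp => //; exact/measurable_EFinP.
set K := fun z : T1 * T2 => _.
have mK : measurable_fun setT K.
  apply: measurable_funM.
    exact: (measurableT_comp mp measurable_fst).
  apply: measurable_funM; first exact: (measurableT_comp mw measurable_snd).
  exact: measurable_indic.
have mKe : measurable_fun setT (EFin \o K) by exact/measurable_EFinP.
apply/(integrable12ltyP m1 m2 mKe).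
pose C := \int[m2]_t `|(w t)%:E|.
have Cfin : C \is a fin_num.
  by apply: integrable_fin_num => //; exact: (integrable_abse wi).
have C0 : 0 <= C by exact: integral_ge0.
apply: (@le_lt_trans _ _ (\int[m1]_x (`|(p x)%:E| * C))); last first.
  rewrite ge0_integralZr// ltey_eq fin_numM//.
  by apply: integrable_fin_num => //; exact: (integrable_abse pi).
apply: ge0_le_integral => //.
- by move=> x _; exact: integral_ge0.
- apply: (@measurable_fun_fubini_tonelli_F _ _ _ _ _ m2 (abse \o (EFin \o K))); last first.
    by move=> x; exact: abse_ge0.
  exact: measurableT_comp.
- exact: emeasurable_funM.
move=> x _; rewrite -ge0_integralZl//.
apply: ge0_le_integral => //.
- apply: measurableT_comp => //; apply/measurable_EFinP.
  exact: (measurableT_comp mK (pair1_measurable x)).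
- exact: emeasurable_funM.
move=> t _ /=; rewrite -EFinM lee_fin !normrM ler_wpM2l//.
by rewrite ler_piMr// indicE; case: (_ \in _); rewrite ?normr1 ?normr0.
Qed.

End integrable_kernel.

(** * Primitives from 0 and the lemma of du Bois-Reymond *)

Section integral_from_0.
Variable R : realType.
Local Notation mu := (@completed_lebesgue_measure R).
Local Notation lebR := (caratheodory_type (wlength (@idfun R))^*%mu).

Lemma EFin_Rintegral d (T : measurableType d) (m : {measure set T -> \bar R})
    (D : set T) (f : T -> R) : measurable D -> m.-integrable D (EFin \o f) ->
  (\int[m]_(x in D) (f x)%:E = (\int[m]_(x in D) f x)%:E)%E.
Proof. by move=> mD fi; rewrite /Rintegral fineK//; exact: integrable_fin_num. Qed.

Lemma measurable_lebR : measurable_fun (setT : set lebR) (fun x : lebR => (x : R)).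
Proof. exact: measurable_leb_id. Qed.

Lemma integrable_patch (D : set lebR) (f : R -> R) : measurable D ->
  mu.-integrable D (EFin \o f) -> mu.-integrable setT (EFin \o (f \_ D)).
Proof. by move=> mD; rewrite -restrict_EFin => /(integrable_mkcond _ mD). Qed.

Variable L : R.
Local Notation I := (`[0, L]%classic : set lebR).
Local Notation integrableI f := (mu.-integrable I (EFin \o f)).
Implicit Types (w v phi psi : R -> R) (a b x : R).

Lemma measurable_I : measurable I. Proof. exact: measurable_itv_leb. Qed.
Hint Resolve measurable_I : core.

Definition J w x : R := \int[mu]_(t in `[0, x]) w t.

Lemma integrable_0x w x : integrableI w -> x <= L ->
  mu.-integrable `[0, x] (EFin \o w).
Proof.
move=> wi xL; apply: integrableS wi => //; first exact: measurable_itv_leb.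
by apply: subset_itvl; rewrite bnd_simp.
Qed.

Section fubini.
Variables (w psi Psi : R -> R).
Hypotheses (wi : integrableI w) (cpsi : continuous psi).
Hypothesis dPsi : forall x, is_derive (x : R) (1 : R) Psi (psi x).

Let w0 : lebR -> R := w \_ I.
Let p0 : lebR -> R := psi \_ I.

Let w0i : mu.-integrable setT (EFin \o w0).
Proof. exact: integrable_patch. Qed.

Let p0i : mu.-integrable setT (EFin \o p0).
Proof. by apply: integrable_patch => //; exact: integrable_continuous_leb. Qed.

(** The triangle [t <= x]. Integrating [K] in [t] first produces [psi] times [J w]; integrating in
    [x] first produces [w] with the weight [Psi L - Psi t]. *)
Let A : set (lebR * lebR) := [set z | (z.2 : R) <= (z.1 : R)].

Let mA : measurable A.
Proof.
rewrite -[A]setTI.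
apply: (@measurable_fun_le _ _ R setT
    (fun z : lebR * lebR => leb_id z.2 : R) (fun z => leb_id z.1 : R)) => //.
- exact: (measurableT_comp measurable_lebR measurable_snd).
- exact: (measurableT_comp measurable_lebR measurable_fst).
Qed.

Let K (z : lebR * lebR) : R := p0 z.1 * (w0 z.2 * \1_A z).

Let mp0 : measurable_fun setT p0.
Proof. exact/measurable_EFinP/(measurable_int _ p0i). Qed.

Let mw0 : measurable_fun setT w0.
Proof. exact/measurable_EFinP/(measurable_int _ w0i). Qed.

Let mK : measurable_fun setT K.
Proof.
apply: measurable_funM.
  exact: (measurableT_comp mp0 measurable_fst).
apply: measurable_funM.
  exact: (measurableT_comp mw0 measurable_snd).
exact: measurable_indic.
Qed.

Let Ki : (mu \x mu)%E.-integrable setT (EFin \o K).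
Proof. exact: integrable_kernel. Qed.

Let KF x : (\int[mu]_t (K (x, t))%:E = ((psi \* J w) \_ I x)%:E)%E.
Proof.
rewrite /K/=; have [xI|xI] := pselect (I x); last first.
  rewrite /p0 !patchE memNset//.
  by under eq_integral do rewrite mul0r; rewrite integral0.
rewrite /p0 !patchE mem_set//.
have [x0 xL] : 0 <= x /\ x <= L by move: xI; rewrite /= in_itv/= => /andP.
have -> : (fun t => (psi x * (w0 t * \1_A (x, t)))%:E) =
    (fun t => (psi x)%:E * (((w \_ `[0, x]) t)%:E))%E.
  apply/funext => t; rewrite -EFinM /w0 !patchE indicE; congr (_ * _)%:E.
  have -> : ((x, t) \in A) = (t <= x).
    by apply/idP/idP; [move=> /set_mem|move=> h; exact/mem_set].
  have -> : (t \in I) = (0 <= t <= L).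
    by apply/idP/idP; [move=> /set_mem /=; rewrite in_itv|move=> h; apply/mem_set; rewrite /= in_itv].
  have -> : (t \in `[0, x]%classic) = (0 <= t <= x).
    by apply/idP/idP; [move=> /set_mem /=; rewrite in_itv|move=> h; apply/mem_set; rewrite /= in_itv].
  case: (leP 0 t) => /=; last by rewrite mul0r.
  case: (leP t x) => [tx|]; last by rewrite mulr0.
  by rewrite (le_trans tx xL) mulr1.
have wxi : mu.-integrable setT (EFin \o (w \_ `[0, x])).
  by apply: integrable_patch; [exact: measurable_itv_leb|exact: integrable_0x].
rewrite integralZl// EFin_Rintegral// -EFinM; congr (_ * _)%:E.
by rewrite /J [RHS]Rintegral_mkcond.
Qed.

Let KG t : (\int[mu]_x (K (x, t))%:E = ((w \* (fun t => Psi L - Psi t)) \_ I t)%:E)%E.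
Proof.
rewrite /K/=; have [tI|tI] := pselect (I t); last first.
  rewrite /w0 !patchE memNset//.
  by under eq_integral do rewrite mul0r mulr0; rewrite integral0.
rewrite /w0 !patchE mem_set//.
have [t0 tL] : 0 <= t /\ t <= L by move: tI; rewrite /= in_itv/= => /andP.
have -> : (fun x => (p0 x * (w t * \1_A (x, t)))%:E) =
    (fun x => (w t)%:E * (((psi \_ `[t, L]) x)%:E))%E.
  apply/funext => x; rewrite -EFinM /p0 mulrCA !patchE indicE; congr (_ * _)%:E.
  have -> : ((x, t) \in A) = (t <= x).
    by apply/idP/idP; [move=> /set_mem|move=> h; exact/mem_set].
  have -> : (x \in I) = (0 <= x <= L).
    by apply/idP/idP; [move=> /set_mem /=; rewrite in_itv|move=> h; apply/mem_set; rewrite /= in_itv].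
  have -> : (x \in `[t, L]%classic) = (t <= x <= L).
    by apply/idP/idP; [move=> /set_mem /=; rewrite in_itv|move=> h; apply/mem_set; rewrite /= in_itv].
  case: (leP t x) => [tx|]; last by rewrite mulr0.
  by rewrite (le_trans t0 tx) mulr1.
have ptLi : mu.-integrable `[t, L] (EFin \o psi) by exact: integrable_continuous_leb.
have mtL : measurable (`[t, L] : set lebR) by exact: measurable_itv_leb.
rewrite integralZl//; last exact: integrable_patch.
rewrite EFin_Rintegral//; last exact: integrable_patch.
rewrite -EFinM; congr (_ * _)%:E.
by rewrite -Rintegral_mkcond (Rintegral_FTC2 tL cpsi dPsi).
Qed.

Lemma integrable_mul_J : integrableI (psi \* J w).
Proof.
apply/integrable_mkcond => //; rewrite restrict_EFin.
have := integrable_fubini_F Ki.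
by apply: eq_integrable => // x _; rewrite /fubini_F KF.
Qed.

Lemma Rintegral_mul_J :
  \int[mu]_(x in I) (psi x * J w x) = \int[mu]_(t in I) (w t * (Psi L - Psi t)).
Proof.
have := Fubini Ki.
under eq_integral do rewrite KF.
under [RHS]eq_integral do rewrite KG.
by rewrite -/(Rintegral mu setT _) => /(congr1 fine) h; rewrite Rintegral_mkcond [RHS]Rintegral_mkcond.
Qed.

End fubini.

(** Measurability of [J w] is itself a product of Fubini's theorem: it is the inner integral of the
    kernel for [psi = 1]. *)
Lemma integrable_J w : integrableI w -> integrableI (J w).
Proof.
move=> wi; have cc : continuous (cst 1 : R -> R) by exact: cst_continuous.
have := @integrable_mul_J w (cst 1) wi cc.
by apply: eq_integrable => // x _ /=; rewrite mul1r.
Qed.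

Lemma le_norm_J w x : integrableI w -> x <= L -> `|J w x| <= J (fun t => `|w t|) x.
Proof.
move=> wi xL; apply: le_normr_Rintegral; first exact: measurable_itv_leb.
exact: integrable_0x.
Qed.

Lemma le_J w v x : integrableI w -> integrableI v -> x <= L ->
  (forall t, 0 <= t <= L -> w t <= v t) -> J w x <= J v x.
Proof.
move=> wi vi xL wv; apply: le_Rintegral; first exact: measurable_itv_leb.
- exact: integrable_0x.
- exact: integrable_0x.
by move=> t /=; rewrite in_itv/= => /andP[t0 tx]; rewrite wv// t0 (le_trans tx).
Qed.

Lemma le_J_L w x : integrableI w -> x <= L ->
  (forall t, 0 <= t <= L -> 0 <= w t) -> J w x <= J w L.
Proof.
move=> wi xL w0; rewrite /J Rintegral_mkcond [leRHS]Rintegral_mkcond.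
apply: le_Rintegral => //.
- by apply: integrable_patch; [exact: measurable_itv_leb|exact: integrable_0x].
- exact: integrable_patch.
move=> t _; rewrite !patchE; case: ifPn => [/set_mem/=|_].
  rewrite in_itv/= => /andP[t0 tx]; rewrite mem_set//= in_itv/= t0 (le_trans tx)//.
by case: ifPn => [/set_mem/=|//]; rewrite in_itv/=; exact: w0.
Qed.

Lemma J_ae_eq w v x : integrableI w -> integrableI v -> x <= L ->
  {ae mu, forall t, I t -> w t = v t} -> J w x = J v x.
Proof.
move=> wi vi xL wv; rewrite /J /Rintegral; congr fine.
have sub : `[0, x]%classic `<=` I by apply: subset_itvl; rewrite bnd_simp.
apply: ae_eq_integral; first exact: measurable_itv_leb.
- by apply: (measurable_int mu); exact: integrable_0x.
- by apply: (measurable_int mu); exact: integrable_0x.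
- by apply: filterS wv => t wvt tx; rewrite /= wvt//; exact: sub.
Qed.

Lemma JD (a b : R) w v x : integrableI w -> integrableI v -> x <= L ->
  J (fun t => a * w t + b * v t) x = a * J w x + b * J v x.
Proof.
move=> wi vi xL; rewrite /J.
have mx : measurable (`[0, x] : set lebR) by exact: measurable_itv_leb.
have wxi := integrable_0x wi xL; have vxi := integrable_0x vi xL.
rewrite RintegralD//; last 2 first.
- have := integrableZl mx a wxi; exact: eq_integrable.
- have := integrableZl mx b vxi; exact: eq_integrable.
by rewrite !RintegralZl.
Qed.

Lemma integrable_mul_continuous w psi : integrableI w -> continuous psi ->
  integrableI (w \* psi).
Proof.
move=> wi cpsi.
have : bounded_set (psi @` `[0, L]).
  apply: compact_bounded; apply: continuous_compact; last exact: segment_compact.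
  exact/continuous_subspaceT.
move=> [M [Mr Mle]].
apply: (@integrableMl _ _ _ mu I measurable_I (EFin \o w) psi) => //.
- by apply: measurable_fun_leb; exact: continuous_measurable_fun.
- by exists M; split => // x /Mle h y yI; apply: h; exists y.
Qed.

(** The exchange of integrals with [psi = derive1 phi] and [Psi = phi], in place of an integration
    by parts that would ask for regularity of [J w]. The boundary term is [phi L = 0]. *)
Lemma Rintegral_J_derive1 w phi : integrableI w -> test_function L phi ->
  \int[mu]_(x in I) (J w x * derive1 phi x) = - \int[mu]_(x in I) (w x * phi x).
Proof.
move=> wi tphi; have sphi := test_function_smooth tphi.
have cphi' : continuous (derive1 phi) by exact/smooth_continuous/smooth_derive1.
have cphi : continuous phi by exact/smooth_continuous.
under eq_Rintegral do rewrite mulrC.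
rewrite (Rintegral_mul_J wi cphi' (smooth_is_derive sphi)).
rewrite (@test_function_eq0 _ L phi L)//; last by rewrite ltxx andbF.
have wphi := integrable_mul_continuous wi cphi.
rewrite -[RHS]mulN1r -RintegralZl//; apply: eq_Rintegral => x _.
by rewrite sub0r mulrN mulN1r.
Qed.

(** Dominated convergence, with bound [|v|], turns the bumps into the indicator of []a, b[]. Testing
    on bumps, instead of on all test functions, makes the result available to [du_bois_reymond] as
    well. *)
Lemma bump_ae_eq0 v : integrableI v ->
  (forall a b n, 0 <= a -> a < b -> b <= L -> (0 < n)%N ->
    \int[mu]_(x in I) (v x * bump_fun a b n x) = 0) ->
  {ae mu, forall x, I x -> v x = 0}.
Proof.
move=> vi v0; apply: integral_itv_eq0 => // a b a0 ab bL.
have abI : `]a, b[%classic `<=` I.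
  move=> x /=; rewrite !in_itv/= => /andP[ax xb].
  by rewrite (le_trans a0 (ltW ax)) (le_trans (ltW xb) bL).
have mab : measurable (`]a, b[ : set lebR) by exact: measurable_itv_leb.
have vabi : integrableI (v \_ `]a, b[).
  rewrite -restrict_EFin; apply/integrable_restrict => //.
  by rewrite setIidr//; exact: integrableS vi.
have mv : measurable_fun I (EFin \o v) by exact: measurable_int vi.
have bi n : integrableI (v \* bump_fun a b n).
  apply: integrable_mul_continuous => //; apply: smooth_continuous.
  exact: smooth_bump.
(* The index is shifted to [n.+1] because the support of a bump is located for positive indices. *)
have lim : forall x, (fun n => (v x * bump_fun a b n.+1 x)%:E) @ \oo -->
    ((v \_ `]a, b[) x)%:E.
  move=> x; apply: cvg_EFin; first exact: nearW.
  rewrite patchE; case: ifPn => [/set_mem/=|].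
    rewrite in_itv/= => xab; rewrite -[X in _ --> X]mulr1.
    have h : bump_fun a b n.+1 x @[n --> \oo] --> (1 : R).
      by have := cvg_bump xab; rewrite -cvg_shiftS.
    have {}h : v x * bump_fun a b n.+1 x @[n --> \oo] --> v x * 1.
      by apply: cvgM => //; exact: cvg_cst.
    exact: h.
  move=> /negP xab; apply: cvg_near_cst; apply: nearW => n.
  rewrite /= bump_eq0 ?mulr0//; apply/negP => /andP[h1 h2]; apply: xab.
  apply/mem_set; rewrite /= in_itv/=.
  have n0 : 0 < n.+1%:R^-1 :> R by rewrite invr_gt0.
  by rewrite (lt_trans _ h1) ?ltrDl//= (lt_trans h2)// gtrBl.
have [|||] := @dominated_convergence _ _ _ mu I measurable_I
  (fun n x => (v x * bump_fun a b n.+1 x)%:E) (EFin \o (v \_ `]a, b[))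
  (fun x => `|(v x)%:E|)%E
  (fun n => measurable_int _ (bi n.+1)) (measurable_int _ vabi).
- by apply: aeW => x _; exact: lim.
- exact: integrable_abse vi.
- apply: aeW => x n _; rewrite lee_fin normrM ler_piMr//.
  by rewrite ger0_norm ?bump_ge0// bump_le1.
move=> _ _.
have -> : (fun n => (\int[mu]_(x in I) (v x * bump_fun a b n.+1 x)%:E)%E) = cst 0%E.
  apply/funext => n; rewrite EFin_Rintegral//; first by rewrite v0.
  exact: (bi n.+1).
move=> /cvg_lim; rewrite lim_cst// => h.
rewrite -[in LHS](setIidr abI) Rintegral_mkcondr /Rintegral -h//.
Qed.

Lemma test_function_bump a b n : 0 <= a -> b <= L -> (0 < n)%N ->
  test_function L (bump_fun a b n).
Proof.
move=> a0 bL n0.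
have n0' : 0 < n%:R^-1 :> R by rewrite invr_gt0 ltr0n.
apply: (@test_function_itv _ _ _ (a + n%:R^-1) (b - n%:R^-1)).
- exact: smooth_bump.
- lra.
- lra.
move=> x; apply: contra_neqT => h; apply: bump_eq0 => //; apply: contra h.
by move=> /andP[/ltW-> /ltW->].
Qed.

Lemma fundamental_lemma v : integrableI v ->
  (forall phi, test_function L phi -> \int[mu]_(x in I) (v x * phi x) = 0) ->
  {ae mu, forall x, I x -> v x = 0}.
Proof.
move=> vi v0; apply: bump_ae_eq0 => // a b n a0 ab bL n0.
exact/v0/test_function_bump.
Qed.

Lemma bump_antiderivative a b n : 0 <= a -> (0 < n)%N ->
  exists Psi : R -> R, (forall x : R, is_derive x (1 : R) Psi (bump_fun a b n x)) /\
    forall x, x <= n%:R^-1 -> Psi x = 0.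
Proof.
move=> a0 n0; have n0' : 0 < n%:R^-1 :> R by rewrite invr_gt0 ltr0n.
apply: antiderivative => //; first exact/smooth_continuous/smooth_bump.
move=> x xn; apply: bump_eq0 => //; apply/negP => /andP[h _]; lra.
Qed.

(** A bump minus a suitable multiple of one reference bump has a primitive vanishing near both ends,
    hence a test function. Testing [v] against the derivative of this primitive shows that [v]
    integrates against every bump as the constant [c] does. *)
Lemma du_bois_reymond v : 0 < L -> integrableI v ->
  (forall phi, test_function L phi ->
    \int[mu]_(x in I) (v x * derive1 phi x) = 0) ->
  exists c, {ae mu, forall x, I x -> v x = c}.
Proof.
move=> L0 vi v0.
(* The condition [2 / N < L] makes the reference bump [bump_fun 0 L N] positive on the nonempty
   interval []1/N, L - 1/N[]. *)
have [N [N0 NL]] : exists N, (0 < N)%N /\ 2 * N%:R^-1 < L.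
  exists (Num.trunc (2 / L)).+1; split => //.
  by rewrite ltr_pdivrMr ?ltr0n// mulrC -ltr_pdivrMr// truncnS_gt.
have N0' : 0 < N%:R^-1 :> R by rewrite invr_gt0 ltr0n.
have [B [dB B0]] := bump_antiderivative L (lexx 0) N0.
(* The mean value theorem shows that [B] grows from [1/N] to [L - 1/N]; from there to [L] it is
   constant. *)
have BL : 0 < B L.
  have [||c cNL] := @MVT R B (bump_fun 0 L N) N%:R^-1 (L - N%:R^-1).
  - lra.
  - apply: continuous_subspaceT => x.
    by apply/differentiable_continuous/derivable1_diffP; case: (dB x).
  rewrite (B0 N%:R^-1)// subr0 => BE.
  have : 0 < B (L - N%:R^-1).
    rewrite BE mulr_gt0 ?subr_gt0 ?bump_gt0E//; last lra.
    by move: cNL; rewrite in_itv/= add0r.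
  suff -> : B L = B (L - N%:R^-1) by [].
  apply/eqP; rewrite -subr_eq0 -(Rintegral_FTC2 _ _ dB); last 2 first.
  - lra.
  - exact/smooth_continuous/smooth_bump.
  rewrite (@eq_Rintegral _ _ _ _ _ (cst 0)).
    by rewrite Rintegral_cst//= ?mul0r//; exact: measurable_itv_leb.
  move=> t; rewrite inE/= in_itv/= => /andP[tL _]; rewrite bump_eq0//.
  by apply/negP => /andP[_ h]; lra.
(* As [B L] is the integral of the reference bump, [c] is the average of [v] weighted by that
   bump. *)
pose c := (\int[mu]_(x in I) (v x * bump_fun 0 L N x)) / B L.
exists c.
have ci : integrableI (cst c).
  by apply: integrable_continuous_leb => x; exact: cvg_cst.
have vci : integrableI (fun x => v x - c).
  have := integrableB measurable_I vi ci; exact: eq_integrable.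
suff : {ae mu, forall x, I x -> v x - c = 0}.
  by apply: ae_mono => x h /h /eqP; rewrite subr_eq0 => /eqP.
apply: bump_ae_eq0 => // a b n a0 ab bL n0.
have n0' : 0 < n%:R^-1 :> R by rewrite invr_gt0 ltr0n.
have [F [dF F0]] := bump_antiderivative b a0 n0.
(* Chosen so that [phi L = 0]; near 0, [phi] vanishes because [F] and [B] do. *)
pose k := F L / B L.
pose phi := F \- (fun x => k * B x).
pose dphi := bump_fun a b n \- (fun x => k * bump_fun 0 L N x).
have dphiE x : is_derive x 1 phi (dphi x).
  by apply: is_deriveB; have := is_deriveZ k (dB x).
have sdphi : smooth dphi.
  rewrite (_ : dphi = bump_fun a b n \+ (cst (- k) \* bump_fun 0 L N)); last first.
    by apply/funext => x; rewrite /dphi /= mulNr.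
  apply: smoothD; first exact: smooth_bump.
  by apply: smoothM; [exact: smooth_cst|exact: smooth_bump].
pose d : R := Num.min n%:R^-1 N%:R^-1.
have [d0 dn dN] : [/\ 0 < d, d <= n%:R^-1 & d <= N%:R^-1].
  by rewrite /d lt_min n0' N0' !ge_min !lexx orbT.
have dphi0 x : L - d <= x -> dphi x = 0.
  move=> dx; rewrite /dphi /= !bump_eq0 ?mulr0 ?subr0//;
    by apply/negP => /andP[_ h]; clear -dx h dn dN bL; lra.
have phiL : phi L = 0.
  by rewrite /phi /= /k divfK ?subrr// gt_eqF.
have tphi : test_function L phi.
  apply: (@test_function_itv _ _ _ d (L - d)) => //.
  - exact: smoothS dphiE sdphi.
  - by rewrite gtrBl.
  move=> x; apply: contra_neqT => /nandP[]; rewrite -ltNge => xd.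
    by rewrite /phi /= F0 ?B0 ?mulr0 ?subrr//; clear -xd dn dN; lra.
  apply/eqP.
  (* Beyond [L - d] the derivative of [phi] is 0, so [phi] keeps there the value [phi L = 0]. *)
  have int0 y z : y <= z -> L - d <= y -> phi z - phi y = 0.
    move=> yz dy; rewrite -(Rintegral_FTC2 yz (smooth_continuous sdphi) dphiE).
    rewrite (@eq_Rintegral _ _ _ _ _ (cst 0)).
      by rewrite Rintegral_cst//= ?mul0r//; exact: measurable_itv_leb.
    by move=> t; rewrite inE/= in_itv/= => /andP[yt _]; rewrite dphi0// (le_trans dy).
  have [Lx|xL'] := leP L x.
    have dL : L - d <= L by rewrite gerBl ltW.
    by have := int0 L x Lx dL; rewrite phiL subr0 => ->.
  by have := int0 x L (ltW xL') (ltW xd); rewrite phiL sub0r => /eqP; rewrite oppr_eq0.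
have := v0 _ tphi; rewrite (derive1_is_derive dphiE).
have vb a' b' n' : integrableI (v \* bump_fun a' b' n').
  by apply: integrable_mul_continuous => //; exact/smooth_continuous/smooth_bump.
have bi : integrableI (bump_fun a b n).
  by apply: integrable_continuous_leb; exact/smooth_continuous/smooth_bump.
have -> : \int[mu]_(x in I) (v x * dphi x) =
    \int[mu]_(x in I) (v x * bump_fun a b n x) -
    k * \int[mu]_(x in I) (v x * bump_fun 0 L N x).
  rewrite -RintegralZl//; last exact: vb.
  rewrite -RintegralB//; last 2 first.
  - exact: vb.
  - have := integrableZl measurable_I k (vb 0 L N); exact: eq_integrable.
  by apply: eq_Rintegral => x _; rewrite /dphi /= mulrBr [v x * (k * _)]mulrCA.
move=> /eqP; rewrite subr_eq0 => /eqP vE.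
under eq_Rintegral do rewrite mulrBl.
rewrite RintegralB//; last 2 first.
- exact: vb.
- have := integrableZl measurable_I c bi; exact: eq_integrable.
rewrite RintegralZl// vE (Rintegral_FTC2 (ltW L0) _ dF); last first.
  exact/smooth_continuous/smooth_bump.
rewrite (F0 0) ?subr0 ?ltW// /k /c.
set X := Rintegral _ _ _; clearbody X; clear; ring.
Qed.

End integral_from_0.

(** * Complex-valued functions *)

Section complex_functions.
Variable R : realType.
Implicit Types (z w : R[i]) (f g : R -> R[i]).

Lemma ReDE z w : complex.Re (z + w) = complex.Re z + complex.Re w.
Proof. by case: z; case: w. Qed.
Lemma ImDE z w : complex.Im (z + w) = complex.Im z + complex.Im w.
Proof. by case: z; case: w. Qed.
Lemma ReME z w : complex.Re (z * w) =
  complex.Re z * complex.Re w - complex.Im z * complex.Im w.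
Proof. by case: z; case: w. Qed.
Lemma ImME z w : complex.Im (z * w) =
  complex.Re z * complex.Im w + complex.Im z * complex.Re w.
Proof. by case: z; case: w. Qed.

(** Equivalent to the modulus within a factor 2. Like the integral, it splits over real and
    imaginary parts, so that [norm1_CJ] is just the real inequality applied twice. *)
Definition norm1 z : R := `|complex.Re z| + `|complex.Im z|.

Lemma norm1_ge0 z : 0 <= norm1 z. Proof. by rewrite addr_ge0. Qed.

Lemma norm1_eq0 z : norm1 z <= 0 -> z = 0.
Proof.
case: z => x y; rewrite /norm1 /= => h.
have /eqP : `|x| + `|y| == 0 by rewrite eq_le h addr_ge0.
by move/eqP; rewrite paddr_eq0// !normr_eq0 => /andP[/eqP-> /eqP->].
Qed.

Lemma norm1D z w : norm1 (z + w) <= norm1 z + norm1 w.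
Proof. by rewrite /norm1 ReDE ImDE addrACA lerD// ler_normD. Qed.

Lemma norm1N z : norm1 (- z) = norm1 z.
Proof. by case: z => x y; rewrite /norm1 /= !normrN. Qed.

Lemma norm1_0 : norm1 0 = 0.
Proof. by rewrite /norm1 /= normr0 addr0. Qed.

Lemma norm1M z w : norm1 (z * w) <= norm1 z * norm1 w.
Proof.
rewrite /norm1 ReME ImME (le_trans (lerD (ler_normB _ _) (ler_normD _ _)))//.
by rewrite !normrM; lra.
Qed.

Lemma norm1_sum (I : Type) (s : seq I) (F : I -> R[i]) :
  norm1 (\sum_(i <- s) F i) <= \sum_(i <- s) norm1 (F i).
Proof.
elim: s => [|i s IHs]; first by rewrite !big_nil norm1_0.
by rewrite !big_cons (le_trans (norm1D _ _))// lerD2l.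
Qed.

Lemma normc_le_norm1 z : Normc.normc z <= norm1 z.
Proof. exact: normc_le_ReIm. Qed.

Lemma norm1_le_normc z : norm1 z <= 2 * Normc.normc z.
Proof. by have [? ?] := ReIm_le_normc z; rewrite /norm1 mulr2n mulrDl !mul1r lerD. Qed.

End complex_functions.

(** * Complex integration, Gronwall's inequality and Volterra equations *)

Section complex_integrable.
Variables (R : realType) (L : R).
Local Notation mu := (@completed_lebesgue_measure R).
Local Notation lebR := (caratheodory_type (wlength (@idfun R))^*%mu).
Local Notation I := (`[0, L]%classic : set lebR).
Local Notation integrableI f := (mu.-integrable I (EFin \o f)).
Implicit Types (a : R[i]) (f g : R -> R[i]).
Local Hint Resolve measurable_I : core.

Lemma lebesgue_measurableD f g : lebesgue_measurable L f ->
  lebesgue_measurable L g -> lebesgue_measurable L (fun x => f x + g x).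
Proof.
move=> [f1 f2] [g1 g2]; split.
  rewrite (_ : (fun x => _) = (fun x => complex.Re (f x) + complex.Re (g x))).
    exact: measurable_funD.
  by apply/funext => x; rewrite ReDE.
rewrite (_ : (fun x => _) = (fun x => complex.Im (f x) + complex.Im (g x))).
  exact: measurable_funD.
by apply/funext => x; rewrite ImDE.
Qed.

Lemma lebesgue_measurableM f g : lebesgue_measurable L f ->
  lebesgue_measurable L g -> lebesgue_measurable L (fun x => f x * g x).
Proof.
move=> [f1 f2] [g1 g2]; split.
  rewrite (_ : (fun x => _) = (fun x => complex.Re (f x) * complex.Re (g x) -
      complex.Im (f x) * complex.Im (g x))).
    by apply: measurable_funB; exact: measurable_funM.
  by apply/funext => x; rewrite ReME.
rewrite (_ : (fun x => _) = (fun x => complex.Re (f x) * complex.Im (g x) +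
    complex.Im (f x) * complex.Re (g x))).
  by apply: measurable_funD; exact: measurable_funM.
by apply/funext => x; rewrite ImME.
Qed.

Lemma lebesgue_measurable_cst a : lebesgue_measurable L (fun=> a).
Proof. by split; exact: measurable_cst. Qed.

Lemma lebesgue_measurable_sum (J : Type) (s : seq J) (F : J -> R -> R[i]) :
  (forall j, lebesgue_measurable L (F j)) ->
  lebesgue_measurable L (fun x => \sum_(j <- s) F j x).
Proof.
move=> mF; elim: s => [|j s IHs].
  by under eq_fun do rewrite big_nil; exact: lebesgue_measurable_cst.
by under eq_fun do rewrite big_cons; exact: lebesgue_measurableD.
Qed.

Lemma lebesgue_measurable_eq f g : (forall x, 0 <= x <= L -> f x = g x) ->
  lebesgue_measurable L f -> lebesgue_measurable L g.
Proof.
move=> fg [f1 f2]; split.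
  by apply: eq_measurable_fun f1 => x; rewrite inE/= in_itv/= => /fg ->.
by apply: eq_measurable_fun f2 => x; rewrite inE/= in_itv/= => /fg ->.
Qed.

Lemma measurable_norm1 f : lebesgue_measurable L f ->
  measurable_fun I (fun x => norm1 (f x)).
Proof.
by move=> [f1 f2]; apply: measurable_funD; exact: measurableT_comp.
Qed.

Definition cintegrable f :=
  integrableI (fun x => complex.Re (f x)) /\ integrableI (fun x => complex.Im (f x)).

Lemma cintegrable_measurable f : cintegrable f -> lebesgue_measurable L f.
Proof.
move=> [f1 f2].
by split; apply/measurable_EFinP; [exact: (measurable_int _ f1)|exact: (measurable_int _ f2)].
Qed.

Lemma integrable_norm1 f : cintegrable f -> integrableI (fun x => norm1 (f x)).
Proof.
move=> [/integrable_norm f1 /integrable_norm f2].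
by have := integrableD (measurable_I L) f1 f2; exact: eq_integrable.
Qed.

Lemma le_cintegrable f (h : R -> R) : lebesgue_measurable L f -> integrableI h ->
  (forall x, 0 <= x <= L -> norm1 (f x) <= h x) -> cintegrable f.
Proof.
move=> [f1 f2] hi fh; split; apply: le_integrable hi => //.
- exact/measurable_EFinP.
- move=> x /=; rewrite in_itv/= => /fh fx; rewrite lee_fin.
  by rewrite (le_trans _ (ler_norm _))// (le_trans _ fx)// lerDl.
- exact/measurable_EFinP.
- move=> x /=; rewrite in_itv/= => /fh fx; rewrite lee_fin.
  by rewrite (le_trans _ (ler_norm _))// (le_trans _ fx)// lerDr.
Qed.

Lemma integrable_cstI (c : R) : integrableI (cst c).
Proof. by apply: integrable_continuous_leb => x; exact: cvg_cst. Qed.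

Lemma bounded_cintegrable f (B : R) : lebesgue_measurable L f ->
  (forall x, 0 <= x <= L -> norm1 (f x) <= B) -> cintegrable f.
Proof. by move=> mf; apply: le_cintegrable => //; exact: integrable_cstI. Qed.

Lemma cintegrable_lin a f g : cintegrable f -> cintegrable g ->
  cintegrable (fun x => a * f x + g x).
Proof.
move=> fi gi.
have h : integrableI (fun x => norm1 a * norm1 (f x) + norm1 (g x)).
  have := integrableD (measurable_I L)
    (integrableZl (measurable_I L) (norm1 a) (integrable_norm1 fi)) (integrable_norm1 gi).
  exact: eq_integrable.
apply: (le_cintegrable _ h) => [|x _].
  apply: lebesgue_measurableD; last exact: cintegrable_measurable.
  by apply: lebesgue_measurableM; [exact: lebesgue_measurable_cst|exact: cintegrable_measurable].
by rewrite (le_trans (norm1D _ _))// lerD2r norm1M.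
Qed.

Lemma cintegrableB f g : cintegrable f -> cintegrable g ->
  cintegrable (fun x => f x - g x).
Proof.
move=> fi gi; have := cintegrable_lin (-1) gi fi.
by under eq_fun do rewrite mulN1r addrC.
Qed.

Lemma cintegrable0 : cintegrable (fun=> 0).
Proof. by apply: (@bounded_cintegrable _ 0) => [|x _]; [exact: lebesgue_measurable_cst|rewrite norm1_0]. Qed.

Definition CJ f x : R[i] := complex_integral x f.

Lemma CJE f x : CJ f x = (J (fun t => complex.Re (f t)) x) +i* (J (fun t => complex.Im (f t)) x).
Proof. by []. Qed.

Lemma CJ_lin a f g x : cintegrable f -> cintegrable g -> x <= L ->
  CJ (fun t => a * f t + g t) x = a * CJ f x + CJ g x.
Proof.
move=> [f1 f2] [g1 g2] xL; rewrite !CJE.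
case: a => a b.
have fab : integrableI (fun t => a * complex.Re (f t) + (- b) * complex.Im (f t)).
  have := integrableD (measurable_I L) (integrableZl (measurable_I L) a f1)
    (integrableZl (measurable_I L) (- b) f2).
  exact: eq_integrable.
have fba : integrableI (fun t => a * complex.Im (f t) + b * complex.Re (f t)).
  have := integrableD (measurable_I L) (integrableZl (measurable_I L) a f2)
    (integrableZl (measurable_I L) b f1).
  exact: eq_integrable.
have -> : (fun t => complex.Re ((a +i* b) * f t + g t)) =
    (fun t => 1 * (a * complex.Re (f t) + (- b) * complex.Im (f t)) + 1 * complex.Re (g t)).
  by apply/funext => t; rewrite ReDE ReME /= !mul1r mulNr.
have -> : (fun t => complex.Im ((a +i* b) * f t + g t)) =
    (fun t => 1 * (a * complex.Im (f t) + b * complex.Re (f t)) + 1 * complex.Im (g t)).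
  by apply/funext => t; rewrite ImDE ImME /= !mul1r.
rewrite !(JD _ _ fab g1 xL) !(JD _ _ fba g2 xL) (JD _ _ f1 f2 xL) (JD _ _ f2 f1 xL).
by apply/eqP; rewrite eq_complex/=; apply/andP; split; apply/eqP; ring.
Qed.

Lemma cintegrable_CJ f : cintegrable f -> cintegrable (CJ f).
Proof. by move=> [f1 f2]; split; apply: integrable_J. Qed.

Lemma norm1_CJ f x : cintegrable f -> x <= L ->
  norm1 (CJ f x) <= J (fun t => norm1 (f t)) x.
Proof.
move=> [f1 f2] xL; rewrite CJE /norm1 /=.
have := JD 1 1 (integrable_norm f1) (integrable_norm f2) xL.
under [X in J X]eq_fun do rewrite !mul1r.
rewrite !mul1r => ->.
by rewrite lerD// (le_norm_J _ xL).
Qed.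

Lemma CJ_ae_eq f g x : cintegrable f -> cintegrable g -> x <= L ->
  {ae mu, forall t, I t -> f t = g t} -> CJ f x = CJ g x.
Proof.
move=> [f1 f2] [g1 g2] xL fg; rewrite !CJE; congr (_ +i* _).
  by apply: (J_ae_eq f1 g1 xL); apply: ae_mono fg => t h /h ->.
by apply: (J_ae_eq f2 g2 xL); apply: ae_mono fg => t h /h ->.
Qed.

Lemma J_cst (c x : R) : 0 <= x -> J (cst c) x = c * x.
Proof.
move=> x0; have dc (t : R) : is_derive t (1 : R) (fun t => c * t) (cst c t).
  have := is_deriveZ c (is_derive_id t (1 : R)).
  by rewrite [_ *: 1]mulr1.
have cc : continuous (cst c : R -> R) by move=> t; exact: cvg_cst.
by rewrite /J (Rintegral_FTC2 x0 cc dc) mulr0 subr0.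
Qed.

Lemma J_expR (M x : R) : 0 < M -> 0 <= x ->
  2 * M * J (fun t => expR (2 * M * t)) x = expR (2 * M * x) - 1.
Proof.
move=> M0 x0; have M20 : 0 < 2 * M by rewrite mulr_gt0.
have ce : continuous (fun t => expR (2 * M * t)).
  move=> t; apply: (@continuous_comp _ _ _ (fun t => 2 * M * t) expR).
    exact: mulrl_continuous.
  exact: continuous_expR.
have de (t : R) : is_derive t (1 : R) (fun t => (2 * M)^-1 * expR (2 * M * t))
    (expR (2 * M * t)).
  have d1 : is_derive t (1 : R) (fun t : R => 2 * M * t) (2 * M).
    have := is_deriveZ (2 * M) (is_derive_id t (1 : R)).
    by rewrite [_ *: 1]mulr1.
  have d2 := is_derive1_comp (is_derive_expR (2 * M * t)) d1.
  have := is_deriveZ (2 * M)^-1 d2.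
  by rewrite [_ *: _]mulrCA mulVf ?mulr1// gt_eqF.
rewrite /J (Rintegral_FTC2 x0 ce de).
by rewrite mulr0 expR0 mulr1 mulrBr mulrA divff ?mul1r// gt_eqF.
Qed.

Lemma J_scale (c : R) (h : R -> R) x : integrableI h -> x <= L ->
  J (fun t => c * h t) x = c * J h x.
Proof.
move=> hi xL; have := JD c 0 hi hi xL.
by under [X in J X]eq_fun do rewrite mul0r addr0; rewrite mul0r addr0.
Qed.

Lemma integrable_expI (M : R) : integrableI (fun t => expR (2 * M * t)).
Proof.
apply: integrable_continuous_leb => t.
apply: (@continuous_comp _ _ _ (fun t => 2 * M * t) expR).
  exact: mulrl_continuous.
exact: continuous_expR.
Qed.

(* In the norm weighted by [expR (- 2 * M * x)], an operator bounded by [M * J] is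
   a contraction with factor [1 / 2]; this drives both Gronwall's inequality and
   the Neumann series below. *)
Lemma le_J_expR (M K x : R) (h : R -> R) : 0 < M -> 0 <= K -> 0 <= x <= L ->
  integrableI h -> (forall t, 0 <= t <= L -> h t <= K * expR (2 * M * t)) ->
  M * J h x <= K / 2 * expR (2 * M * x).
Proof.
move=> M0 K0 /andP[x0 xL] hi hK.
have ei := integrable_expI M.
have Kei : integrableI (fun t => K * expR (2 * M * t)).
  have := integrableZl (measurable_I L) K ei; exact: eq_integrable.
rewrite (@le_trans _ _ (M * J (fun t => K * expR (2 * M * t)) x))//.
  by apply: (ler_wpM2l (ltW M0)); exact: (le_J hi Kei xL).
rewrite (J_scale _ ei xL).
have := J_expR M0 x0; set j := J _ _; set e := expR _ => je.
have -> : M * (K * j) = K / 2 * (2 * M * j) by field.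
by rewrite je ler_wpM2l ?divr_ge0// gerBl.
Qed.

Lemma gronwall (phi : R -> R) (B G M : R) : 0 < M -> 0 <= G -> integrableI phi ->
  (forall x, 0 <= x <= L -> phi x <= B) ->
  (forall x, 0 <= x <= L -> phi x <= G + M * J phi x) ->
  forall x, 0 <= x <= L -> phi x <= 2 * G * expR (2 * M * x).
Proof.
move=> M0 G0 phii phiB phiG.
have e1 x : 0 <= x -> 1 <= expR (2 * M * x).
  by move=> x0; rewrite -expR0 ler_expR mulr_ge0// mulr_ge0// ltW.
have step n x : 0 <= x <= L ->
    phi x <= (2 * G + `|B| / 2 ^+ n) * expR (2 * M * x).
  elim: n x => [|n IHn] x xL; have /andP[x0 _] := xL.
    rewrite expr0 divr1 (le_trans (phiB x xL))// (le_trans (ler_norm _))//.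
    rewrite (@le_trans _ _ (2 * G + `|B|))//; first by rewrite lerDr mulr_ge0.
    by rewrite ler_peMr ?e1// addr_ge0// mulr_ge0.
  rewrite (le_trans (phiG x xL))//.
  have K0 : 0 <= 2 * G + `|B| / 2 ^+ n by rewrite addr_ge0// ?divr_ge0// mulr_ge0.
  have := le_J_expR M0 K0 xL phii IHn.
  have := e1 _ x0; set e := expR _ => e1' MJ.
  have : G <= G * e by rewrite ler_peMr.
  rewrite exprS invfM; move: MJ; set b := `|B|; set q := (2 ^+ n)^-1; lra.
move=> x xL; apply/ler_addgt0Pr => eps eps0.
have [n nE] : exists n, `|B| / 2 ^+ n * expR (2 * M * x) <= eps.
  pose c := `|B| * expR (2 * M * x) / eps.
  exists (Num.trunc c).+1.
  have cE : c < 2 ^+ (Num.trunc c).+1.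
    by rewrite (lt_trans (truncnS_gt c))// -natrX ltr_nat ltn_expl.
  rewrite mulrAC ler_pdivrMr ?exprn_gt0//.
  by move: (ltW cE); rewrite {1}/c ler_pdivrMr// [eps * _]mulrC.
by rewrite (le_trans (step n x xL))// mulrDl lerD2l.
Qed.

Lemma J_ge0 (h : R -> R) x : integrableI h -> x <= L ->
  (forall t, 0 <= t <= L -> 0 <= h t) -> 0 <= J h x.
Proof.
move=> hi xL h0; apply: Rintegral_ge0 => t /=; rewrite in_itv/= => /andP[t0 tx].
by rewrite h0// t0 (le_trans tx).
Qed.

Section volterra.
Variables (V : (R -> R[i]) -> R -> R[i]) (M : R).
Hypothesis M0 : 0 < M.
Hypothesis V_int : forall w, cintegrable w -> cintegrable (V w).
Hypothesis V_sub : forall w v, cintegrable w -> cintegrable v ->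
  forall x, 0 <= x <= L -> V (fun t => w t - v t) x = V w x - V v x.
Hypothesis V_le : forall w, cintegrable w ->
  forall x, 0 <= x <= L -> norm1 (V w x) <= M * J (fun t => norm1 (w t)) x.

Let M_ge0 : 0 <= M. Proof. exact: ltW. Qed.

Let V_bounded w : cintegrable w -> forall x, 0 <= x <= L ->
  norm1 (V w x) <= M * J (fun t => norm1 (w t)) L.
Proof.
move=> wi x xL; rewrite (le_trans (V_le wi xL))// ler_wpM2l ?M_ge0//.
apply: le_J_L; [exact: integrable_norm1|by case/andP: xL|].
by move=> t _; exact: norm1_ge0.
Qed.

(** The estimate concerns [w - g = - V w] rather than [w]: it is bounded even when [g] is only
    integrable, and a bounded function is what [gronwall] asks for. *)
Lemma volterra_apriori w g : cintegrable w -> cintegrable g ->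
  (forall x, 0 <= x <= L -> w x + V w x = g x) ->
  forall x, 0 <= x <= L ->
  norm1 (w x - g x) <= 2 * (M * J (fun t => norm1 (g t)) L) * expR (2 * M * x).
Proof.
move=> wi gi wE.
have L0 x : 0 <= x <= L -> 0 <= L by case/andP; exact: le_trans.
move=> x xL; have LL : 0 <= L <= L by rewrite lexx (L0 x xL).
have hE y : 0 <= y <= L -> w y - g y = - V w y.
  by move=> yL; rewrite -wE// opprD addrA subrr sub0r.
have di := cintegrableB wi gi.
have ni := integrable_norm1 wi; have ngi := integrable_norm1 gi.
have ndi := integrable_norm1 di.
apply: (gronwall (B := M * J (fun t => norm1 (w t)) L) M0 _ ndi) => //.
- by rewrite mulr_ge0 ?M_ge0// J_ge0// => t _; exact: norm1_ge0.
- by move=> y yL; rewrite hE// norm1N V_bounded.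
move=> y yL; rewrite hE// norm1N (le_trans (V_le wi yL))//.
have /andP[y0 yL'] := yL.
rewrite -mulrDr ler_wpM2l ?M_ge0//.
rewrite (@le_trans _ _ (J (fun t => norm1 (g t)) y + J (fun t => norm1 (w t - g t)) y))//.
  have := JD 1 1 ngi ndi yL'; rewrite !mul1r => <-.
  apply: (le_J ni _ yL').
    have := integrableD (measurable_I L) ngi ndi; apply: eq_integrable => // t _.
    by rewrite /= !mul1r EFinD.
  by move=> t _; rewrite !mul1r -[w t in leLHS](subrKC (g t)) norm1D.
by rewrite lerD2r le_J_L// => t _; exact: norm1_ge0.
Qed.

(** Neumann series, summed pointwise. The term [d 0 = g] is only integrable while the next ones are
    bounded with geometric decay; hence all the estimates start at [d n.+1] and [s n.+1]. *)
Lemma volterra_exists g : cintegrable g -> exists w, cintegrable w /\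
  forall x, 0 <= x <= L -> w x + V w x = g x.
Proof.
move=> gi.
pose d n := iter n (fun w x => - V w x) g.
have di n : cintegrable (d n).
  elim: n => [//|n IHn].
  have := cintegrable_lin (-1) (V_int IHn) cintegrable0.
  by under eq_fun do rewrite mulN1r addr0.
have dS n x : d n.+1 x = - V (d n) x by [].
(* A bound for [V g] on [[0, L]]; it is 0 when that interval is empty. *)
pose B := M * J (fun t => norm1 (g t)) L.
have B0 : 0 <= B.
  have [L0|L0] := leP 0 L; last first.
    rewrite /B /J set_itv_ge ?Rintegral_set0 ?mulr0//.
    by rewrite bnd_simp -ltNge.
  rewrite /B mulr_ge0 ?M_ge0// J_ge0//; first exact: integrable_norm1.
  by move=> t _; exact: norm1_ge0.
have dle n x : 0 <= x <= L -> norm1 (d n.+1 x) <= B / 2 ^+ n * expR (2 * M * x).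
  elim: n x => [|n IHn] x xL; have /andP[x0 xL'] := xL.
    rewrite expr0 divr1 /= norm1N (le_trans (V_bounded gi xL))// -/B.
    by rewrite ler_peMr// -expR0 ler_expR mulr_ge0// mulr_ge0// ltW.
  rewrite dS norm1N (le_trans (V_le (di n.+1) xL))//.
  have K0 : 0 <= B / 2 ^+ n by rewrite divr_ge0.
  rewrite (le_trans (le_J_expR M0 K0 xL (integrable_norm1 (di n.+1)) IHn))//.
  by rewrite exprSr invfM mulrA.
pose E := expR (2 * M * L).
have dle' n x : 0 <= x <= L -> norm1 (d n.+1 x) <= B * E / 2 ^+ n.
  move=> xL; rewrite (le_trans (dle n x xL))// mulrAC ler_wpM2r ?invr_ge0//.
  rewrite ler_wpM2l// ler_expR ler_wpM2l ?mulr_ge0// ?M_ge0//.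
  by case/andP: xL.
pose s n x : R[i] := \sum_(k < n) d k x.
have sS n x : s n.+1 x = s n x + d n x by rewrite /s big_ord_recr.
have si n : cintegrable (s n).
  elim: n => [|n IHn].
    by rewrite (_ : s 0%N = fun=> 0)//; [exact: cintegrable0
      |apply/funext => x; rewrite /s big_ord0].
  have := cintegrable_lin 1 IHn (di n).
  by under eq_fun do rewrite mul1r -sS.
have sV n x : 0 <= x <= L -> s n.+1 x = g x - V (s n) x.
  move=> xL; elim: n => [|n IHn].
    rewrite sS /s big_ord0 add0r /=.
    have V0 : V (fun=> 0) x = 0.
      have := V_sub cintegrable0 cintegrable0 xL.
      by under [X in V X]eq_fun do rewrite subrr; rewrite subrr.
    have -> : (fun x => \sum_(k < 0) d k x) = (fun=> 0).
      by apply/funext => t; rewrite big_ord0.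
    by rewrite V0 subr0.
  rewrite sS IHn.
  have := V_sub (si n.+1) (si n) xL.
  have -> : (fun t => s n.+1 t - s n t) = d n.
    by apply/funext => t; rewrite sS addrAC subrr add0r.
  by move=> h; rewrite /= h opprB addrA subrK.
(* After [s n.+1] the increments are at most [B * E / 2 ^+ i] with [i >= n], a geometric series of
   sum [2 * B * E / 2 ^+ n]. *)
pose K := 2 * B * E.
have E0 : 0 <= E by exact: expR_ge0.
have sK n k x : 0 <= x <= L ->
    norm1 (s (n + k).+1 x - s n.+1 x) <= K / 2 ^+ n - K / 2 ^+ (n + k).
  move=> xL; elim: k => [|k IHk].
    by rewrite addn0 !subrr norm1_0.
  rewrite addnS sS addrAC (le_trans (norm1D _ _))//.
  rewrite (le_trans (lerD IHk (dle' _ x xL)))//.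
  rewrite exprS invfM /K.
  by set q := (2 ^+ (n + k))^-1; set q' := (2 ^+ n)^-1; lra.
have sC n k x : 0 <= x <= L ->
    norm1 (s n.+1 x - s k.+1 x) <= K * ((2 ^+ n)^-1 + (2 ^+ k)^-1).
  move=> xL.
  have K0 : 0 <= K by rewrite /K mulr_ge0// mulr_ge0.
  have q0 j : 0 <= K / 2 ^+ j by rewrite divr_ge0.
  have h i j : (i <= j)%N ->
      norm1 (s j.+1 x - s i.+1 x) <= K * ((2 ^+ i)^-1 + (2 ^+ j)^-1).
    move=> /subnKC <-; rewrite (le_trans (sK _ _ x xL))// mulrDr lerD2l.
    by rewrite (le_trans _ (q0 _))// oppr_le0.
  have [nk|/ltnW kn] := leqP n k; last by rewrite [2 ^- n + _]addrC h.
  by rewrite -norm1N opprB h.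
(* Real and imaginary parts each contribute [K / 2 ^+ n]. The statement is void outside [[0, L]], so
   that [choice] can produce a function on all of [R]. *)
have wex (x : R) : exists z : R[i], 0 <= x <= L ->
    forall n, norm1 (s n.+1 x - z) <= 2 * K / 2 ^+ n.
  have [xL|] := boolP (0 <= x <= L); last by exists 0.
  have [a aE] : exists a : R, forall n, `|complex.Re (s n.+1 x) - a| <= K * (2 ^+ n)^-1.
    apply: (@real_cauchy_limit R _ (fun n => (2 ^+ n)^-1)) => n k.
    by apply: le_trans (sC n k x xL); case: (s n.+1 x) => ? ?; case: (s k.+1 x) => ? ?;
      rewrite /norm1 /= lerDl.
  have [b bE] : exists b : R, forall n, `|complex.Im (s n.+1 x) - b| <= K * (2 ^+ n)^-1.
    apply: (@real_cauchy_limit R _ (fun n => (2 ^+ n)^-1)) => n k.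
    by apply: le_trans (sC n k x xL); case: (s n.+1 x) => ? ?; case: (s k.+1 x) => ? ?;
      rewrite /norm1 /= lerDr.
  exists (a +i* b) => _ n; move: (aE n) (bE n).
  by case: (s n.+1 x) => u v; rewrite /norm1 /=; lra.
have [w wE] := choice wex.
have K0 : 0 <= K by rewrite /K mulr_ge0// mulr_ge0.
have q20 (c : R) : 0 <= c -> forall eps, 0 < eps -> exists n, c / 2 ^+ n <= eps.
  move=> c0 eps eps0; exists (Num.trunc (c / eps)).+1.
  have cE : c / eps < 2 ^+ (Num.trunc (c / eps)).+1.
    by rewrite (lt_trans (truncnS_gt _))// -natrX ltr_nat ltn_expl.
  rewrite ler_pdivrMr ?exprn_gt0//.
  by move: (ltW cE); rewrite ler_pdivrMr// [eps * _]mulrC.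
have mw : lebesgue_measurable L w.
  have cvgw (p : R[i] -> R) : (forall z, `|p z| <= norm1 z) ->
      (forall z z', p (z - z') = p z - p z') ->
      forall x, I x -> (fun n => p (s n.+1 x)) @ \oo --> p (w x).
    move=> p1 pB x; rewrite /= in_itv/= => xL.
    apply/cvgrPdist_le => eps eps0.
    have [N NE] := q20 (2 * K) (mulr_ge0 (ler0n _ _) K0) _ eps0.
    exists N => // n /= Nn; rewrite distrC -pB (le_trans (p1 _))//.
    rewrite (le_trans (wE x xL n))// (le_trans _ NE)//.
    apply: ler_wpM2l; first by rewrite mulr_ge0.
    rewrite lef_pV2 ?posrE ?exprn_gt0//.
    by rewrite ler_eXn2l ?ltr1n.
  split.
  - apply: (measurable_fun_cvg (fun n => (cintegrable_measurable (si n.+1)).1)).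
    apply: cvgw => [z|[? ?] [? ?]//]; by rewrite /norm1 lerDl.
  - apply: (measurable_fun_cvg (fun n => (cintegrable_measurable (si n.+1)).2)).
    apply: cvgw => [z|[? ?] [? ?]//]; by rewrite /norm1 lerDr.
(* Only the difference with [s 1], which is [g], is known to be bounded. *)
have wi : cintegrable w.
  have wgi : cintegrable (fun x => w x - s 1%N x).
    apply: (@bounded_cintegrable _ (2 * K)).
      apply: lebesgue_measurable_eq (lebesgue_measurableD mw
        (lebesgue_measurableM (lebesgue_measurable_cst (-1)) (cintegrable_measurable (si 1%N)))).
      by move=> x _; rewrite mulN1r.
    move=> x xL; rewrite -norm1N opprB (le_trans (wE x xL 0%N))//.
    by rewrite expr0 divr1.
  have := cintegrable_lin 1 wgi (si 1%N).
  by under eq_fun do rewrite mul1r subrK.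
exists w; split => // x xL; have /andP[x0 xL'] := xL.
apply/eqP; rewrite -subr_eq0; apply/eqP; apply: norm1_eq0.
apply/ler_addgt0Pr => eps eps0; rewrite add0r.
have K20 : 0 <= 2 * K by exact: mulr_ge0.
(* By [sV], the defect [w + V w - g] is the sum of [w - s n.+2] and [V w - V (s n.+1)]. Up to the
   factor [2 ^- n], these are bounded by [2 * K] and [M * (2 * K * L)]. *)
pose c := 2 * K + M * (2 * K * L).
have LK0 : 0 <= L by exact: le_trans xL'.
have [n nE] := q20 c (addr_ge0 (mulr_ge0 (ler0n _ _) K0)
  (mulr_ge0 (ltW M0) (mulr_ge0 (mulr_ge0 (ler0n _ _) K0) LK0))) _ eps0.
rewrite (le_trans _ nE)//.
have -> : w x + V w x - g x = (w x - s n.+2 x) + (V w x - V (s n.+1) x).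
  by rewrite (sV n.+1 x xL); move: (g x) (V w x) (w x) (V _ x) => g0 v0 w0 v1; ring.
rewrite (le_trans (norm1D _ _))// /c mulrDl lerD//.
  rewrite -norm1N opprB (le_trans (wE x xL n.+1))//; apply: (ler_wpM2l K20).
  rewrite lef_pV2 ?posrE ?exprn_gt0// ler_eXn2l ?ltr1n//.
rewrite -(V_sub wi (si n.+1) xL) (le_trans (V_le (cintegrableB wi (si n.+1)) xL))//.
rewrite -mulrA ler_wpM2l ?M_ge0//.
rewrite (@le_trans _ _ (J (cst (2 * K / 2 ^+ n)) x))//.
  apply: (le_J _ (integrable_cstI _) xL'); first exact/integrable_norm1/cintegrableB.
  by move=> t tL; rewrite -norm1N opprB wE.
rewrite J_cst// mulrAC; apply: ler_wpM2r; first by rewrite invr_ge0.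
exact: (ler_wpM2l K20).
Qed.

End volterra.

End complex_integrable.

(** * Square integrable functions *)

Section square_integrable.
Variables (R : realType) (L : R).
Local Notation mu := (@completed_lebesgue_measure R).
Local Notation lebR := (caratheodory_type (wlength (@idfun R))^*%mu).
Local Notation I := (`[0, L]%classic : set lebR).
Local Notation integrableI f := (mu.-integrable I (EFin \o f)).
Implicit Types (a : R[i]) (f g : R -> R[i]).
Local Hint Resolve measurable_I : core.

Lemma sqr_normc (z : R[i]) :
  Normc.normc z ^+ 2 = complex.Re z ^+ 2 + complex.Im z ^+ 2.
Proof. by case: z => x y /=; rewrite sqr_sqrtr// addr_ge0 ?sqr_ge0. Qed.

Lemma sqr_normcD (z w : R[i]) : Normc.normc (z + w) ^+ 2 <=
  2 * Normc.normc z ^+ 2 + 2 * Normc.normc w ^+ 2.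
Proof.
rewrite !sqr_normc ReDE ImDE; move: (complex.Re _) (complex.Im _) (complex.Re _) (complex.Im _).
move=> x y x' y'.
rewrite -subr_ge0 (_ : _ - _ = (x - x') ^+ 2 + (y - y') ^+ 2); last by ring.
by rewrite addr_ge0 ?sqr_ge0.
Qed.

Lemma measurable_sqr_normc f : lebesgue_measurable L f ->
  measurable_fun I (fun x => Normc.normc (f x) ^+ 2).
Proof.
move=> [f1 f2]; rewrite (_ : (fun x => _) =
  (fun x => complex.Re (f x) ^+ 2 + complex.Im (f x) ^+ 2)).
  by apply: measurable_funD; exact: measurable_funX.
by apply/funext => x; rewrite sqr_normc.
Qed.

Lemma square_integrableP f : square_integrable L f <->
  lebesgue_measurable L f /\ integrableI (fun x => Normc.normc (f x) ^+ 2).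
Proof.
split=> -[mf fi]; split => //.
- apply/integrableP; split; first exact/measurable_EFinP/measurable_sqr_normc.
  apply: le_lt_trans fi; rewrite le_eqVlt; apply/orP; left; apply/eqP.
  by apply: eq_integral => x _ /=; rewrite ger0_norm ?sqr_ge0.
- move/integrableP: fi => [_]; apply: le_lt_trans.
  rewrite le_eqVlt; apply/orP; left; apply/eqP.
  by apply: eq_integral => x _ /=; rewrite ger0_norm ?sqr_ge0.
Qed.

Definition L2_sqr f : R := \int[mu]_(x in I) Normc.normc (f x) ^+ 2.

Lemma L2_sqr_ge0 f : 0 <= L2_sqr f.
Proof. by apply: Rintegral_ge0 => x _; exact: sqr_ge0. Qed.

Lemma L2_normE f : L2_norm L f ^+ 2 = L2_sqr f.
Proof. by rewrite sqr_sqrtr// L2_sqr_ge0. Qed.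

Lemma le_square_integrable f (h : R -> R) : lebesgue_measurable L f ->
  integrableI h -> (forall x, 0 <= x <= L -> Normc.normc (f x) ^+ 2 <= h x) ->
  square_integrable L f /\ L2_sqr f <= \int[mu]_(x in I) h x.
Proof.
move=> mf hi fh.
have fi : integrableI (fun x => Normc.normc (f x) ^+ 2).
  apply: le_integrable hi => //; first exact/measurable_EFinP/measurable_sqr_normc.
  move=> x /=; rewrite in_itv/= => /fh h1; rewrite lee_fin ger0_norm ?sqr_ge0//.
  exact: le_trans h1 (ler_norm _).
split; first exact/square_integrableP.
by apply: le_Rintegral => // x /=; rewrite in_itv/=; exact: fh.
Qed.

(** Domination by [1 + |f| ^+ 2], which is at least [2 * |f|]; the constant is integrable as the
    interval is bounded. *)
Lemma cintegrable_square f : square_integrable L f -> cintegrable L f.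
Proof.
move=> /square_integrableP[mf fi].
have hi : integrableI (fun x => 1 + Normc.normc (f x) ^+ 2).
  by have := integrableD (measurable_I L) (integrable_cstI L 1) fi; exact: eq_integrable.
apply: (le_cintegrable mf hi) => x _; rewrite (le_trans (norm1_le_normc _))//.
rewrite -subr_ge0 (_ : _ - _ = (1 - Normc.normc (f x)) ^+ 2) ?sqr_ge0//; ring.
Qed.

Lemma square_measurable f : square_integrable L f -> lebesgue_measurable L f.
Proof. by case. Qed.

Lemma square_integrableD f g : square_integrable L f -> square_integrable L g ->
  square_integrable L (fun x => f x + g x) /\
  L2_sqr (fun x => f x + g x) <= 2 * L2_sqr f + 2 * L2_sqr g.
Proof.
move=> /square_integrableP[mf fi] /square_integrableP[mg gi].
have f2 : integrableI (fun x => 2 * Normc.normc (f x) ^+ 2).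
  by have := integrableZl (measurable_I L) 2 fi; exact: eq_integrable.
have g2 : integrableI (fun x => 2 * Normc.normc (g x) ^+ 2).
  by have := integrableZl (measurable_I L) 2 gi; exact: eq_integrable.
have hi : integrableI (fun x => 2 * Normc.normc (f x) ^+ 2 + 2 * Normc.normc (g x) ^+ 2).
  by have := integrableD (measurable_I L) f2 g2; exact: eq_integrable.
have [|? h] := @le_square_integrable (fun x => f x + g x) _ (lebesgue_measurableD mf mg) hi.
  by move=> x _; exact: sqr_normcD.
split => //; rewrite (le_trans h)// RintegralD// !RintegralZl//.
Qed.

Lemma square_integrableM (c : R -> R[i]) (A : R) f : lebesgue_measurable L c ->
  (forall x, 0 <= x <= L -> Normc.normc (c x) <= A) -> square_integrable L f ->
  square_integrable L (fun x => c x * f x) /\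
  L2_sqr (fun x => c x * f x) <= A ^+ 2 * L2_sqr f.
Proof.
move=> mc cA /square_integrableP[mf fi].
have hi : integrableI (fun x => A ^+ 2 * Normc.normc (f x) ^+ 2).
  by have := integrableZl (measurable_I L) (A ^+ 2) fi; exact: eq_integrable.
have [|? h] := @le_square_integrable (fun x => c x * f x) _ (lebesgue_measurableM mc mf) hi.
  move=> x /cA cx; rewrite Normc.normcM exprMn ler_wpM2r ?sqr_ge0//.
  by rewrite lerXn2r ?nnegrE ?normc_ge0// (le_trans (normc_ge0 _) cx).
by split => //; rewrite (le_trans h)// RintegralZl.
Qed.

Lemma square_integrableZ a f : square_integrable L f ->
  square_integrable L (fun x => a * f x).
Proof.
move=> fi; apply: (@square_integrableM (fun=> a) (Normc.normc a) f _ _ fi).1 => //.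
Qed.

Lemma L2_sqrZ a f : square_integrable L f ->
  L2_sqr (fun x => a * f x) = Normc.normc a ^+ 2 * L2_sqr f.
Proof.
move=> /square_integrableP[mf fi]; rewrite /L2_sqr -RintegralZl//.
by apply: eq_Rintegral => x _; rewrite Normc.normcM exprMn.
Qed.

Lemma square_integrable0 : square_integrable L (fun=> 0).
Proof.
apply/square_integrableP; split; first exact: lebesgue_measurable_cst.
by rewrite Normc.normc0 expr0n; exact: integrable_cstI.
Qed.

Lemma square_integrable_sum (K : Type) (s : seq K) (F : K -> R -> R[i]) :
  (forall k, square_integrable L (F k)) ->
  square_integrable L (fun x => \sum_(k <- s) F k x).
Proof.
move=> Fi; elim: s => [|k s IHs].
  by under eq_fun do rewrite big_nil; exact: square_integrable0.
by under eq_fun do rewrite big_cons; exact: (square_integrableD (Fi k) IHs).1.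
Qed.

Lemma bounded_square_integrable f (B : R) : 0 <= L -> lebesgue_measurable L f ->
  (forall x, 0 <= x <= L -> norm1 (f x) <= B) ->
  square_integrable L f /\ L2_sqr f <= B ^+ 2 * L.
Proof.
move=> L0 mf fB.
have [|? h] := @le_square_integrable f _ mf (integrable_cstI L (B ^+ 2)).
  move=> x /fB fx; have fx' := le_trans (normc_le_norm1 (f x)) fx.
  by rewrite lerXn2r ?nnegrE ?normc_ge0// (le_trans (normc_ge0 _) fx').
split => //; rewrite (le_trans h)//.
by have := J_cst (B ^+ 2) L0; rewrite /J => ->.
Qed.

(** Expansion of the nonnegative integral of [(h - c) ^+ 2], where [c] is the mean of [h]. *)
Lemma cauchy_schwarz (h : R -> R) : 0 < L -> integrableI h ->
  integrableI (fun x => h x ^+ 2) ->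
  (\int[mu]_(x in I) h x) ^+ 2 <= L * \int[mu]_(x in I) (h x ^+ 2).
Proof.
move=> L0 hi h2; set S := \int[mu]_(x in I) h x.
pose c := S / L.
have ch : integrableI (fun x => (- 2 * c) * h x).
  by have := integrableZl (measurable_I L) (- 2 * c) hi; exact: eq_integrable.
have cc := integrable_cstI L (c ^+ 2).
have hc : integrableI (fun x => - 2 * c * h x + c ^+ 2).
  by have := integrableD (measurable_I L) ch cc; exact: eq_integrable.
have : 0 <= \int[mu]_(x in I) ((h x - c) ^+ 2).
  by apply: Rintegral_ge0 => x _; exact: sqr_ge0.
rewrite (@eq_Rintegral _ _ _ mu I (fun x : lebR => h x ^+ 2 + (- 2 * c * h x + c ^+ 2))); last first.
  by move=> x _; ring.
rewrite RintegralD// RintegralD// RintegralZl// -/S.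
have -> : \int[mu]_(x in I) (c ^+ 2) = c ^+ 2 * L by exact: (J_cst (c ^+ 2) (ltW L0)).
rewrite /c; set Q := \int[mu]_(x in I) _ => h0.
have : 0 <= L * (Q + (-2 * (S / L) * S + (S / L) ^+ 2 * L)).
  exact: (mulr_ge0 (ltW L0)).
have -> : L * (Q + (-2 * (S / L) * S + (S / L) ^+ 2 * L)) = L * Q - S ^+ 2.
  by field; rewrite gt_eqF.
by rewrite subr_ge0.
Qed.

Lemma J_norm1_le f : 0 < L -> square_integrable L f ->
  J (fun t => norm1 (f t)) L ^+ 2 <= 4 * L * L2_sqr f.
Proof.
move=> L0 fi; have [mf f2] := (square_integrableP f).1 fi.
have n1 (z : R[i]) : norm1 z ^+ 2 <= 4 * Normc.normc z ^+ 2.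
  have := norm1_le_normc z; have := norm1_ge0 z; have := normc_ge0 z.
  move=> h0 h1 h2; rewrite (_ : 4 * _ = (2 * Normc.normc z) ^+ 2); last by ring.
  by rewrite lerXn2r ?nnegrE// mulr_ge0.
have f4 : integrableI (fun x => 4 * Normc.normc (f x) ^+ 2).
  by have := integrableZl (measurable_I L) 4 f2; exact: eq_integrable.
have fn : integrableI (fun x => norm1 (f x) ^+ 2).
  apply: le_integrable f4 => //.
    by apply/measurable_EFinP; apply: measurable_funX; exact: measurable_norm1.
  move=> x _; rewrite /= lee_fin ger0_norm ?sqr_ge0//.
  exact: le_trans (n1 _) (ler_norm _).
have := cauchy_schwarz L0 (integrable_norm1 (cintegrable_square fi)) fn.
move=> /le_trans; apply; rewrite [4 * L]mulrC -mulrA; apply: ler_wpM2l; first exact: ltW.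
by rewrite -RintegralZl//; apply: le_Rintegral => // x _; exact: n1.
Qed.

Lemma L2_sqr_ae_eq f g : lebesgue_measurable L f -> lebesgue_measurable L g ->
  {ae mu, forall x, I x -> f x = g x} -> L2_sqr f = L2_sqr g.
Proof.
move=> mf mg fg; rewrite /L2_sqr /Rintegral; congr fine.
apply: (@ae_eq_integral _ lebR R mu I).
- exact: measurable_I.
- exact/measurable_EFinP/measurable_sqr_normc.
- exact/measurable_EFinP/measurable_sqr_normc.
- by apply: ae_mono fg => x h /h /= ->.
Qed.

Lemma L2_sqr_eq0 f : square_integrable L f -> L2_sqr f = 0 ->
  {ae mu, forall x, I x -> f x = 0}.
Proof.
move=> /square_integrableP[mf fi] f0.
have : (\int[mu]_(x in I) `|(Normc.normc (f x) ^+ 2)%:E| = 0)%E.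
  rewrite (eq_integral (fun x : lebR => (Normc.normc (f x) ^+ 2)%:E)); last first.
    by move=> x _; rewrite gee0_abs// lee_fin sqr_ge0.
  by rewrite EFin_Rintegral// -/(L2_sqr f) f0.
move/ae_eq_integral_abs => /(_ (measurable_I L)) h.
have {}h := h (measurable_int _ fi).
apply: ae_mono h => x h /h /= [] /eqP.
by rewrite sqrf_eq0 => /eqP /Normc.eq0_normc.
Qed.

End square_integrable.

(** * Weak derivatives *)

Section weak_derivatives.
Variables (R : realType) (L : R).
Hypothesis L0 : 0 < L.
Local Notation mu := (@completed_lebesgue_measure R).
Local Notation lebR := (caratheodory_type (wlength (@idfun R))^*%mu).
Local Notation I := (`[0, L]%classic : set lebR).
Local Notation integrableI f := (mu.-integrable I (EFin \o f)).
Implicit Types (a : R[i]) (f g u w : R -> R[i]) (phi : R -> R).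
Local Hint Resolve measurable_I : core.

Lemma continuous_derive1n k phi : smooth phi -> continuous (derive1n k phi).
Proof.
move=> sphi; apply: smooth_continuous.
elim: k => [|k IHk]; first exact: sphi.
by rewrite derive1nS; exact: smooth_derive1.
Qed.

Let Rintegral_0 : \int[mu]_(x in I) (0 : R) = 0.
Proof. by rewrite /Rintegral integral0. Qed.

Lemma complex_integral_mul f phi : complex_integral L (fun x => f x * (phi x)%:C) =
  (\int[mu]_(x in I) (complex.Re (f x) * phi x)) +i*
  (\int[mu]_(x in I) (complex.Im (f x) * phi x)).
Proof.
rewrite /complex_integral; congr (_ +i* _); apply: eq_Rintegral => x _.
  by rewrite ReME /= mulr0 subr0.
by rewrite ImME /= mulr0 add0r.
Qed.

Lemma complex_integral_lin a f g phi : cintegrable L f -> cintegrable L g ->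
  continuous phi ->
  complex_integral L (fun x => (a * f x + g x) * (phi x)%:C) =
  a * complex_integral L (fun x => f x * (phi x)%:C) +
  complex_integral L (fun x => g x * (phi x)%:C).
Proof.
move=> fi gi cphi.
have ci h : cintegrable L h -> cintegrable L (fun x => h x * (phi x)%:C).
  move=> [h1 h2]; split.
    apply: eq_integrable (integrable_mul_continuous h1 cphi) => // x _.
    by rewrite /= ReME /= mulr0 subr0.
  apply: eq_integrable (integrable_mul_continuous h2 cphi) => // x _.
  by rewrite /= ImME /= mulr0 add0r.
have := CJ_lin a (ci _ fi) (ci _ gi) (lexx L); rewrite /CJ => <-.
by congr complex_integral; apply/funext => x; rewrite mulrDl mulrA.
Qed.

Lemma is_weak_derivative_lin k a f f' g g' : cintegrable L f -> cintegrable L f' ->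
  cintegrable L g -> cintegrable L g' ->
  is_weak_derivative L k f g -> is_weak_derivative L k f' g' ->
  is_weak_derivative L k (fun x => a * f x + f' x) (fun x => a * g x + g' x).
Proof.
move=> fi fi' gi gi' fg fg' phi tphi.
have cphi := smooth_continuous (test_function_smooth tphi).
have cphik : continuous (derive1n k phi).
  exact: continuous_derive1n (test_function_smooth tphi).
rewrite (complex_integral_lin _ fi fi' cphik) (complex_integral_lin _ gi gi' cphi).
by rewrite fg// fg'// mulrDr mulrCA.
Qed.

(** Test functions being real, the fundamental lemma applies separately to the real and imaginary
    parts of the difference. *)
Lemma weak_derivative_unique k f g g' : cintegrable L g -> cintegrable L g' ->
  is_weak_derivative L k f g -> is_weak_derivative L k f g' ->
  {ae mu, forall x, I x -> g x = g' x}.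
Proof.
move=> gi gi' fg fg'.
have di := cintegrable_lin (-1) gi' gi.
have d0 phi : test_function L phi ->
    complex_integral L (fun x => (-1 * g' x + g x) * (phi x)%:C) = 0.
  move=> tphi; have cphi := smooth_continuous (test_function_smooth tphi).
  rewrite (complex_integral_lin _ gi' gi cphi).
  have : (-1) ^+ k * complex_integral L (fun x => g' x * (phi x)%:C) =
    (-1) ^+ k * complex_integral L (fun x => g x * (phi x)%:C) :> R[i].
    by rewrite -fg// -fg'.
  have k0 : (-1) ^+ k != 0 :> R[i] by rewrite expf_neq0// oppr_eq0 oner_neq0.
  by move=> /(mulfI k0) ->; rewrite mulN1r addNr.
have [d1 d2] := di.
have := fundamental_lemma d1.
have := fundamental_lemma d2.
move=> /(_ _) h2 /(_ _) h1.
have {}h1 : {ae mu, forall x, I x -> complex.Re (-1 * g' x + g x) = 0}.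
  apply: h1 => phi /d0; rewrite complex_integral_mul => /eqP.
  by rewrite eq_complex => /andP[/eqP h _]; exact: h.
have {}h2 : {ae mu, forall x, I x -> complex.Im (-1 * g' x + g x) = 0}.
  apply: h2 => phi /d0; rewrite complex_integral_mul => /eqP.
  by rewrite eq_complex => /andP[_ /eqP h]; exact: h.
apply: (ae_mono2 _ h1 h2) => x hx1 hx2 Ix; apply/eqP; rewrite -subr_eq0.
move: (hx1 Ix) (hx2 Ix); rewrite mulN1r addrC; case: (g x - g' x) => p q /= -> ->.
by [].
Qed.

Lemma is_weak_derivative0 f : is_weak_derivative L 0 f f.
Proof. by move=> phi _; rewrite expr0 mul1r. Qed.

(** The derivative of a test function is a test function, so the relation of order [k] may be used
    on [derive1 phi]. *)
Lemma is_weak_derivative_diff k u f g : is_weak_derivative L k u f ->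
  is_weak_derivative L k.+1 u g -> is_weak_derivative L 1 f g.
Proof.
move=> uf ug phi tphi; have := ug _ tphi.
rewrite derive1Sn uf; last exact: test_function_derive1.
rewrite exprS -mulrA -mulrCA => h.
apply: (mulfI (_ : (-1) ^+ k != 0)); first by rewrite expf_neq0// oppr_eq0 oner_neq0.
by rewrite derive1n1 h expr1.
Qed.

Lemma is_weak_derivativeS k u f g : is_weak_derivative L k u f ->
  is_weak_derivative L 1 f g -> is_weak_derivative L k.+1 u g.
Proof.
move=> uf fg phi tphi; rewrite derive1Sn uf; last exact: test_function_derive1.
by have := fg _ tphi; rewrite derive1n1 => ->; rewrite expr1 exprSr mulrA.
Qed.

Lemma is_weak_derivative_primitive a w : cintegrable L w ->
  is_weak_derivative L 1 (fun x => a + CJ w x) w.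
Proof.
move=> wi phi tphi; have sphi := test_function_smooth tphi.
have cphi' : continuous (derive1n 1 phi) by exact: continuous_derive1n.
have ci : cintegrable L (fun=> 1).
  by apply: (@bounded_cintegrable _ _ _ 1) => [|x _];
    [exact: lebesgue_measurable_cst|rewrite /norm1 /= normr0 addr0 normr1].
have := complex_integral_lin a ci (cintegrable_CJ wi) cphi'.
under [fun x => (a * 1 + CJ w x) * _]eq_fun do rewrite mulr1.
move=> ->.
have -> : complex_integral L (fun x => 1 * (derive1n 1 phi x)%:C) = 0.
  rewrite complex_integral_mul derive1n1 /=.
  rewrite (@eq_Rintegral _ _ _ mu I (fun x : lebR => derive1 phi x)); last first.
    by move=> x _; rewrite mul1r.
  rewrite (@eq_Rintegral _ _ _ mu I (fun=> 0) (fun x : lebR => 0 * derive1 phi x)); last first.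
    by move=> x _; rewrite mul0r.
  have cd : continuous (derive1 phi) by rewrite -derive1n1.
  rewrite Rintegral_0 (Rintegral_FTC2 (ltW L0) cd (smooth_is_derive sphi)).
  by rewrite !(test_function_eq0 tphi) ?subr0 ?ltxx ?andbF.
rewrite mulr0 add0r !complex_integral_mul derive1n1 expr1 mulN1r.
have [w1 w2] := wi.
by rewrite (Rintegral_J_derive1 w1 tphi) (Rintegral_J_derive1 w2 tphi).
Qed.

(** The difference [f - CJ g] has weak derivative 0, so its real and imaginary parts are constant by
    the lemma of du Bois-Reymond. *)
Lemma primitive_of_weak_derivative f g : cintegrable L f -> cintegrable L g ->
  is_weak_derivative L 1 f g ->
  exists a, {ae mu, forall x, I x -> f x = a + CJ g x}.
Proof.
move=> fi gi fg.
have pg := is_weak_derivative_primitive 0 gi.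
have pgi : cintegrable L (fun x => 0 + CJ g x).
  by under eq_fun do rewrite add0r; exact: cintegrable_CJ.
have di := cintegrable_lin (-1) pgi fi.
have dwd := is_weak_derivative_lin (-1) pgi fi gi gi pg fg.
have d0 phi : test_function L phi ->
    complex_integral L (fun x => (-1 * (0 + CJ g x) + f x) * (derive1 phi x)%:C) = 0.
  move=> tphi; have := dwd _ tphi; rewrite derive1n1 => ->.
  under [fun x => (-1 * g x + g x) * _]eq_fun do rewrite mulN1r addNr.
  rewrite complex_integral_mul /=.
  under eq_Rintegral do rewrite mul0r.
  by rewrite Rintegral_0 mulr0.
have [d1 d2] := di.
have [c h1] : exists c : R, {ae mu, forall x, I x -> complex.Re (-1 * (0 + CJ g x) + f x) = c}.
  apply: (du_bois_reymond L0 d1) => phi /d0; rewrite complex_integral_mul => /eqP.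
  by rewrite eq_complex => /andP[/eqP h _]; exact: h.
have [c' h2] : exists c : R, {ae mu, forall x, I x -> complex.Im (-1 * (0 + CJ g x) + f x) = c}.
  apply: (du_bois_reymond L0 d2) => phi /d0; rewrite complex_integral_mul => /eqP.
  by rewrite eq_complex => /andP[_ /eqP h]; exact: h.
exists (c +i* c'); apply: (ae_mono2 _ h1 h2) => x hx1 hx2 Ix.
rewrite -[f x](addrNK (CJ g x)); congr (_ + _).
move: (hx1 Ix) (hx2 Ix); rewrite add0r mulN1r addrC; case: (f x - CJ g x) => p q /= -> ->.
by [].
Qed.

End weak_derivatives.

(** * Iterated primitives and jets *)

Section jets.
Variables (R : realType) (L : R).
Hypothesis L0 : 0 < L.
Local Notation mu := (@completed_lebesgue_measure R).
Local Notation lebR := (caratheodory_type (wlength (@idfun R))^*%mu).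
Local Notation I := (`[0, L]%classic : set lebR).
Local Notation ae_eqI f g := {ae mu, forall x, I x -> f x = g x}.
Implicit Types (f g u v w : R -> R[i]) (a b : nat -> R[i]).

Lemma CJ_eq f g x : x <= L -> (forall t, 0 <= t <= L -> f t = g t) -> CJ f x = CJ g x.
Proof.
move=> xL fg; rewrite !CJE; congr (_ +i* _); apply: eq_Rintegral => t;
  by rewrite inE/= in_itv/= => /andP[t0 tx]; rewrite fg// t0 (le_trans tx).
Qed.

(** The interval has measure [L > 0], so it is not contained in a null set. *)
Lemma ae_constI (z : R[i]) : {ae mu, forall x, I x -> z = 0} -> z = 0.
Proof.
move=> h; apply: contrapT => z0.
have [A [mA A0 IA]] := h.
have : (mu I <= mu A)%E.
  apply: le_measure; rewrite ?inE//; first exact: measurable_I.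
  by move=> x Ix; apply: IA => /= /(_ Ix).
by rewrite A0 (_ : (mu I = L%:E)%E) ?lee_fin ?leNgt ?L0//; rewrite -[in RHS](subr0 L) -mu_itv// ltW.
Qed.

(** Here [a j] is the value at 0 of the primitive of order [j.+1]. Counting integrations from the
    top derivative, instead of orders of derivation, keeps [m] out of the recursion. *)
Fixpoint iterated_primitive a w j : R -> R[i] :=
  if j is j'.+1 then fun x => a j' + CJ (iterated_primitive a w j') x else w.

Local Notation ip := iterated_primitive.

Lemma square_integrable_primitive (z : R[i]) w : square_integrable L w ->
  square_integrable L (fun x => z + CJ w x).
Proof.
move=> wi; have ci := cintegrable_square wi.
apply: (@bounded_square_integrable _ _ _ (norm1 z + J (fun t => norm1 (w t)) L) _ _ _).1.
- exact: ltW.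
- apply: lebesgue_measurableD; first exact: lebesgue_measurable_cst.
  exact/cintegrable_measurable/cintegrable_CJ.
move=> x /andP[x0 xL]; rewrite (le_trans (norm1D _ _))// lerD2l.
rewrite (le_trans (norm1_CJ ci xL))// le_J_L//; first exact: integrable_norm1.
by move=> t _; exact: norm1_ge0.
Qed.

Lemma ip_square a w j : square_integrable L w -> square_integrable L (ip a w j).
Proof.
move=> wi; elim: j => [|j IHj]; first exact: wi.
exact: (square_integrable_primitive (a j) IHj).
Qed.

Lemma cintegrable_ip a w j : cintegrable L w -> cintegrable L (ip a w j).
Proof.
move=> wi; elim: j => //= j IHj.
have ci : cintegrable L (fun=> a j).
  apply: (@bounded_cintegrable _ _ _ (norm1 (a j))); first exact: lebesgue_measurable_cst.
  by move=> x _; exact: lexx.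
have := cintegrable_lin 1 ci (cintegrable_CJ IHj).
by under eq_fun do rewrite mul1r.
Qed.

Lemma ip_lin (z : R[i]) a b w v j x : cintegrable L w -> cintegrable L v ->
  0 <= x <= L ->
  ip (fun i => z * a i + b i) (fun t => z * w t + v t) j x =
  z * ip a w j x + ip b v j x.
Proof.
move=> wi vi; elim: j x => //= j IHj x /andP[x0 xL].
rewrite (CJ_eq xL IHj) (CJ_lin _ (cintegrable_ip a j wi) (cintegrable_ip b j vi) xL).
by rewrite mulrDr addrACA.
Qed.

Lemma ip_eq_seq a b w j : (forall i, (i < j)%N -> a i = b i) -> ip a w j = ip b w j.
Proof.
elim: j => //= j IHj ab; apply/funext => x; rewrite ab// IHj// => i ij.
by rewrite ab// (ltn_trans ij).
Qed.

Lemma ip_ae_eq a w v j : cintegrable L w -> cintegrable L v -> ae_eqI w v ->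
  ae_eqI (ip a w j) (ip a v j).
Proof.
move=> wi vi wv; elim: j => //= j IHj; apply: aeW => x /=; rewrite in_itv/= => /andP[_ xL].
by congr (_ + _); apply: CJ_ae_eq xL _; [exact: cintegrable_ip|exact: cintegrable_ip|].
Qed.

Lemma ip0_ae_eq w v j x : cintegrable L w -> cintegrable L v -> ae_eqI w v ->
  0 <= x <= L -> ip (fun=> 0) w j.+1 x = ip (fun=> 0) v j.+1 x.
Proof.
move=> wi vi wv /andP[_ xL] /=; congr (_ + _).
by apply: CJ_ae_eq xL _; [exact: cintegrable_ip|exact: cintegrable_ip|exact: ip_ae_eq].
Qed.

(** One integration is kept as [J] up to [x], the form required of a Volterra operator. Each further
    one costs a factor [L], because [J] of a nonnegative function is at most its value at the right
    end. *)
Lemma norm1_ip0 w j x : cintegrable L w -> 0 <= x <= L ->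
  norm1 (ip (fun=> 0) w j.+1 x) <= L ^+ j * J (fun t => norm1 (w t)) x.
Proof.
move=> wi; have nwi := integrable_norm1 wi.
elim: j x => [|j IHj] x xL; have /andP[x0 xL'] := xL.
  by rewrite /= add0r expr0 mul1r; exact: (norm1_CJ wi xL').
rewrite (_ : ip _ _ _ _ = CJ (ip (fun=> 0) w j.+1) x); last by rewrite /= add0r.
apply: (le_trans (norm1_CJ (cintegrable_ip (fun=> 0) j.+1 wi) xL')).
pose K := L ^+ j * J (fun t => norm1 (w t)) x.
have J0 : 0 <= J (fun t => norm1 (w t)) x.
  by apply: J_ge0 nwi xL' _ => t _; exact: norm1_ge0.
have LJ : 0 <= L ^+ j by rewrite exprn_ge0// ltW.
apply: (@le_trans _ _ (J (cst K) x)); last first.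
  rewrite (J_cst _ x0) exprS -mulrA mulrC.
  by apply: (ler_wpM2r _ xL'); exact: (mulr_ge0 LJ J0).
have ipi := integrable_norm1 (cintegrable_ip (fun=> 0) j.+1 wi).
apply: le_Rintegral.
- exact: measurable_itv_leb.
- exact: integrable_0x ipi xL'.
- exact: integrable_0x (integrable_cstI L K) xL'.
move=> t /=; rewrite in_itv/= => /andP[t0 tx].
have tL : 0 <= t <= L by rewrite t0 (le_trans tx).
apply: (le_trans (IHj t tL)); apply: (ler_wpM2l LJ).
apply: (@le_J_L _ x) => //; first exact: integrable_0x nwi xL'.
by move=> s _; exact: norm1_ge0.
Qed.

Lemma ip_weak_derivative a w j k : square_integrable L w -> (k <= j)%N ->
  is_weak_derivative L k (ip a w j) (ip a w (j - k)).
Proof.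
move=> wi; elim: k => [|k IHk] kj.
  by rewrite subn0; exact: is_weak_derivative0.
apply: (is_weak_derivativeS (IHk (ltnW kj))).
rewrite (_ : (j - k)%N = (j - k.+1).+1); last by rewrite subnS prednK// subn_gt0.
exact/is_weak_derivative_primitive/cintegrable_square/ip_square.
Qed.

Section sobolev.
Variable m : nat.
Local Notation H := (sobolev L m).
Local Notation wd := (weak_derivative L).

Lemma weak_derivativeP u k : H u -> (k <= m)%N ->
  square_integrable L (wd k u) /\ is_weak_derivative L k u (wd k u).
Proof.
move=> [_ Hu] /Hu [g gi ug]; rewrite /weak_derivative; case: xgetP => [h _ //|].
by move=> /(_ g); case.
Qed.

(* The derivative of order [m - j] of [u] is the [j]-fold primitive of [w], and
   [a] lists the constants of integration. *)
Definition is_jet a w u := [/\ square_integrable L w, H u &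
  forall j, (j <= m)%N -> ae_eqI (wd (m - j) u) (ip a w j)].

Lemma weak_derivative_ae_eq u k g : H u -> (k <= m)%N -> square_integrable L g ->
  is_weak_derivative L k u g -> ae_eqI (wd k u) g.
Proof.
move=> Hu km gi ug; have [wi uw] := weak_derivativeP Hu km.
exact: weak_derivative_unique (cintegrable_square wi) (cintegrable_square gi) uw ug.
Qed.

Lemma jet_ip a w : square_integrable L w -> is_jet a w (ip a w m).
Proof.
move=> wi; have Hw : H (ip a w m).
  split; first exact: ip_square.
  by move=> k km; exists (ip a w (m - k)); [exact: ip_square|exact: ip_weak_derivative].
split; [exact: wi|exact: Hw|move=> j jm].
apply: (weak_derivative_ae_eq Hw (leq_subr j m) (ip_square a j wi)).
by have := ip_weak_derivative a wi (leq_subr j m); rewrite subKn.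
Qed.

(** Each derivative of order below [m] is a primitive of the next one up to a constant; these
    constants form [a], and the induction on [j] nests the primitives. *)
Lemma jet_exists u : H u -> exists a, is_jet a (wd m u) u.
Proof.
move=> Hu; have [wi uw] := weak_derivativeP Hu (leqnn m).
have /choice[a aE] j : exists z : R[i], (j < m)%N ->
    ae_eqI (wd (m - j.+1) u) (fun x => z + CJ (wd (m - j) u) x).
  have [jm|] := boolP (j < m)%N; last by exists 0.
  have [gi ug] := weak_derivativeP Hu (leq_subr j.+1 m).
  have [gi' ug'] := weak_derivativeP Hu (leq_subr j m).
  have ug'' : is_weak_derivative L (m - j.+1).+1 u (wd (m - j) u).
    by rewrite subnS prednK// subn_gt0.
  have [z zE] := primitive_of_weak_derivative L0 (cintegrable_square gi)
    (cintegrable_square gi') (is_weak_derivative_diff ug ug'').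
  by exists z.
exists a; split => // j; elim: j => [|j IHj] jm.
  by rewrite subn0; exact: aeW.
apply: (ae_mono _ (aE j jm)) => x h Ix; rewrite h//=; congr (_ + _).
have [gi _] := weak_derivativeP Hu (leq_subr j m).
apply: CJ_ae_eq (IHj (ltnW jm)).
- exact: cintegrable_square.
- exact/cintegrable_ip/cintegrable_square.
by move: Ix; rewrite /= in_itv/= => /andP[].
Qed.

Lemma sobolev_lin (z : R[i]) u v : H u -> H v -> H (fun x => z * u x + v x) /\
  forall k, (k <= m)%N ->
    ae_eqI (wd k (fun x => z * u x + v x)) (fun x => z * wd k u x + wd k v x).
Proof.
move=> Hu Hv.
have li f g : square_integrable L f -> square_integrable L g ->
    square_integrable L (fun x => z * f x + g x).
  by move=> fi gi; exact: (square_integrableD (square_integrableZ z fi) gi).1.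
have lw k : (k <= m)%N -> square_integrable L (fun x => z * wd k u x + wd k v x) /\
    is_weak_derivative L k (fun x => z * u x + v x) (fun x => z * wd k u x + wd k v x).
  move=> km; have [ui uw] := weak_derivativeP Hu km; have [vi vw] := weak_derivativeP Hv km.
  split; first exact: li.
  by apply: (is_weak_derivative_lin z (cintegrable_square Hu.1) (cintegrable_square Hv.1)
    (cintegrable_square ui) (cintegrable_square vi) uw vw).
have Hl : H (fun x => z * u x + v x).
  split; first exact: (li _ _ Hu.1 Hv.1).
  by move=> k km; have [h1 h2] := lw k km; exists (fun x => z * wd k u x + wd k v x).
split; first exact: Hl.
by move=> k km; have [h1 h2] := lw k km; exact: (weak_derivative_ae_eq Hl km h1 h2).
Qed.

Lemma jet_lin (z : R[i]) a b w w' u v : is_jet a w u -> is_jet b w' v ->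
  is_jet (fun i => z * a i + b i) (fun x => z * w x + w' x) (fun x => z * u x + v x).
Proof.
move=> [wi Hu uj] [wi' Hv vj]; have [Hl lE] := sobolev_lin z Hu Hv.
split; [exact: (square_integrableD (square_integrableZ z wi) wi').1|exact: Hl|].
move=> j jm; have hj := leq_subr j m.
have uv : ae_eqI (fun x => z * wd (m - j) u x + wd (m - j) v x)
    (ip (fun i => z * a i + b i) (fun x => z * w x + w' x) j).
  apply: (ae_mono2 _ (uj _ jm) (vj _ jm)) => x h1 h2 Ix.
  rewrite (h1 Ix) (h2 Ix) (ip_lin z a b j (cintegrable_square wi) (cintegrable_square wi'))//.
by apply: (ae_mono2 _ (lE _ hj) uv) => x h1 h2 Ix; rewrite (h1 Ix) (h2 Ix).
Qed.

Lemma jet_eq a b w u : (forall i, (i < m)%N -> a i = b i) -> is_jet a w u -> is_jet b w u.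
Proof.
move=> ab [wi Hu uj]; split; [exact: wi|exact: Hu|move=> j jm].
rewrite -(ip_eq_seq _ (a := a)); first exact: uj.
by move=> i ij; rewrite ab// (leq_trans ij).
Qed.

(** The combination [-1 * h + h] of a jet with itself is the zero function exactly, which spares the
    computation of an iterated primitive of 0. *)
Lemma jet0 : is_jet (fun=> 0) (fun=> 0) (fun=> 0).
Proof.
have h := jet_ip (fun=> 0) (square_integrable0 L).
have := jet_lin (-1) h h.
rewrite (_ : (fun _ : nat => -1 * 0 + 0) = fun=> 0); last first.
  by apply/funext => i; rewrite mulr0 addr0.
rewrite (_ : (fun _ : R => -1 * 0 + 0) = fun=> 0); last first.
  by apply/funext => x; rewrite mulr0 addr0.
rewrite (_ : (fun x => -1 * ip _ _ _ x + _) = fun=> 0)//.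
by apply/funext => x; rewrite mulN1r addNr.
Qed.

Lemma jet_sum (K : Type) (s : seq K) (k : K -> R[i]) (a : K -> nat -> R[i])
    (w u : K -> R -> R[i]) : (forall i, is_jet (a i) (w i) (u i)) ->
  is_jet (fun j => \sum_(i <- s) k i * a i j) (fun x => \sum_(i <- s) k i * w i x)
    (fun x => \sum_(i <- s) k i * u i x).
Proof.
move=> h; elim: s => [|i s IHs].
  rewrite (_ : (fun j => _) = fun=> 0); last by apply/funext => j; rewrite big_nil.
  rewrite (_ : (fun x => \sum_(i <- [::]) k i * w i x) = fun=> 0); last first.
    by apply/funext => x; rewrite big_nil.
  rewrite (_ : (fun x => \sum_(i <- [::]) k i * u i x) = fun=> 0); last first.
    by apply/funext => x; rewrite big_nil.
  exact: jet0.
rewrite (_ : (fun j => _) = fun j => k i * a i j + \sum_(i <- s) k i * a i j); last first.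
  by apply/funext => j; rewrite big_cons.
rewrite (_ : (fun x => \sum_(i0 <- i :: s) k i0 * w i0 x) =
    fun x => k i * w i x + \sum_(i <- s) k i * w i x); last first.
  by apply/funext => x; rewrite big_cons.
rewrite (_ : (fun x => \sum_(i0 <- i :: s) k i0 * u i0 x) =
    fun x => k i * u i x + \sum_(i <- s) k i * u i x); last first.
  by apply/funext => x; rewrite big_cons.
exact: (jet_lin (k i) (h i) IHs).
Qed.

Lemma sobolev_normE u : sobolev_norm L m u ^+ 2 = \sum_(k < m.+1) L2_sqr L (wd k u).
Proof.
rewrite sqr_sqrtr; last by apply: sumr_ge0 => k _; exact: sqr_ge0.
by apply: eq_bigr => k _; rewrite L2_normE.
Qed.

Lemma sobolev_norm_eq0 u : H u -> sobolev_norm L m u = 0 <->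
  forall k, (k <= m)%N -> ae_eqI (wd k u) (fun=> 0).
Proof.
move=> Hu; split=> [u0 k km|u0].
  have [wi _] := weak_derivativeP Hu km.
  apply: L2_sqr_eq0 => //.
  have /eqP : \sum_(k < m.+1) L2_sqr L (wd k u) = 0 by rewrite -sobolev_normE u0 expr0n.
  rewrite psumr_eq0; last by move=> i _; exact: L2_sqr_ge0.
  by move=> /allP /(_ (Ordinal (km : (k < m.+1)%N))) /(_ (mem_index_enum _)) /eqP.
apply/eqP; rewrite -sqrf_eq0 sobolev_normE big1// => k _.
have km : (k <= m)%N by rewrite -ltnS.
have [wi _] := weak_derivativeP Hu km.
rewrite (L2_sqr_ae_eq (square_measurable wi) _ (u0 k km)); last exact: lebesgue_measurable_cst.
rewrite /L2_sqr /Rintegral (eq_integral (cst 0%E)) ?integral0// => x _.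
by rewrite Normc.normc0 expr0n.
Qed.

(** All the iterated primitives up to order [m] vanish almost everywhere with [u]. The one of order
    [j.+1] is [a j] plus the integral of the one of order [j], so only the constant [a j]
    remains. *)
Lemma jet_null_coef a w u : is_jet a w u -> sobolev_norm L m u = 0 ->
  forall j, (j < m)%N -> a j = 0.
Proof.
move=> [wi Hu uj] /(sobolev_norm_eq0 Hu) u0 j jm.
apply: ae_constI.
have ip0 i : (i <= m)%N -> ae_eqI (ip a w i) (fun=> 0).
  move=> im; apply: (ae_mono2 _ (uj i im) (u0 _ (leq_subr i m))) => x h1 h2 Ix.
  by rewrite -h1// h2.
apply: (ae_mono _ (ip0 _ jm)) => x /= h Ix; have := h Ix.
have xL : x <= L by move: Ix; rewrite /= in_itv/= => /andP[].
rewrite (CJ_ae_eq (cintegrable_ip a j (cintegrable_square wi)) (cintegrable0 L) xL (ip0 j (ltnW jm))).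
have -> : CJ (fun=> 0) x = 0 :> R[i].
  by rewrite CJE /J /Rintegral integral0.
by rewrite addr0.
Qed.

Lemma jet_null a w u : is_jet a w u -> (forall j, (j < m)%N -> a j = 0) ->
  ae_eqI w (fun=> 0) -> sobolev_norm L m u = 0.
Proof.
move=> [wi Hu uj] a0 w0; apply/(sobolev_norm_eq0 Hu) => k km.
have := uj _ (leq_subr k m); rewrite subKn//.
have ci := cintegrable_square wi.
have : ae_eqI (ip a w (m - k)) (fun=> 0).
  rewrite (ip_eq_seq (b := fun=> 0)); last first.
    by move=> i ik; rewrite a0// (leq_trans ik)// leq_subr.
  have := ip_ae_eq (fun=> 0) (m - k) ci (cintegrable0 L) w0.
  apply: ae_mono => x h Ix; rewrite h//.
  elim: (m - k)%N x {h Ix} => //= j IHj x; rewrite add0r.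
  have -> : ip (fun=> 0) (fun=> 0) j = (fun=> 0) :> (R -> R[i]) by apply/funext.
  by rewrite CJE /J /Rintegral integral0.
by apply: ae_mono2 => x h1 h2 Ix; rewrite h2// h1.
Qed.

End sobolev.

End jets.

(** * The operator on one edge *)

Section edge_operator.
Variables (R : realType) (L : R).
Hypothesis L0 : 0 < L.
Local Notation mu := (@completed_lebesgue_measure R).
Local Notation lebR := (caratheodory_type (wlength (@idfun R))^*%mu).
Local Notation I := (`[0, L]%classic : set lebR).
Local Notation ae_eqI f g := {ae mu, forall x, I x -> f x = g x}.
Local Notation ip := iterated_primitive.
Implicit Types (f g u v w : R -> R[i]) (a b : nat -> R[i]).

(** Iterates the inequality for two terms, at the cost of a factor 2 per term. *)
Lemma L2_sqr_sum (K : Type) (s : seq K) (F : K -> R -> R[i]) :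
  (forall k, square_integrable L (F k)) ->
  L2_sqr L (fun x => \sum_(k <- s) F k x) <= 2 ^+ size s * \sum_(k <- s) L2_sqr L (F k).
Proof.
move=> Fi; elim: s => [|k s IHs].
  rewrite big_nil mulr0 (_ : (fun x => _) = fun=> 0); last by apply/funext => x; rewrite big_nil.
  by rewrite /L2_sqr Normc.normc0 expr0n /= /Rintegral integral0.
rewrite (_ : (fun x => _) = fun x => F k x + \sum_(k <- s) F k x); last first.
  by apply/funext => x; rewrite big_cons.
apply: (le_trans (square_integrableD (Fi k) (square_integrable_sum s Fi)).2).
rewrite big_cons mulrDr; apply: lerD.
  apply: (ler_wpM2r (L2_sqr_ge0 _ _)); rewrite /= exprS -[leLHS]mulr1.
  by apply: ler_wpM2l => //; rewrite exprn_ege1// ler1n.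
by rewrite /= exprS -mulrA; exact: ler_wpM2l.
Qed.

Lemma ae_eq_sum (K : Type) (s : seq K) (F G : K -> R -> R[i]) :
  (forall k, ae_eqI (F k) (G k)) ->
  ae_eqI (fun x => \sum_(k <- s) F k x) (fun x => \sum_(k <- s) G k x).
Proof.
move=> FG; elim: s => [|k s IHs]; first by apply: aeW => x _; rewrite !big_nil.
by apply: (ae_mono2 _ (FG k) IHs) => x h1 h2 Ix; rewrite !big_cons (h1 Ix) (h2 Ix).
Qed.

Lemma L2_sqr_fun0 : L2_sqr L (fun=> 0) = 0.
Proof. by rewrite /L2_sqr Normc.normc0 expr0n /= /Rintegral integral0. Qed.

Lemma L2_sqr_sub_eq0 f g : lebesgue_measurable L f -> lebesgue_measurable L g ->
  ae_eqI f g -> L2_sqr L (fun x => f x - g x) = 0.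
Proof.
move=> mf mg fg; rewrite -L2_sqr_fun0; apply: L2_sqr_ae_eq.
- rewrite (_ : (fun x => _) = fun x => f x + (-1) * g x); last first.
    by apply/funext => x; rewrite mulN1r.
  apply: (lebesgue_measurableD mf).
  by apply: lebesgue_measurableM mg; exact: lebesgue_measurable_cst.
- exact: lebesgue_measurable_cst.
by apply: ae_mono fg => x h Ix; rewrite (h Ix) subrr.
Qed.

Lemma ip0B w v j x : cintegrable L w -> cintegrable L v -> 0 <= x <= L ->
  ip (fun=> 0) (fun t => w t - v t) j x = ip (fun=> 0) w j x - ip (fun=> 0) v j x.
Proof.
move=> wi vi xL.
have := ip_lin (-1) (fun=> 0) (fun=> 0) j vi wi xL.
rewrite (_ : (fun _ : nat => -1 * 0 + 0) = fun=> 0); last first.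
  by apply/funext => i; rewrite mulr0 addr0.
rewrite (_ : (fun t => -1 * v t + w t) = fun t => w t - v t); last first.
  by apply/funext => t; rewrite mulN1r addrC.
by move=> ->; rewrite mulN1r addrC.
Qed.

Lemma ip_split a w j x : cintegrable L w -> 0 <= x <= L ->
  ip a w j x = ip a (fun=> 0) j x + ip (fun=> 0) w j x.
Proof.
move=> wi xL.
have := ip_lin 1 a (fun=> 0) j (cintegrable0 L) wi xL.
rewrite (_ : (fun i => 1 * a i + 0) = a); last by apply/funext => i; rewrite mul1r addr0.
rewrite (_ : (fun t => 1 * 0 + w t) = w); last by apply/funext => t; rewrite mulr0 add0r.
by move=> ->; rewrite mul1r.
Qed.

Lemma ip00 j : ip (fun=> 0) (fun=> 0) j = (fun=> 0) :> (R -> R[i]).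
Proof.
elim: j => [//|j IHj]; apply/funext => x /=; rewrite IHj add0r CJE.
by rewrite /J /Rintegral integral0.
Qed.

Lemma L2_sqr_ip0 w j : square_integrable L w -> L2_sqr L (ip (fun=> 0) w j) <=
  (if j is j'.+1 then (L ^+ j') ^+ 2 * L * (4 * L) else 1) * L2_sqr L w.
Proof.
move=> wi; case: j => [|j]; first by rewrite mul1r.
have ci := cintegrable_square wi.
have nwi := integrable_norm1 ci.
set K := J (fun t => norm1 (w t)) L.
have LJ : 0 <= L ^+ j by rewrite exprn_ge0// ltW.
have b (x : R) : 0 <= x <= L -> norm1 (ip (fun=> 0) w j.+1 x) <= L ^+ j * K.
  move=> xL; apply: (le_trans (norm1_ip0 L0 j ci xL)); apply: (ler_wpM2l LJ).
  by apply: (le_J_L nwi); [case/andP: xL|move=> t _; exact: norm1_ge0].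
have mi := cintegrable_measurable (cintegrable_ip (fun=> 0) j.+1 ci).
apply: (le_trans (bounded_square_integrable (ltW L0) mi b).2).
rewrite (_ : (L ^+ j * K) ^+ 2 * L = (L ^+ j) ^+ 2 * L * K ^+ 2); last by ring.
rewrite -[leRHS]mulrA; apply: ler_wpM2l.
  by rewrite mulr_ge0 ?sqr_ge0// ltW.
exact: J_norm1_le.
Qed.

Section coefficients.
Variables (m : nat) (c : 'I_m.+1 -> R -> R[i]) (A B : R).
Local Notation H := (sobolev L m).
Local Notation wd := (weak_derivative L).
Hypothesis c_measurable : forall j, lebesgue_measurable L (c j).
Hypothesis c_le : forall j (x : R), 0 <= x <= L -> Normc.normc (c j x) <= A.
Hypothesis c0_neq0 : forall x : R, 0 <= x <= L -> c ord0 x != 0.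
Hypothesis c0V_measurable : lebesgue_measurable L (fun x => (c ord0 x)^-1).
Hypothesis c0V_le : forall x : R, 0 <= x <= L -> Normc.normc ((c ord0 x)^-1) <= B.

Let T u x := \sum_(j < m.+1) c j x * wd (m - j) u x.

Let A_ge0 : 0 <= A.
Proof. by apply: le_trans (c_le ord0 (_ : 0 <= 0 <= L)); rewrite ?normc_ge0// lexx ltW. Qed.

Let B_ge0 : 0 <= B.
Proof. by apply: le_trans (c0V_le (_ : 0 <= 0 <= L)); rewrite ?normc_ge0// lexx ltW. Qed.

Lemma edge_bounded u : H u -> square_integrable L (T u) /\
  L2_sqr L (T u) <= 2 ^+ m.+1 * A ^+ 2 * sobolev_norm L m u ^+ 2.
Proof.
move=> Hu.
have h (j : 'I_m.+1) := square_integrableM (c_measurable j) (@c_le j)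
  (weak_derivativeP Hu (leq_subr j m)).1.
split; first exact: (square_integrable_sum _ (fun j => (h j).1)).
apply: (le_trans (L2_sqr_sum _ (fun j => (h j).1))).
have -> : size (index_enum 'I_m.+1) = m.+1 by rewrite [index_enum _]unlock -enumT size_enum_ord.
rewrite -mulrA; apply: ler_wpM2l; first exact: exprn_ge0.
rewrite sobolev_normE mulr_sumr [leRHS](reindex_inj rev_ord_inj) /=.
by apply: ler_sum => j _; exact: (h j).2.
Qed.

Lemma edge_lin z u v : H u -> H v ->
  ae_eqI (T (fun x => z * u x + v x)) (fun x => z * T u x + T v x).
Proof.
move=> Hu Hv; have [_ lE] := sobolev_lin z Hu Hv.
have h (j : 'I_m.+1) : ae_eqI (fun x => c j x * wd (m - j) (fun x => z * u x + v x) x)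
    (fun x => z * (c j x * wd (m - j) u x) + c j x * wd (m - j) v x).
  apply: (ae_mono _ (lE _ (leq_subr j m))) => x e Ix.
  by rewrite (e Ix) mulrDr mulrCA.
apply: (ae_mono _ (ae_eq_sum (index_enum _) h)) => x e Ix.
by rewrite /T (e Ix) big_split mulr_sumr.
Qed.

(** The operator in the coordinates [(a, w)]: no choice of weak derivatives is involved, so
    equations between its values can hold at every point. *)
Definition jet_operator a w x := \sum_(j < m.+1) c j x * ip a w j x.

Lemma edge_jet a w u : is_jet L m a w u -> ae_eqI (T u) (jet_operator a w).
Proof.
move=> [wi Hu uj]; apply: ae_eq_sum => j.
have jm : (j <= m)%N by rewrite -ltnS.
by apply: (ae_mono _ (uj j jm)) => x e Ix; rewrite (e Ix).
Qed.

(** The terms of order below [m], with zero constants of integration, divided by the leading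
    coefficient. *)
Let V w x := (c ord0 x)^-1 * \sum_(j < m) c (lift ord0 j) x * ip (fun=> 0) w j.+1 x.

(** Each factor 2 converts [Normc.normc] of a coefficient into [norm1], [L ^+ j] comes from
    [norm1_ip0], and the final 1 makes [M] positive. *)
Let M : R := 2 * B * (\sum_(j < m) 2 * A * L ^+ j) + 1.

Let S_ge0 : 0 <= \sum_(j < m) 2 * A * L ^+ j.
Proof. by apply: sumr_ge0 => j _; rewrite mulr_ge0 ?mulr_ge0// exprn_ge0// ltW. Qed.

Let M_gt0 : 0 < M.
Proof. by rewrite /M ltr_wpDl// mulr_ge0// mulr_ge0. Qed.

Let V_le w : cintegrable L w -> forall x : R, 0 <= x <= L ->
  norm1 (V w x) <= M * J (fun t => norm1 (w t)) x.
Proof.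
move=> wi x xL.
have J0 : 0 <= J (fun t => norm1 (w t)) x.
  apply: (J_ge0 (integrable_norm1 wi)); first by case/andP: xL.
  by move=> t _; exact: norm1_ge0.
have n2 (z : R[i]) : norm1 z <= 2 * Normc.normc z := norm1_le_normc z.
apply: (le_trans (norm1M _ _)); rewrite /M [leRHS]mulrDl mul1r -[leLHS]addr0; apply: lerD => //.
rewrite -mulrA; apply: ler_pM; rewrite ?norm1_ge0//.
  by apply: (le_trans (n2 _)); apply: ler_wpM2l => //; exact: c0V_le.
apply: (le_trans (norm1_sum _ _)); rewrite mulr_suml; apply: ler_sum => j _.
apply: (le_trans (norm1M _ _)); rewrite -mulrA; apply: ler_pM; rewrite ?norm1_ge0//.
  by apply: (le_trans (n2 _)); apply: ler_wpM2l => //; exact: c_le.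
exact: norm1_ip0.
Qed.

Let V_int w : cintegrable L w -> cintegrable L (V w).
Proof.
move=> wi; apply: (@bounded_cintegrable _ _ _ (M * J (fun t => norm1 (w t)) L)).
  apply: lebesgue_measurableM; first exact: c0V_measurable.
  apply: lebesgue_measurable_sum => j; apply: lebesgue_measurableM; first exact: c_measurable.
  exact/cintegrable_measurable/cintegrable_ip.
move=> x xL; apply: (le_trans (V_le wi xL)); apply: (ler_wpM2l (ltW M_gt0)).
apply: (le_J_L (integrable_norm1 wi)); first by case/andP: xL.
by move=> t _; exact: norm1_ge0.
Qed.

Let V_sub w v : cintegrable L w -> cintegrable L v ->
  forall x : R, 0 <= x <= L -> V (fun t => w t - v t) x = V w x - V v x.
Proof.
move=> wi vi x xL; rewrite /V -mulrBr -sumrB; congr (_ * _); apply: eq_bigr => j _.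
by rewrite (ip0B j.+1 wi vi xL) mulrBr.
Qed.

(** Separates [w] from [a]: the last sum depends on the constants alone, so prescribing the value of
    the operator is a Volterra equation for [w]. *)
Lemma jet_operatorE a w x : cintegrable L w -> 0 <= x <= L ->
  jet_operator a w x = c ord0 x * (w x + V w x) +
    \sum_(j < m) c (lift ord0 j) x * ip a (fun=> 0) j.+1 x.
Proof.
move=> wi xL; rewrite /jet_operator big_ord_recl /V mulrDr mulrA divff ?c0_neq0// mul1r.
rewrite -addrA; congr (_ + _); rewrite -big_split; apply: eq_bigr => j _ /=.
by rewrite -mulrDr; congr (_ * _); rewrite [RHS]addrC; exact: (ip_split a j.+1 wi xL).
Qed.

Let K : R := 2 * M * expR (2 * M * L).

(** In [w = (w - g) + g], the a priori estimate bounds the first term by [K] times the integral of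
    [norm1 (g t)], which Cauchy-Schwarz bounds by the L2 norm of [g]. *)
Let volterra_L2 g : square_integrable L g -> exists w, [/\ square_integrable L w,
  forall x : R, 0 <= x <= L -> w x + V w x = g x &
  L2_sqr L w <= (2 * (K ^+ 2 * L * (4 * L)) + 2) * L2_sqr L g].
Proof.
move=> gi; have ci := cintegrable_square gi.
have [w [wi wg]] := volterra_exists M_gt0 V_int V_sub V_le ci.
set N := J (fun t => norm1 (g t)) L.
have N0 : 0 <= N.
  by apply: (J_ge0 (integrable_norm1 ci) (lexx L)) => t _; exact: norm1_ge0.
have d (x : R) : 0 <= x <= L -> norm1 (w x - g x) <= K * N.
  move=> xL; apply: (le_trans (volterra_apriori M_gt0 V_le wi ci wg xL)).
  rewrite (_ : K * N = 2 * (M * N) * expR (2 * M * L)); last by rewrite /K; ring.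
  apply: ler_wpM2l; first by rewrite mulr_ge0// mulr_ge0// ltW.
  rewrite ler_expR; apply: ler_wpM2l; first by rewrite mulr_ge0// ltW.
  by case/andP: xL.
have [di dle] := bounded_square_integrable (ltW L0)
  (cintegrable_measurable (cintegrableB wi ci)) d.
have [si sle] := square_integrableD di gi.
have wE : (fun x => w x - g x + g x) = w by apply/funext => x; rewrite subrK.
rewrite wE in si sle; exists w; split => //.
apply: (le_trans sle); rewrite [leRHS]mulrDl; apply: lerD => //.
rewrite -[leRHS]mulrA; apply: ler_wpM2l => //.
apply: (le_trans dle).
rewrite (_ : (K * N) ^+ 2 * L = K ^+ 2 * L * N ^+ 2); last by ring.
rewrite -[leRHS]mulrA; apply: ler_wpM2l.
  by rewrite mulr_ge0 ?sqr_ge0// ltW.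
exact: J_norm1_le.
Qed.

Lemma jet_operator_surjective a f : square_integrable L f ->
  exists w, square_integrable L w /\ forall x : R, 0 <= x <= L -> jet_operator a w x = f x.
Proof.
move=> fi.
pose h x := \sum_(j < m) c (lift ord0 j) x * ip a (fun=> 0) j.+1 x.
have hi : square_integrable L h.
  apply: square_integrable_sum => j.
  apply: (square_integrableM (c_measurable _) (@c_le _) _).1.
  exact: (ip_square L0 a j.+1 (square_integrable0 L)).
have fhi := (square_integrableD (square_integrableZ (-1) hi) fi).1.
have [w [wi wE _]] := volterra_L2 (square_integrableM c0V_measurable c0V_le fhi).1.
exists w; split => // x xL.
rewrite (jet_operatorE a (cintegrable_square wi) xL) (wE x xL) mulrA divff ?c0_neq0//.
by rewrite mul1r mulN1r addrAC addNr add0r.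
Qed.

(** The constants of [L2_sqr_ip0] summed over all derivatives, times those of [volterra_L2] and of
    the division by [c ord0]. *)
Let C0 : R := (\sum_(k < m.+1)
    (if (m - k)%N is j'.+1 then (L ^+ j') ^+ 2 * L * (4 * L) else 1)) *
  ((2 * (K ^+ 2 * L * (4 * L)) + 2) * B ^+ 2).

(** Taking all constants of integration to be 0 makes [u] and its derivatives iterated primitives of
    [w], with norms controlled by [w] alone. *)
Lemma edge_lift f : square_integrable L f ->
  exists u, [/\ H u, ae_eqI f (T u) & sobolev_norm L m u ^+ 2 <= C0 * L2_sqr L f].
Proof.
move=> fi; have [gi gle] := square_integrableM c0V_measurable c0V_le fi.
have [w [wi wE wle]] := volterra_L2 gi.
have ju := jet_ip L0 m (fun=> 0) wi; have [_ Hu uj] := ju.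
exists (ip (fun=> 0) w m); split; first exact: Hu.
  apply: (ae_mono _ (edge_jet ju)) => x e Ix.
  have xL : 0 <= x <= L by move: Ix; rewrite /= in_itv.
  rewrite (e Ix) (jet_operatorE _ (cintegrable_square wi) xL) (wE x xL).
  rewrite mulrA divff ?c0_neq0// mul1r big1 ?addr0// => j _.
  by rewrite ip00 mulr0.
rewrite sobolev_normE /C0 -mulrA mulr_suml; apply: ler_sum => k _.
set C1 := 2 * _ + 2.
have km : (m - k <= m)%N by exact: leq_subr.
have ek : ae_eqI (wd k (ip (fun=> 0) w m)) (ip (fun=> 0) w (m - k)).
  by have := uj _ km; rewrite subKn// -ltnS.
rewrite (L2_sqr_ae_eq _ _ ek).
- apply: (le_trans (L2_sqr_ip0 _ wi)); apply: ler_wpM2l.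
    by case: (m - k)%N => // j; rewrite mulr_ge0//; rewrite mulr_ge0 ?sqr_ge0//; exact: ltW.
  apply: (le_trans wle); rewrite -[leRHS]mulrA; apply: ler_wpM2l => //.
  apply: addr_ge0 => //; apply: mulr_ge0 => //; apply: mulr_ge0; last first.
    by rewrite mulr_ge0// ltW.
  by rewrite mulr_ge0 ?sqr_ge0// ltW.
- have km' : (k <= m)%N by rewrite -ltnS.
  exact: (square_measurable (weak_derivativeP Hu km').1).
exact: (square_measurable (ip_square L0 _ _ wi)).
Qed.

(** With zero constants, [T u = 0] gives [w = - V w] only almost everywhere. The representative
    [w' = - V w] satisfies it at every point, [V] being insensitive to null sets, and the a priori
    estimate with [g = 0] then yields [w' = 0]. *)
Lemma edge_injective a w u : is_jet L m a w u -> (forall j, (j < m)%N -> a j = 0) ->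
  ae_eqI (T u) (fun=> 0) -> sobolev_norm L m u = 0.
Proof.
move=> ju a0 Tu0; have [wi _ _] := ju; have ci := cintegrable_square wi.
have ju0 := jet_eq (b := fun=> 0) a0 ju.
pose w' := fun x => - V w x.
have ww' : ae_eqI w w'.
  apply: (ae_mono2 _ (edge_jet ju0) Tu0) => x e1 e2 Ix.
  have xL : 0 <= x <= L by move: Ix; rewrite /= in_itv.
  have := e2 Ix; rewrite (e1 Ix) (jet_operatorE _ ci xL) big1 => [|j _]; last first.
    by rewrite ip00 mulr0.
  move=> /eqP; rewrite addr0 mulf_eq0 (negbTE (c0_neq0 xL)) /= addr_eq0 => /eqP.
  exact.
have ci' : cintegrable L w'.
  have := cintegrableB (cintegrable0 L) (V_int ci).
  by rewrite (_ : (fun x => _) = w')//; apply/funext => x; rewrite sub0r.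
have w'E (x : R) : 0 <= x <= L -> w' x + V w' x = (fun=> 0) x.
  move=> xL; rewrite (_ : V w' x = V w x) ?addNr// /V; congr (_ * _).
  apply: eq_bigr => j _; congr (_ * _); apply: esym.
  exact: (ip0_ae_eq j ci ci' ww' xL).
apply: (jet_null ju a0); apply: (ae_mono _ ww') => x e Ix.
have xL : 0 <= x <= L by move: Ix; rewrite /= in_itv.
rewrite (e Ix); apply: norm1_eq0.
have := volterra_apriori M_gt0 V_le ci' (cintegrable0 L) w'E xL.
rewrite subr0 norm1_0 (_ : J (fun=> 0) L = 0) ?mulr0 ?mul0r//.
by rewrite /J /Rintegral integral0.
Qed.

Lemma edge_sum0 (s : seq 'I_m) (y : 'I_m -> R -> R[i]) (k : 'I_m -> R[i]) :
  (forall i, H (y i)) -> (forall i, ae_eqI (T (y i)) (fun=> 0)) ->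
  H (fun x => \sum_(i <- s) k i * y i x) /\
  ae_eqI (T (fun x => \sum_(i <- s) k i * y i x)) (fun=> 0).
Proof.
move=> Hy Ty; elim: s => [|i s [IHs1 IHs2]].
  rewrite (_ : (fun x => _) = fun=> 0); last by apply/funext => x; rewrite big_nil.
  have j0 := jet0 L0 m; split; first by case: j0.
  apply: (ae_mono _ (edge_jet j0)) => x e Ix; rewrite (e Ix) /jet_operator big1// => j _.
  by rewrite ip00 mulr0.
rewrite (_ : (fun x => _) = fun x => k i * y i x + \sum_(i <- s) k i * y i x); last first.
  by apply/funext => x; rewrite big_cons.
split; first exact: (sobolev_lin (k i) (Hy i) IHs1).1.
have e2 : ae_eqI (fun x => k i * T (y i) x + T (fun x => \sum_(i <- s) k i * y i x) x) (fun=> 0).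
  by apply: (ae_mono2 _ (Ty i) IHs2) => x e1 e2 Ix; rewrite (e1 Ix) (e2 Ix) mulr0 addr0.
by apply: (ae_mono2 _ (edge_lin (k i) (Hy i) IHs1) e2) => x h1 h2 Ix; rewrite (h1 Ix) (h2 Ix).
Qed.

(** Solutions of the homogeneous equation are determined by their constants of integration: those
    with zero constants are null by [edge_injective], and null functions have zero constants by
    [jet_null_coef]. *)
Lemma edge_kernel : exists y : 'I_m -> R -> R[i],
  [/\ forall i, H (y i), forall i, ae_eqI (T (y i)) (fun=> 0),
    forall u, H u -> ae_eqI (T u) (fun=> 0) -> exists k : 'I_m -> R[i],
      sobolev_norm L m (fun x => u x - \sum_(i < m) k i * y i x) = 0 &
    forall k : 'I_m -> R[i],
      sobolev_norm L m (fun x => \sum_(i < m) k i * y i x) = 0 -> forall i, k i = 0].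
Proof.
(* The constants of [y i] are the [i]-th unit vector, so the constants of a combination of the [y i]
   are its coefficients. *)
pose d (i : 'I_m) (j : nat) : R[i] := (j == i)%:R.
have /choice[w wP] (i : 'I_m) := jet_operator_surjective (d i) (square_integrable0 L).
pose y i := ip (d i) (w i) m.
have jy i : is_jet L m (d i) (w i) (y i) := jet_ip L0 m (d i) (wP i).1.
have Hy i : H (y i) by case: (jy i).
have Ty i : ae_eqI (T (y i)) (fun=> 0).
  apply: (ae_mono _ (edge_jet (jy i))) => x e Ix; rewrite (e Ix) (wP i).2//.
have sum_d (k : 'I_m -> R[i]) (i : 'I_m) : \sum_(j < m) k j * d j i = k i.
  rewrite (bigD1 i)//= /d eqxx mulr1 big1 ?addr0// => j ji.
  by rewrite (eq_sym (i : nat)) (negbTE ji : (j == i :> nat) = false) mulr0.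
exists y; split=> [//|//|u Hu Tu|k k0].
- have [a ju] := jet_exists L0 Hu.
  exists (fun i => a i).
  have uE : (fun x => u x - \sum_(i < m) a i * y i x) =
      (fun x => -1 * (\sum_(i < m) a i * y i x) + u x).
    by apply/funext => x; rewrite mulN1r addrC.
  rewrite uE.
  have js := jet_sum L0 (index_enum 'I_m) (fun i : 'I_m => a i) jy.
  have jl := jet_lin (-1) js ju.
  have [Hs Ts] := edge_sum0 (index_enum 'I_m) (fun i : 'I_m => a i) Hy Ty.
  apply: (edge_injective jl) => [j jm|].
    by have := sum_d (fun i => a i) (Ordinal jm) => /= ->; rewrite mulN1r addNr.
  have e2 : ae_eqI (fun x => -1 * T (fun x => \sum_(i < m) a i * y i x) x + T u x) (fun=> 0).
    by apply: (ae_mono2 _ Ts Tu) => x e1 e2 Ix; rewrite (e1 Ix) (e2 Ix) mulr0 addr0.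
  by apply: (ae_mono2 _ (edge_lin (-1) Hs Hu) e2) => x h1 h2 Ix; rewrite (h1 Ix) (h2 Ix).
have js := jet_sum L0 (index_enum 'I_m) k jy.
by move=> i; have := jet_null_coef L0 js k0 (ltn_ord i); rewrite sum_d.
Qed.

End coefficients.
End edge_operator.

(** * The continuous leading coefficient and its inverse *)

Section continuous_coefficient.
Variables (R : realType) (L : R).
Hypothesis L0 : 0 < L.
Local Notation I := (`[0, L]%classic : set R).
Implicit Types (h : R -> R) (c : R -> R[i]).

Definition within_continuous h := forall x, I x -> h t @[t --> within I (nbhs x)] --> h x.

Lemma within_continuousP h : within_continuous h <-> {within I, continuous h}.
Proof. by split => /subspace_continuousP. Qed.

Lemma within_continuous_measurable h : within_continuous h ->
  measurable_fun (I : set (caratheodory_type (wlength (@idfun R))^*%mu)) h.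
Proof.
move=> /within_continuousP hc _ Y mY; apply: borel_lebesgue_measurable.
by apply: (subspace_continuous_measurable_fun _ hc _ mY); exact: measurable_itv.
Qed.

Lemma within_continuous_ReIm c : {within I, continuous (c : R -> (R[i])^o)} ->
  within_continuous (fun x => complex.Re (c x)) /\ within_continuous (fun x => complex.Im (c x)).
Proof.
move=> /subspace_continuousP cc.
have h x (e : R) : I x -> 0 < e ->
    \forall t \near within I (nbhs x), Normc.normc (c x - c t) < e.
  (* The norm of [R[i]] over itself takes values in [R[i]], so the tolerance has to be the complex
     number [e%:C]. *)
  move=> Ix e0; have e0' : 0 < e%:C by rewrite ltcR.
  have F : Filter (within I (nbhs x)) by exact: within_filter.
  have /(_ F) := cvgr_dist_lt _ _ (cc x Ix) _ e0'.
  apply: filterS => t; rewrite normc_def ltcR.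
  by case: (c x - c t).
by split=> x Ix; apply/cvgrPdist_lt => e e0; apply: filterS (h x e Ix e0) => t;
  have [h1 h2] := ReIm_le_normc (c x - c t); apply: le_lt_trans;
  [rewrite (_ : _ - _ = complex.Re (c x - c t))//|rewrite (_ : _ - _ = complex.Im (c x - c t))//];
  case: (c x) (c t) => [? ?] [? ?].
Qed.

(** Everything goes through the squared modulus [n2], which is real, continuous and positive:
    [(c x)^-1] is the conjugate of [c x] divided by [n2 x], and the extreme values of [n2] on the
    compact interval bound both [c] and its inverse. *)
Lemma continuous_coefficient c : {within I, continuous (c : R -> (R[i])^o)} ->
  (forall x, 0 <= x <= L -> c x != 0) ->
  [/\ lebesgue_measurable L c, lebesgue_measurable L (fun x => (c x)^-1) &
    exists B, forall x, 0 <= x <= L -> Normc.normc (c x) <= B /\ Normc.normc (c x)^-1 <= B].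
Proof.
move=> /within_continuous_ReIm[c1 c2] c0.
pose n2 x := complex.Re (c x) ^+ 2 + complex.Im (c x) ^+ 2.
have n2c : within_continuous n2.
  by move=> x Ix; apply: cvgD; apply: cvgM; [exact: c1|exact: c1|exact: c2|exact: c2].
have n2E x : Normc.normc (c x) = Num.sqrt (n2 x) by rewrite /n2; case: (c x).
have n20 x : 0 <= x <= L -> 0 < n2 x.
  move=> /c0 cx; rewrite lt_neqAle addr_ge0 ?sqr_ge0// andbT eq_sym.
  apply: contra_neq cx => nx; apply: Normc.eq0_normc.
  by rewrite n2E nx sqrtr0.
have n2V : within_continuous (fun x => (n2 x)^-1).
  move=> x Ix; apply: cvgV; last exact: n2c.
  by rewrite gt_eqF// n20//; move: Ix; rewrite /= in_itv.
have n2cw : {within I, continuous n2} by exact/within_continuousP.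
have [xM _ xMP] := EVT_max (ltW L0) n2cw.
have [xm xmI xmP] := EVT_min (ltW L0) n2cw.
split.
- by split; exact: within_continuous_measurable.
- split; apply: within_continuous_measurable => x Ix.
    rewrite (_ : (fun t => _) = (fun t => complex.Re (c t) * (n2 t)^-1)).
      by rewrite (_ : complex.Re (c x)^-1 = complex.Re (c x) * (n2 x)^-1);
        [apply: cvgM; [exact: c1|exact: n2V]|rewrite /n2; case: (c x)].
    by apply/funext => t; rewrite /n2; case: (c t).
  rewrite (_ : (fun t => _) = (fun t => - (complex.Im (c t) * (n2 t)^-1))).
    by rewrite (_ : complex.Im (c x)^-1 = - (complex.Im (c x) * (n2 x)^-1));
      [apply: cvgN; apply: cvgM; [exact: c2|exact: n2V]|rewrite /n2; case: (c x)].
  by apply/funext => t; rewrite /n2; case: (c t).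
exists (Num.sqrt (n2 xM) + (Num.sqrt (n2 xm))^-1) => x xI.
have xI' : x \in `[0, L] by rewrite in_itv.
have p1 : Num.sqrt (n2 x) <= Num.sqrt (n2 xM) by rewrite ler_wsqrtr// xMP.
have xm0 : 0 < n2 xm by apply: n20; move: xmI; rewrite in_itv.
have p2 : Num.sqrt (n2 xm) <= Num.sqrt (n2 x) by rewrite ler_wsqrtr// xmP.
split; first by rewrite n2E (le_trans p1)// lerDl invr_ge0 sqrtr_ge0.
rewrite Normc.normcV n2E (@le_trans _ _ (Num.sqrt (n2 xm))^-1)//.
  by rewrite lef_pV2// ?posrE ?sqrtr_gt0//; exact: n20.
by rewrite lerDr sqrtr_ge0.
Qed.

End continuous_coefficient.

(** * Square sums of norms over the edges *)

Section graph_norm.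
Variables (R : realType) (E : finType) (car : E -> set (R -> R[i]))
  (N : E -> (R -> R[i]) -> R).
Hypothesis N_ge0 : forall e u, 0 <= N e u.
Hypothesis car0 : forall e, car e (fun=> 0).
Hypothesis car_lin : forall e a u v, car e u -> car e v ->
  car e (fun x => a * u x + v x).
Hypothesis N_add : forall e u v, car e u -> car e v ->
  N e (fun x => u x + v x) ^+ 2 <= 2 * N e u ^+ 2 + 2 * N e v ^+ 2.
Hypothesis N_scale : forall e a u, car e u ->
  N e (fun x => a * u x) = Normc.normc a * N e u.

(** The common shape of [sobolev_graph] and [L2_graph], so that both are treated at once. *)
Definition sum_seminormed : seminormed R :=
  @Seminormed R (E -> R -> R[i]) [set u | forall e, car e (u e)]
    (fun u => Num.sqrt (\sum_e N e (u e) ^+ 2)).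

Lemma sum_seminorm_eq0 (u : ambient sum_seminormed) :
  seminorm u = 0 <-> forall e, N e (u e) = 0.
Proof.
split=> [/eqP + e|u0].
  rewrite sqrtr_eq0 => u0.
  have : \sum_e N e (u e) ^+ 2 == 0 by rewrite eq_le u0 sumr_ge0// => ? _; exact: sqr_ge0.
  rewrite psumr_eq0 => [|i _]; last exact: sqr_ge0.
  by move=> /allP /(_ e (mem_index_enum _)); rewrite sqrf_eq0 => /eqP.
by rewrite /= big1 ?sqrtr0// => e _; rewrite u0 expr0n.
Qed.

Lemma sum_seminorm_le (u : ambient sum_seminormed) (a : R) :
  0 <= a -> \sum_e N e (u e) ^+ 2 <= a ^+ 2 -> seminorm u <= a.
Proof.
by move=> a0 ua; rewrite -[leRHS]ger0_norm// -sqrtr_sqr; exact: ler_wsqrtr.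
Qed.

Lemma sum_seminorm_sqr (u : ambient sum_seminormed) :
  seminorm u ^+ 2 = \sum_e N e (u e) ^+ 2.
Proof. by rewrite sqr_sqrtr// sumr_ge0// => e _; exact: sqr_ge0. Qed.

Lemma sum_quasi_seminormed : quasi_seminormed sum_seminormed.
Proof.
split.
- split; first by move=> e; exact: car0.
  by move=> a u v Hu Hv e; exact: (car_lin a (Hu e) (Hv e)).
- by move=> u; exact: sqrtr_ge0.
- move=> u v Hu Hv; apply: sum_seminorm_le => //.
    by rewrite mulr_ge0// addr_ge0// sqrtr_ge0.
  have p : 0 <= seminorm u * seminorm v by rewrite mulr_ge0// sqrtr_ge0.
  (* The square of [2 * (a + b)] dominates [2 * a ^+ 2 + 2 * b ^+ 2] because [a * b >= 0]. *)
  apply: (@le_trans _ _ (2 * seminorm u ^+ 2 + 2 * seminorm v ^+ 2)); last first.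
    have := sqr_ge0 (seminorm u); have := sqr_ge0 (seminorm v).
    by move: p; move: (seminorm u) (seminorm v) => a b *; nra.
  rewrite !sum_seminorm_sqr !mulr_sumr -big_split; apply: ler_sum => e _.
  exact: (N_add (Hu e) (Hv e)).
move=> a u Hu.
have a0 := normc_ge0 a.
rewrite -[RHS]ger0_norm ?mulr_ge0 ?sqrtr_ge0// -sqrtr_sqr exprMn sum_seminorm_sqr.
by congr Num.sqrt; rewrite mulr_sumr; apply: eq_bigr => e _; rewrite -exprMn -N_scale.
Qed.

End graph_norm.

(** * Norm properties on one edge *)

Section function_spaces.
Variables (R : realType) (L : R).
Hypothesis L0 : 0 < L.
Implicit Types (u v : R -> R[i]).

Lemma L2_norm_ge0 u : 0 <= L2_norm L u.
Proof. exact: sqrtr_ge0. Qed.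

Lemma L2_norm_eq0 u : L2_norm L u = 0 <-> L2_sqr L u = 0.
Proof.
rewrite -L2_normE; split=> [->|/eqP]; first by rewrite expr0n.
by rewrite sqrf_eq0 => /eqP.
Qed.

Lemma L2_norm_add u v : square_integrable L u -> square_integrable L v ->
  L2_norm L (fun x => u x + v x) ^+ 2 <= 2 * L2_norm L u ^+ 2 + 2 * L2_norm L v ^+ 2.
Proof. by move=> ui vi; rewrite !L2_normE; exact: (square_integrableD ui vi).2. Qed.

Lemma L2_norm_scale (a : R[i]) u : square_integrable L u ->
  L2_norm L (fun x => a * u x) = Normc.normc a * L2_norm L u.
Proof.
move=> ui; apply/eqP; rewrite -(@eqrXn2 _ 2)// ?mulr_ge0 ?normc_ge0 ?L2_norm_ge0//.
by rewrite exprMn !L2_normE (L2_sqrZ a ui).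
Qed.

Lemma sqr_sum_le n (A B C : R) (a b c : 'I_n -> R) :
  A ^+ 2 = \sum_i a i -> B ^+ 2 = \sum_i b i -> C ^+ 2 = \sum_i c i ->
  (forall i, a i <= 2 * b i + 2 * c i) -> A ^+ 2 <= 2 * B ^+ 2 + 2 * C ^+ 2.
Proof.
move=> -> -> -> abc; rewrite !mulr_sumr -big_split.
by apply: ler_sum => i _; exact: abc.
Qed.

Lemma sqr_sum_scale n (A B z : R) (a b : 'I_n -> R) :
  A ^+ 2 = \sum_i a i -> B ^+ 2 = \sum_i b i ->
  (forall i, a i = z ^+ 2 * b i) -> A ^+ 2 = (z * B) ^+ 2.
Proof.
move=> Aa Bb ab; rewrite exprMn Aa Bb mulr_sumr.
by apply: eq_bigr => i _; exact: ab.
Qed.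

Variable m : nat.
Local Notation H := (sobolev L m).
Local Notation wd := (weak_derivative L).

Lemma sobolev_norm_ge0 u : 0 <= sobolev_norm L m u.
Proof. exact: sqrtr_ge0. Qed.

Lemma sobolev0 : H (fun=> 0).
Proof. by case: (jet0 L0 m). Qed.

Lemma sobolev_norm0 : sobolev_norm L m (fun=> 0) = 0.
Proof. by apply: (jet_null (jet0 L0 m)) => [//|]; exact: aeW. Qed.

Lemma sobolev_norm_add u v : H u -> H v ->
  sobolev_norm L m (fun x => u x + v x) ^+ 2 <=
  2 * sobolev_norm L m u ^+ 2 + 2 * sobolev_norm L m v ^+ 2.
Proof.
move=> Hu Hv; have [Hl lE] := sobolev_lin 1 Hu Hv.
rewrite (_ : (fun x => 1 * u x + v x) = fun x => u x + v x) in Hl lE; last first.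
  by apply/funext => x; rewrite mul1r.
have nE := @sobolev_normE R L m.
apply: (sqr_sum_le (nE _) (nE _) (nE _)) => k.
have km : (k <= m)%N by rewrite -ltnS.
have [ui _] := weak_derivativeP Hu km; have [vi _] := weak_derivativeP Hv km.
have [li _] := weak_derivativeP Hl km.
have [si sle] := square_integrableD ui vi.
rewrite (L2_sqr_ae_eq (square_measurable li) (square_measurable si))//.
by apply: ae_mono (lE k km) => x h Ix; rewrite (h Ix) mul1r.
Qed.

Lemma sobolev_norm_scale (a : R[i]) u : H u ->
  sobolev_norm L m (fun x => a * u x) = Normc.normc a * sobolev_norm L m u.
Proof.
move=> Hu; have [Hl lE] := sobolev_lin a Hu sobolev0.
rewrite (_ : (fun x => a * u x + 0) = fun x => a * u x) in Hl lE; last first.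
  by apply/funext => x; rewrite addr0.
(* The chosen weak derivatives of the zero function are known to be 0 only almost everywhere. *)
have z0 := (sobolev_norm_eq0 sobolev0).1 sobolev_norm0.
apply/eqP; rewrite -(@eqrXn2 _ 2)// ?mulr_ge0 ?normc_ge0 ?sobolev_norm_ge0//.
have nE := @sobolev_normE R L m.
apply/eqP; apply: (sqr_sum_scale (nE _) (nE _)) => k.
have km : (k <= m)%N by rewrite -ltnS.
have [ui _] := weak_derivativeP Hu km; have [li _] := weak_derivativeP Hl km.
rewrite -(L2_sqrZ a ui).
apply: (L2_sqr_ae_eq (square_measurable li) (square_measurable (square_integrableZ a ui))).
by apply: (ae_mono2 _ (lE k km) (z0 k km)) => x h1 h2 Ix; rewrite (h1 Ix) (h2 Ix) addr0.
Qed.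

End function_spaces.

(** Gathers the results on an edge with norms in place of almost everywhere equalities and with one
    constant [C], the form that can be summed over the edges. *)
Lemma edge_operator (R : realType) (L : R) (m : nat) (c : 'I_m.+1 -> R -> R[i]) :
  0 < L ->
  {within `[0, L], continuous (c ord0 : R -> (R[i])^o)} ->
  (forall x : R, 0 <= x <= L -> c ord0 x != 0) ->
  (forall j, j != ord0 -> lebesgue_measurable L (c j)) ->
  (forall j, j != ord0 ->
    exists M : R, forall x : R, 0 <= x <= L -> Normc.normc (c j x) <= M) ->
  let T u x := \sum_(j < m.+1) c j x * weak_derivative L (m - j) u x in
  exists C : R, 0 <= C /\
  [/\ forall u, sobolev L m u -> square_integrable L (T u) /\
        L2_norm L (T u) ^+ 2 <= C * sobolev_norm L m u ^+ 2,
      forall z u v, sobolev L m u -> sobolev L m v ->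
        L2_norm L (fun x => T (fun t => z * u t + v t) x - (z * T u x + T v x)) = 0,
      forall f, square_integrable L f -> exists u, [/\ sobolev L m u,
        L2_norm L (fun x => f x - T u x) = 0 &
        sobolev_norm L m u ^+ 2 <= C * L2_norm L f ^+ 2] &
      exists y : 'I_m -> R -> R[i], [/\ forall i, sobolev L m (y i),
        forall i, L2_norm L (T (y i)) = 0,
        forall u, sobolev L m u -> L2_norm L (T u) = 0 -> exists k : 'I_m -> R[i],
          sobolev_norm L m (fun x => u x - \sum_(i < m) k i * y i x) = 0 &
        forall k : 'I_m -> R[i],
          sobolev_norm L m (fun x => \sum_(i < m) k i * y i x) = 0 -> forall i, k i = 0]].
Proof.
move=> L0 cc c0 cm cb T.
have [m0 mV [B B0]] := continuous_coefficient L0 cc c0.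
have mc j : lebesgue_measurable L (c j) by have [->|/cm] := eqVneq j ord0.
have /choice[A AP] j : exists M : R, forall x : R, 0 <= x <= L -> Normc.normc (c j x) <= M.
  by have [->|/cb//] := eqVneq j ord0; exists B => x /B0[].
have A_ge0 j : 0 <= A j.
  by apply: le_trans (AP j 0 _); [exact: normc_ge0|rewrite lexx ltW].
have cA j (x : R) : 0 <= x <= L -> Normc.normc (c j x) <= \sum_j A j.
  by move=> /(AP j) h; rewrite (le_trans h)// (bigD1 j)//= lerDl sumr_ge0.
have cB (x : R) : 0 <= x <= L -> Normc.normc (c ord0 x)^-1 <= B by move=> /B0[].
have [C1 bd] : exists C1, forall u, sobolev L m u -> square_integrable L (T u) /\
    L2_sqr L (T u) <= C1 * sobolev_norm L m u ^+ 2.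
  by eexists; exact: (edge_bounded mc cA).
have [C2 lift] : exists C2, forall f, square_integrable L f -> exists u, [/\ sobolev L m u,
    {ae @completed_lebesgue_measure R, forall x, `[0, L]%classic x -> f x = T u x} &
    sobolev_norm L m u ^+ 2 <= C2 * L2_sqr L f].
  by eexists; exact: (edge_lift L0 mc cA c0 mV cB).
have ker := edge_kernel L0 mc cA c0 mV cB.
have mT u : sobolev L m u -> lebesgue_measurable L (T u).
  by move=> /bd[/square_measurable].
have T0 u : sobolev L m u -> L2_norm L (T u) = 0 <->
    {ae @completed_lebesgue_measure R, forall x, `[0, L]%classic x -> T u x = (fun=> 0) x}.
  move=> Hu; rewrite L2_norm_eq0; split; first exact: (L2_sqr_eq0 (bd u Hu).1).
  move=> h; rewrite -(L2_sqr_fun0 L); apply: L2_sqr_ae_eq h; first exact: mT.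
  exact: lebesgue_measurable_cst.
(* One nonnegative constant serves for the boundedness of [T] and for that of its right inverse. *)
exists (`|C1| + `|C2|); split; first by rewrite addr_ge0.
split.
- move=> u Hu; have [Ti Tle] := bd u Hu; split => //; rewrite L2_normE (le_trans Tle)//.
  by apply: ler_wpM2r; [exact: sqr_ge0|rewrite (le_trans (ler_norm _))// lerDl].
- move=> z u v Hu Hv; apply/L2_norm_eq0; apply: L2_sqr_sub_eq0 (edge_lin c z Hu Hv).
    by apply: mT; exact: (sobolev_lin z Hu Hv).1.
  apply: lebesgue_measurableD (mT v Hv).
  by apply: lebesgue_measurableM (mT u Hu); exact: lebesgue_measurable_cst.
- move=> f fi; have [u [Hu fu ule]] := lift f fi; exists u; split; first exact: Hu.
    by apply/L2_norm_eq0; apply: L2_sqr_sub_eq0 fu; [exact: square_measurable|exact: mT].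
  rewrite L2_normE (le_trans ule)//; apply: ler_wpM2r; first exact: L2_sqr_ge0.
  by rewrite (le_trans (ler_norm _))// lerDr.
have [y [Hy Ty ygen yfree]] := ker; exists y; split; [exact: Hy| | |exact: yfree].
  by move=> i; exact: ((T0 _ (Hy i)).2 (Ty i)).
by move=> u Hu /(T0 u Hu); exact: ygen.
Qed.

(** * The operator on the graph *)

Section differential_operator.
Variables (R : realType) (G : quantum_graph R) (m : nat).
Local Notation X := (sobolev_graph G m).
Local Notation Y := (L2_graph G).
Implicit Types (u v : ambient X).

Lemma quasi_seminormed_sobolev : quasi_seminormed X.
Proof.
apply: (@sum_quasi_seminormed _ _ (fun e => sobolev (length e) m)
  (fun e => sobolev_norm (length e) m)).
- by move=> e; exact: (sobolev0 (length_gt0 e)).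
- by move=> e a u v Hu Hv; exact: (sobolev_lin a Hu Hv).1.
- by move=> e u v Hu Hv; exact: sobolev_norm_add.
by move=> e a u Hu; exact: (sobolev_norm_scale (length_gt0 e) a Hu).
Qed.

Lemma quasi_seminormed_L2 : quasi_seminormed Y.
Proof.
apply: (@sum_quasi_seminormed _ _ (fun e => square_integrable (length e))
  (fun e => L2_norm (length e))).
- by move=> e; exact: square_integrable0.
- by move=> e a u v ui vi; exact: (square_integrableD (square_integrableZ a ui) vi).1.
- by move=> e u v ui vi; exact: L2_norm_add.
by move=> e a u ui; exact: L2_norm_scale.
Qed.

Lemma sobolev_seminorm_eq0 u :
  seminorm u = 0 <-> forall e, sobolev_norm (length e) m (u e) = 0.
Proof.
by apply: (@sum_seminorm_eq0 _ _ (fun e => sobolev (length e) m)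
  (fun e => sobolev_norm (length e) m)).
Qed.

Lemma L2_seminorm_eq0 (f : ambient Y) :
  seminorm f = 0 <-> forall e, L2_norm (length e) (f e) = 0.
Proof.
by apply: (@sum_seminorm_eq0 _ _ (fun e => square_integrable (length e))
  (fun e => L2_norm (length e))).
Qed.

Lemma sum_sqr_le (F : finType) (p q : F -> R) (C : R) :
  (forall e, p e ^+ 2 <= C * q e ^+ 2) ->
  Num.sqrt (\sum_e p e ^+ 2) <= Num.sqrt C * Num.sqrt (\sum_e q e ^+ 2).
Proof.
move=> pq; have [C0|C0] := leP 0 C.
  rewrite -sqrtrM//; apply: ler_wsqrtr; rewrite mulr_sumr.
  by apply: ler_sum => e _; exact: pq.
(* For [C < 0] every [p e ^+ 2] is at most 0, so the left-hand side vanishes. *)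
rewrite (_ : Num.sqrt (\sum_e p e ^+ 2) = 0) ?mulr_ge0 ?sqrtr_ge0//.
apply/eqP; rewrite sqrtr_eq0; apply: sumr_le0 => e _.
by rewrite (le_trans (pq e))// nmulr_rle0// sqr_ge0.
Qed.

Lemma sum_apply n (k : 'I_n -> R[i]) (b : 'I_n -> ambient X) e x :
  (\sum_(i < n) k i *: b i) e x = \sum_(i < n) k i * b i e x.
Proof. by elim/big_rec2: _ => [//|i _ w _ <-]. Qed.

Variable c : 'I_m.+1 -> edge G -> R -> R[i].
Hypothesis c0_continuous : forall e : edge G,
  {within `[0, length e], continuous (c ord0 e : R -> (R[i])^o)}.
Hypothesis c0_neq0 : forall (e : edge G) (x : R), x \in `[0, length e] ->
  c ord0 e x != 0.
Hypothesis c_measurable : forall (j : 'I_m.+1) (e : edge G), j != ord0 ->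
  lebesgue_measurable (length e) (c j e).
Hypothesis c_bounded : forall (j : 'I_m.+1) (e : edge G), j != ord0 ->
  exists M : R, forall x : R, x \in `[0, length e] -> `|c j e x| <= M%:C.
Local Notation T := (differential_operator c : ambient X -> ambient Y).

Let c0_neq0' e (x : R) : 0 <= x <= length e -> c ord0 e x != 0.
Proof. by move=> xe; apply: c0_neq0; rewrite in_itv. Qed.

Let c_normc e j : j != ord0 ->
  exists M : R, forall x : R, 0 <= x <= length e -> Normc.normc (c j e x) <= M.
Proof.
move=> /(@c_bounded _ e)[M MP]; exists M => x xe.
have := MP x; rewrite in_itv/= => /(_ xe); rewrite normc_def lecR.
by case: (c j e x).
Qed.

Lemma differential_operator_facts : exists C : R,
  [/\ bounded_operator T,
      forall f : ambient Y, carrier f -> exists u : ambient X,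
        [/\ carrier u, seminorm (f - T u) = 0 & seminorm u <= C * seminorm f] &
      has_quotient_dim (Defs.kernel T) (@null _ X) (m * #|edge G|)].
Proof.
have /choice[C CP] := fun e => @edge_operator R (length e) m (fun j => c j e)
  (length_gt0 e) (@c0_continuous e) (@c0_neq0' e) (fun j => @c_measurable j e) (@c_normc e).
have CP1 e : C e <= \sum_e C e.
  by rewrite (bigD1 e)//= lerDl sumr_ge0// => e' _; case: (CP e').
exists (Num.sqrt (\sum_e C e)); split.
- split.
  + by move=> u Hu e; have [_ [+ _ _ _]] := CP e; move=> /(_ _ (Hu e))[].
  + move=> z u v Hu Hv; apply/L2_seminorm_eq0 => e.
    by have [_ [_ + _ _]] := CP e; exact.
  exists (Num.sqrt (\sum_e C e)) => u Hu; apply: sum_sqr_le => e.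
  have [_ [+ _ _ _]] := CP e; move=> /(_ _ (Hu e))[_ h].
  by apply: (le_trans h); apply: ler_wpM2r; [exact: sqr_ge0|exact: CP1].
- move=> f fi.
  have /choice[u uP] := fun e => let: conj _ (And4 _ _ h _) := CP e in h (f e) (fi e).
  exists u; split.
  + by move=> e; case: (uP e).
  + by apply/L2_seminorm_eq0 => e; case: (uP e).
  apply: sum_sqr_le => e; have [_ _ h] := uP e.
  by apply: (le_trans h); apply: ler_wpM2r; [exact: sqr_ge0|exact: CP1].
have /choice[y yP] e := let: conj _ (And4 _ _ _ h) := CP e in h.
(* The weak derivatives of the zero function are arbitrary representatives, so [T] need not send it
   to 0 at each point; its norm is 0 by the operator bound. *)
have T_zero e : L2_norm (length e) (fun x => \sum_(j < m.+1) c j e x *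
    weak_derivative (length e) (m - j) (fun=> 0) x) = 0.
  have [_ [+ _ _ _]] := CP e; move=> /(_ _ (sobolev0 (length_gt0 e) m))[_].
  rewrite (sobolev_norm0 (length_gt0 e) m) expr0n mulr0 => h.
  by apply/eqP; rewrite -sqrf_eq0 eq_le h sqr_ge0.
rewrite mulnC -[X in (_ * X)%N](card_ord m) -card_prod.
(* The basis is indexed by pairs of an edge and a kernel function on it, extended by 0 to the other
   edges. The coordinates on the edge [e] are then the [k (enum_rank (e, j))]. *)
pose P : finType := (edge G * 'I_m)%type.
pose b (i : 'I_#|P|) : ambient X := fun e =>
  if (enum_val i).1 == e then y e (enum_val i).2 else fun=> 0.
have bE k e x : (\sum_i k i *: b i) e x = \sum_j k (enum_rank (e, j)) * y e j x.
  rewrite sum_apply (reindex (@enum_rank P)); last exact/onW_bij/enum_rank_bij.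
  transitivity (\sum_(e' : edge G) \sum_(j < m)
      k (@enum_rank P (e', j)) * b (@enum_rank P (e', j)) e x).
    by rewrite pair_bigA; apply: eq_bigr => -[e' j] _.
  rewrite (bigD1 e)//= [X in _ + X]big1 ?addr0 => [|e' e'e]; last first.
    by rewrite big1// => j _; rewrite /b enum_rankK (negbTE e'e) mulr0.
  by apply: eq_bigr => j _; rewrite /b enum_rankK eqxx.
have Xb i : @carrier _ X (b i).
  move=> e; rewrite /b; case: ifP => _; last exact: (sobolev0 (length_gt0 e)).
  by have [+ _ _ _] := yP e; exact.
have sX : is_subspace (@carrier _ X) by case: quasi_seminormed_sobolev.
exists b; split.
- move=> i; split; first exact: Xb.
  apply/L2_seminorm_eq0 => e; rewrite /differential_operator /b; case: ifP => _.
    by have [_ + _ _] := yP e; exact.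
  exact: T_zero.
- move=> u [Hu /L2_seminorm_eq0 Tu].
  have /choice[k kP] e : exists k : 'I_m -> R[i],
      sobolev_norm (length e) m (fun x => u e x - \sum_(i < m) k i * y e i x) = 0.
    by have [_ _ + _] := yP e; move=> /(_ _ (Hu e) (Tu e)).
  exists (fun i => k (enum_val i).1 (enum_val i).2); split.
    apply: (subspaceB sX Hu); apply: (subspace_sum _ sX) => i.
    exact: (subspaceZ _ sX (Xb i)).
  apply/sobolev_seminorm_eq0 => e; rewrite -(kP e); congr sobolev_norm.
  apply/funext => x; congr (_ - _); rewrite bE.
  by apply: eq_bigr => j _; rewrite enum_rankK.
move=> k [_ /sobolev_seminorm_eq0 k0] i.
rewrite -(enum_valK i) [enum_val i]surjective_pairing.
have [_ _ _ free] := yP (enum_val i).1.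
apply: (free (fun j => k (enum_rank ((enum_val i).1, j)))).
rewrite -(k0 (enum_val i).1); congr sobolev_norm.
by apply/funext => x; rewrite bE.
Qed.

End differential_operator.

Theorem theorem14 (R : realType) (G : quantum_graph R) (m p : nat)
    (c : 'I_m.+1 -> edge G -> R -> R[i])
    (c0_continuous : forall e : edge G,
      {within `[0, length e], continuous (c ord0 e : R -> (R[i])^o)})
    (c0_neq0 : forall (e : edge G) (x : R), x \in `[0, length e] ->
      c ord0 e x != 0)
    (c_measurable : forall (j : 'I_m.+1) (e : edge G), j != ord0 ->
      lebesgue_measurable (length e) (c j e))
    (c_bounded : forall (j : 'I_m.+1) (e : edge G), j != ord0 ->
      exists M : R, forall x : R, x \in `[0, length e] -> `|c j e x| <= M%:C)
    (D : set (ambient (sobolev_graph G m)))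
    (D_subspace : is_subspace D)
    (D_closed : closed_in D)
    (D_codim : has_quotient_dim (@carrier R (sobolev_graph G m)) D p) :
  let T1 : ambient (restriction D) -> ambient (L2_graph G) :=
    differential_operator c in
  fredholm T1 /\
  fredholm_index T1 = (m * #|edge G|)%N%:Z - p%:Z.
Proof.
have [C [T_bounded T_lift T_kernel]] :=
  differential_operator_facts c0_continuous c0_neq0 c_measurable c_bounded.
exact: (fredholm_restriction (quasi_seminormed_sobolev G m) (quasi_seminormed_L2 G)
  T_bounded T_kernel T_lift D_subspace D_closed D_codim).
Qed.
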